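(* Let $R$ be a commutative Cohen-Macaulay ring with a dualizing $R$-module $D$ and a semidualizing $R$-module $C$, and let $C^{\dag}:=\mathrm{Hom}_R(C,D)$. Then \[ [(\mathcal{GP}_{C}(R),\mathcal{P}_{C}(R));(\mathcal{I}_{C^{\dag}}(R),\mathcal{GI}_{C^{\dag}}(R))] \] is a strong finite balanced system (in the category of $R$-modules). In particular, $(\mathcal{GP}_{C}(R),\mathcal{GI}_{C^{\dag}}(R))$ is a balanced pair with respect to $(\mathcal{GP}_{C}(R)^\wedge,\mathcal{GI}_{C^{\dag}}(R)^{\vee})$.
   Context: Rings are with unit; a Cohen-Macaulay ring is in particular noetherian. A finitely generated $R$-module $C$ is semidualizing if the homothety map $R\to\mathrm{Hom}_R(C,C)$ is an isomorphism and $\mathrm{Ext}^i_R(C,C)=0$ for all $i\ge1$; a dualizing module is a semidualizing module of finite injective dimension. Let $\mathcal{P}(R)$, $\mathcal{I}(R)$ be the classes of projective and injective $R$-modules. For a semidualizing module $C$ (the module $C^\dag$ is again semidualizing): $\mathcal{P}_C(R)=\{C\otimes_RP:P\in\mathcal{P}(R)\}$ and $\mathcal{I}_C(R)=\{\mathrm{Hom}_R(C,I):I\in\mathcal{I}(R)\}$ (closed under isomorphisms). $\mathcal{GP}_C(R)$ is the class of $C$-Gorenstein projective modules (in the sense of Holm and Jørgensen): modules $M$ with $\mathrm{Ext}^i_R(M,C\otimes_RP)=0$ for all $i\ge1$ and all $P\in\mathcal{P}(R)$, for which there is an exact sequence $0\to M\to C\otimes_RP^0\to C\otimes_RP^1\to\cdots$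 with $P^k\in\mathcal{P}(R)$ that remains exact after applying $\mathrm{Hom}_R(-,C\otimes_RQ)$ for every $Q\in\mathcal{P}(R)$. $\mathcal{GI}_C(R)$ is the class of $C$-Gorenstein injective modules: modules $N$ with $\mathrm{Ext}^i_R(\mathrm{Hom}_R(C,I),N)=0$ for all $i\ge1$ and all $I\in\mathcal{I}(R)$, for which there is an exact sequence $\cdots\to\mathrm{Hom}_R(C,I_1)\to\mathrm{Hom}_R(C,I_0)\to N\to0$ with $I_k\in\mathcal{I}(R)$ that remains exact after applying $\mathrm{Hom}_R(\mathrm{Hom}_R(C,J),-)$ for every $J\in\mathcal{I}(R)$. The following notions are for an abelian category $\mathcal{A}$ (here $\mathcal{A}=\mathsf{Mod}(R)$). $\mathrm{Ext}^n_{\mathcal{A}}(\mathcal{C},\mathcal{D})=0$ means vanishing for all pairs of objects of $\mathcal{C}$, $\mathcal{D}$. A class is pointed if it contains $0$. $\mathrm{id}_{\mathcal{C}}(\mathcal{D})=0$ means $\mathrm{Ext}^i_{\mathcal{A}}(\mathcal{C},\mathcal{D})=0$ for all $i\ge1$; $\mathrm{pd}_{\mathcal{C}}(\mathcal{D})=0$ means $\mathrm{Ext}^i_{\mathcal{A}}(\mathcal{D},\mathcal{C})=0$ for all $i\ge1$. $\omega$ is a relative cogenerator in $\mathcal{X}$ if $\omega\subseteq\mathcal{X}$ and for every $X\in\mathcal{X}$ there is a short exact sequence $0\to X\to W\to X'\to0$ with $W\in\omega$, $X'\in\mathcal{X}$. $\nu$ is a relative generator in $\mathcal{Y}$ if $\nu\subseteq\mathcal{Y}$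 and for every $Y\in\mathcal{Y}$ there is a short exact sequence $0\to Y'\to V\to Y\to0$ with $V\in\nu$, $Y'\in\mathcal{Y}$. $\mathcal{C}^\wedge$ is the class of objects $M$ admitting an exact sequence $0\to C_n\to\cdots\to C_0\to M\to0$ with $n\in\mathbb{N}$ and all $C_k\in\mathcal{C}$; $\mathcal{C}^\vee$ is the class of objects $N$ admitting an exact sequence $0\to N\to C^0\to\cdots\to C^n\to0$ with $n\in\mathbb{N}$ and all $C^k\in\mathcal{C}$. Finite balanced system. $[(\mathcal{X},\omega);(\nu,\mathcal{Y})]$ is a finite balanced system if: (fbs1) $\mathcal{X}$ is pointed and closed under extensions; (fbs2) $\mathcal{Y}$ is pointed and closed under extensions; (fbs3) $\omega$ is a relative cogenerator in $\mathcal{X}$ with $\mathrm{id}_{\mathcal{X}}(\omega)=0$; (fbs4) $\nu$ is a relative generator in $\mathcal{Y}$ with $\mathrm{pd}_{\mathcal{Y}}(\nu)=0$; (fbs5) $\mathrm{Ext}^1_{\mathcal{A}}(\mathcal{X}^\wedge,\nu)=\mathrm{Ext}^1_{\mathcal{A}}(\omega^\wedge,\mathcal{Y})=0$; (fbs6) $\mathrm{Ext}^1_{\mathcal{A}}(\omega,\mathcal{Y}^\vee)=\mathrm{Ext}^1_{\mathcal{A}}(\mathcal{X},\nu^\vee)=0$. It is strong if in addition $\mathrm{pd}_{\mathcal{Y}}(\omega)=0$ and $\mathrm{id}_{\mathcal{X}}(\nu)=0$. Resolutions. A left $\mathcal{X}$-resolution of $M$ is a (not necessarily exact) complex $\cdots\to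 X_1\to X_0\to M\to0$ with all $X_k\in\mathcal{X}$; it is proper if it becomes exact after applying $\mathrm{Hom}_{\mathcal{A}}(X,-)$ for every $X\in\mathcal{X}$. A right $\mathcal{Y}$-resolution of $N$ is a (not necessarily exact) complex $0\to N\to Y^0\to Y^1\to\cdots$ with all $Y^k\in\mathcal{Y}$; it is proper if it becomes exact after applying $\mathrm{Hom}_{\mathcal{A}}(-,Y)$ for every $Y\in\mathcal{Y}$. $\mathsf{p.l.res}(\mathcal{X})$ (resp. $\mathsf{p.r.res}(\mathcal{Y})$) is the class of objects admitting a proper left $\mathcal{X}$-resolution (resp. proper right $\mathcal{Y}$-resolution). A complex is $\mathrm{Hom}_{\mathcal{A}}(\mathcal{X},-)$-acyclic (resp. $\mathrm{Hom}_{\mathcal{A}}(-,\mathcal{Y})$-acyclic) if it becomes exact after applying $\mathrm{Hom}_{\mathcal{A}}(X,-)$ for every $X\in\mathcal{X}$ (resp. $\mathrm{Hom}_{\mathcal{A}}(-,Y)$ for every $Y\in\mathcal{Y}$). Balanced pair. $(\mathcal{X},\mathcal{Y})$ is a balanced pair with respect to $(\tilde{\mathcal{X}},\tilde{\mathcal{Y}})$ if: $\mathcal{X}\subseteq\tilde{\mathcal{X}}\subseteq\mathsf{p.l.res}(\mathcal{X})$ and $\mathcal{Y}\subseteq\tilde{\mathcal{Y}}\subseteq\mathsf{p.r.res}(\mathcal{Y})$; every $M\in\tilde{\mathcal{X}}$ has a $\mathrm{Hom}_{\mathcal{A}}(-,\mathcal{Y})$-acyclic proper left $\mathcal{X}$-resolution;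 every $N\in\tilde{\mathcal{Y}}$ has a $\mathrm{Hom}_{\mathcal{A}}(\mathcal{X},-)$-acyclic proper right $\mathcal{Y}$-resolution. *)

(* Defs.v *)
From HB Require Import structures.
From mathcomp Require Import all_boot all_order all_algebra.
From mathcomp Require Import boolp.

Set Implicit Arguments.
Unset Strict Implicit.
Unset Printing Implicit Defensive.

Import GRing.Theory.
Local Open Scope ring_scope.

(* The alias carries the R-module structure of Hom_R(U, V); the equality and
   choice structures on linear maps are the classical ones of boolp. *)
Definition lhom (R : comPzRingType) (U V : lmodType R) : Type :=
  {linear U -> V}.

Section HomModule.
Variables (R : comPzRingType) (U V : lmodType R).
Implicit Types (f g h : lhom U V) (a b : R).

HB.instance Definition _ := gen_eqMixin (lhom U V).
HB.instance Definition _ := gen_choiceMixin (lhom U V).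

Lemma lhomP f g : (forall u, f u = g u) -> f = g.
Proof.
case: f g => [f cf] [g cg] /= fg.
have {}fg : f = g by apply: funext.
case: _ / fg cg => -[[cg1] [cg2]]; case: cf => -[cf1] [cf2].
by rewrite (Prop_irrelevance cf1 cg1) (Prop_irrelevance cf2 cg2).
Qed.

Definition lhom_zero : lhom U V := \0.
Definition lhom_opp f : lhom U V := \- f.
Definition lhom_add f g : lhom U V := f \+ g.
Definition lhom_scale a f : lhom U V := a \*: f.

Lemma lhom_addA : associative lhom_add.
Proof. by move=> f g h; apply: lhomP => u; apply: addrA. Qed.
Lemma lhom_addC : commutative lhom_add.
Proof. by move=> f g; apply: lhomP => u; apply: addrC. Qed.
Lemma lhom_add0 : left_id lhom_zero lhom_add.
Proof. by move=> f; apply: lhomP => u; apply: add0r. Qed.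
Lemma lhom_addN : left_inverse lhom_zero lhom_opp lhom_add.
Proof. by move=> f; apply: lhomP => u; apply: addNr. Qed.

HB.instance Definition _ := GRing.isZmodule.Build (lhom U V)
  lhom_addA lhom_addC lhom_add0 lhom_addN.

Lemma lhom_scaleA a b f : lhom_scale a (lhom_scale b f) = lhom_scale (a * b) f.
Proof. by apply: lhomP => u; apply: scalerA. Qed.
Lemma lhom_scale1 : left_id 1 lhom_scale.
Proof. by move=> f; apply: lhomP => u; apply: scale1r. Qed.
Lemma lhom_scaleDr : right_distributive lhom_scale +%R.
Proof. by move=> a f g; apply: lhomP => u; apply: scalerDr. Qed.
Lemma lhom_scaleDl f : {morph lhom_scale^~ f : a b / a + b}.
Proof. by move=> a b; apply: lhomP => u; apply: scalerDl. Qed.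

HB.instance Definition _ := GRing.Zmodule_isLmodule.Build R (lhom U V)
  lhom_scaleA lhom_scale1 lhom_scaleDr lhom_scaleDl.

End HomModule.

Section HomFunctor.
Variables (R : comPzRingType) (A B X : lmodType R) (g : {linear A -> B}).

Definition hom_post (f : lhom X A) : lhom X B := g \o f.

Lemma hom_post_linear : linear hom_post.
Proof. by move=> a f h; apply: lhomP => u; apply: linearP. Qed.
HB.instance Definition _ := GRing.isLinear.Build R (lhom X A) (lhom X B) _
  hom_post hom_post_linear.

Definition hom_pre (f : lhom B X) : lhom A X := f \o g.

Lemma hom_pre_linear : linear hom_pre.
Proof. by move=> a f h; apply: lhomP => u. Qed.
HB.instance Definition _ := GRing.isLinear.Build R (lhom B X) (lhom A X) _
  hom_pre hom_pre_linear.

End HomFunctor.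
Arguments hom_post {R A B} X g f.
Arguments hom_pre {R A B} X g f.

Section Modules.
Variable R : comPzRingType.
Implicit Types A B M N T X Y : lmodType R.

Definition injection A B (f : {linear A -> B}) := forall x y, f x = f y -> x = y.
Definition surjection A B (f : {linear A -> B}) := forall y, exists x, f x = y.
Definition exact A B X (f : {linear A -> B}) (g : {linear B -> X}) :=
  forall b, g b = 0 <-> exists a, f a = b.
Definition short_exact A B X (f : {linear A -> B}) (g : {linear B -> X}) :=
  [/\ injection f, exact f g & surjection g].

Definition is_zero M := forall x : M, x = 0.
Definition isomorphic M N := exists f : {linear M -> N}, bijective f.

Definition projective M :=
  forall A B (g : {linear A -> B}) (f : {linear M -> B}),
    surjection g -> exists h : {linear M -> A}, forall x, g (h x) = f x.
Definition injective_module M :=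
  forall A B (i : {linear A -> B}) (f : {linear A -> M}),
    injection i -> exists h : {linear B -> M}, forall x, h (i x) = f x.

Definition finitely_generated M :=
  exists (n : nat) (g : 'I_n -> M),
    forall x, exists r : 'I_n -> R, x = \sum_i r i *: g i.

Definition bilinear_map A B X (t : A -> B -> X) :=
  (forall b, linear (t^~ b)) /\ (forall a, linear (t a)).

Definition is_tensor A B T (t : A -> B -> T) :=
  bilinear_map t /\
  forall X (h : A -> B -> X), bilinear_map h ->
    exists! f : {linear T -> X}, forall a b, f (t a b) = h a b.

(* Sequences ... -> X_1 -> X_0 -> M -> 0 *)
Record lseq M := LSeq {
  lobj : nat -> lmodType R;
  ldiff : forall n, {linear lobj n.+1 -> lobj n};
  laug : {linear lobj 0 -> M}
}.

(* Sequences 0 -> N -> Y^0 -> Y^1 -> ... *)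
Record rseq N := RSeq {
  robj : nat -> lmodType R;
  rdiff : forall n, {linear robj n -> robj n.+1};
  raug : {linear N -> robj 0}
}.

Definition lcomplex M (L : lseq M) :=
  (forall x, laug L (ldiff L 0 x) = 0) /\
  (forall n x, ldiff L n (ldiff L n.+1 x) = 0).
Definition rcomplex N (L : rseq N) :=
  (forall x, rdiff L 0 (raug L x) = 0) /\
  (forall n x, rdiff L n.+1 (rdiff L n x) = 0).

Definition lexact M (L : lseq M) :=
  [/\ surjection (laug L), exact (ldiff L 0) (laug L) &
      forall n, exact (ldiff L n.+1) (ldiff L n)].
Definition rexact N (L : rseq N) :=
  [/\ injection (raug L), exact (raug L) (rdiff L 0) &
      forall n, exact (rdiff L n) (rdiff L n.+1)].

Definition hom_lseq X M (L : lseq M) : lseq (lhom X M) :=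
  @LSeq (lhom X M) (fun n => lhom X (lobj L n))
    (fun n => hom_post X (ldiff L n)) (hom_post X (laug L)).
Definition lseq_hom M (L : lseq M) Y : rseq (lhom M Y) :=
  @RSeq (lhom M Y) (fun n => lhom (lobj L n) Y)
    (fun n => hom_pre Y (ldiff L n)) (hom_pre Y (laug L)).
Definition hom_rseq X N (L : rseq N) : rseq (lhom X N) :=
  @RSeq (lhom X N) (fun n => lhom X (robj L n))
    (fun n => hom_post X (rdiff L n)) (hom_post X (raug L)).
Definition rseq_hom N (L : rseq N) Y : lseq (lhom N Y) :=
  @LSeq (lhom N Y) (fun n => lhom (robj L n) Y)
    (fun n => hom_pre Y (rdiff L n)) (hom_pre Y (raug L)).

Definition projective_resolution M (P : lseq M) :=
  lexact P /\ forall n, projective (lobj P n).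

(* Ext^i(M, N) = 0: the cohomology of 0 -> Hom(P_0, N) -> Hom(P_1, N) -> ...
   vanishes in degree i, for projective resolutions P of M.  That cohomology
   does not depend on P and resolutions by free modules exist, so it is
   immaterial whether one or all P are considered. *)
Definition Ext_eq0 (i : nat) M N :=
  forall P : lseq M, projective_resolution P ->
    match i with
    | 0 => injection (rdiff (lseq_hom P N) 0)
    | j.+1 => exact (rdiff (lseq_hom P N) j) (rdiff (lseq_hom P N) j.+1)
    end.

Definition mclass := lmodType R -> Prop.
Implicit Types C D : mclass.

Definition subclass C D := forall M, C M -> D M.

Definition Ext_class_eq0 i C D := forall M N, C M -> D N -> Ext_eq0 i M N.

(* The arguments are in the order of id_C(D) = 0 and pd_C(D) = 0. *)
Definition id_eq0 C D := forall i, (1 <= i)%N -> Ext_class_eq0 i C D.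
Definition pd_eq0 C D := forall i, (1 <= i)%N -> Ext_class_eq0 i D C.

Definition pointed C := forall Z, is_zero Z -> C Z.

Definition extension_closed C :=
  forall A B X (f : {linear A -> B}) (g : {linear B -> X}),
    short_exact f g -> C A -> C X -> C B.

Definition relative_cogenerator (W C : mclass) :=
  subclass W C /\
  forall X, C X ->
    exists (V X' : lmodType R) (f : {linear X -> V}) (g : {linear V -> X'}),
    [/\ short_exact f g, W V & C X'].
Definition relative_generator (V C : mclass) :=
  subclass V C /\
  forall Y, C Y ->
    exists (W Y' : lmodType R) (f : {linear Y' -> W}) (g : {linear W -> Y}),
    [/\ short_exact f g, V W & C Y'].

(* A finite sequence is an infinite one that vanishes beyond degree n. *)
Definition wedge C : mclass := fun M =>
  exists (n : nat) (L : lseq M),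
    [/\ lexact L, forall k, (k <= n)%N -> C (lobj L k) &
        forall k, (n < k)%N -> is_zero (lobj L k)].
Definition vee C : mclass := fun N =>
  exists (n : nat) (L : rseq N),
    [/\ rexact L, forall k, (k <= n)%N -> C (robj L k) &
        forall k, (n < k)%N -> is_zero (robj L k)].

Record finite_balanced_system (X W V Y : mclass) : Prop := {
  fbs1 : pointed X /\ extension_closed X;
  fbs2 : pointed Y /\ extension_closed Y;
  fbs3 : relative_cogenerator W X /\ id_eq0 X W;
  fbs4 : relative_generator V Y /\ pd_eq0 Y V;
  fbs5 : Ext_class_eq0 1 (wedge X) V /\ Ext_class_eq0 1 (wedge W) Y;
  fbs6 : Ext_class_eq0 1 W (vee Y) /\ Ext_class_eq0 1 X (vee V)
}.

Definition strong_finite_balanced_system (X W V Y : mclass) :=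
  [/\ finite_balanced_system X W V Y, pd_eq0 Y W & id_eq0 X V].

Definition covariant_acyclic_l C M (L : lseq M) :=
  forall X, C X -> lexact (hom_lseq X L).
Definition contravariant_acyclic_l D M (L : lseq M) :=
  forall Y, D Y -> rexact (lseq_hom L Y).
Definition covariant_acyclic_r C N (L : rseq N) :=
  forall X, C X -> rexact (hom_rseq X L).
Definition contravariant_acyclic_r D N (L : rseq N) :=
  forall Y, D Y -> lexact (rseq_hom L Y).

Definition proper_left_resolution C M (L : lseq M) :=
  [/\ lcomplex L, forall n, C (lobj L n) & covariant_acyclic_l C L].
Definition proper_right_resolution D N (L : rseq N) :=
  [/\ rcomplex L, forall n, D (robj L n) & contravariant_acyclic_r D L].

Definition plres C : mclass :=
  fun M => exists L : lseq M, proper_left_resolution C L.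
Definition prres D : mclass :=
  fun N => exists L : rseq N, proper_right_resolution D L.

Definition balanced_pair (X Y tX tY : mclass) :=
  [/\ subclass X tX /\ subclass tX (plres X),
      subclass Y tY /\ subclass tY (prres Y),
      forall M, tX M -> exists L : lseq M,
        proper_left_resolution X L /\ contravariant_acyclic_l Y L &
      forall N, tY N -> exists L : rseq N,
        proper_right_resolution Y L /\ covariant_acyclic_r X L].

Definition homothety M (r : R) : lhom M M := r *: (idfun : lhom M M).

Definition semidualizing M :=
  [/\ finitely_generated M, bijective (homothety M) &
      forall i, (1 <= i)%N -> Ext_eq0 i M M].

Definition finite_injective_dimension M := vee injective_module M.

Definition dualizing M := semidualizing M /\ finite_injective_dimension M.

Definition P_ (K : lmodType R) : mclass := fun M =>
  exists (P : lmodType R) (t : K -> P -> M), projective P /\ is_tensor t.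

Definition I_ (K : lmodType R) : mclass := fun M =>
  exists I : lmodType R, injective_module I /\ isomorphic M (lhom K I).

Definition GP_ (K : lmodType R) : mclass := fun M =>
  (forall i W, (1 <= i)%N -> P_ K W -> Ext_eq0 i M W) /\
  exists L : rseq M,
    [/\ rexact L, forall n, P_ K (robj L n) & contravariant_acyclic_r (P_ K) L].

Definition GI_ (K : lmodType R) : mclass := fun N =>
  (forall i V, (1 <= i)%N -> I_ K V -> Ext_eq0 i V N) /\
  exists L : lseq N,
    [/\ lexact L, forall n, I_ K (lobj L n) & covariant_acyclic_l (I_ K) L].

End Modules.

Section CohenMacaulay.
Variable R : comPzRingType.
Implicit Types (I J p m : R -> Prop) (k n : nat).

Definition ideal I :=
  [/\ I 0, forall x y, I x -> I y -> I (x + y) & forall a x, I x -> I (a * x)].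
Definition prime_ideal p :=
  [/\ ideal p, ~ p 1 & forall x y, p (x * y) -> p x \/ p y].
Definition maximal_ideal m :=
  [/\ ideal m, ~ m 1 &
      forall I, ideal I -> ~ I 1 -> (forall x, m x -> I x) ->
        forall x, I x -> m x].

Definition gen_ideal (x : nat -> R) n : R -> Prop :=
  fun y => exists r : nat -> R, y = \sum_(i < n) r i * x i.

Definition noetherian :=
  forall I, ideal I -> exists n (x : nat -> R), forall y, I y <-> gen_ideal x n y.

Definition prime_chain k :=
  exists p : nat -> R -> Prop,
    (forall i, (i <= k)%N -> prime_ideal (p i)) /\
    (forall i, (i < k)%N ->
       (forall x, p i x -> p i.+1 x) /\ ~ (forall x, p i.+1 x -> p i x)).

Definition regular_sequence (x : nat -> R) n :=
  (forall i, (i < n)%N -> forall y,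
     gen_ideal x i (x i * y) -> gen_ideal x i y) /\
  ~ gen_ideal x n 1.

Definition is_maximum (P : nat -> Prop) n := P n /\ forall k, P k -> (k <= n)%N.

Definition krull_dimension n := is_maximum prime_chain n.

Definition depth m n :=
  is_maximum (fun k => exists x : nat -> R,
    (forall i, (i < k)%N -> m (x i)) /\ regular_sequence x k) n.

Definition local_ring_at m :=
  maximal_ideal m /\
  forall m', maximal_ideal m' -> forall x, m' x <-> m x.

Definition cohen_macaulay_local :=
  noetherian /\
  exists m, local_ring_at m /\ exists n, depth m n /\ krull_dimension n.

Definition invertible (x : R) := exists y, x * y = 1.

End CohenMacaulay.

(* The universal property of R -> R_p. *)
Definition is_localization (R S : comPzRingType) (p : R -> Prop)
    (f : {rmorphism R -> S}) :=
  (forall s, ~ p s -> invertible (f s)) /\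
  forall (T : comPzRingType) (g : {rmorphism R -> T}),
    (forall s, ~ p s -> invertible (g s)) ->
    exists! h : {rmorphism S -> T}, forall x, h (f x) = g x.

Definition cohen_macaulay (R : comPzRingType) :=
  noetherian R /\
  forall m : R -> Prop, maximal_ideal m ->
    forall (S : comPzRingType) (f : {rmorphism R -> S}),
      is_localization m f -> cohen_macaulay_local S.

(* Main.v *)
(* Write Cd = Hom(C, D).  The Bass class of C contains the injective modules and is
   closed under kernels of epimorphisms, by Nakayama's lemma; as D has a finite
   injective coresolution, D belongs to it, i.e. Ext^i(C, D) = Tor_i(C, Cd) = 0 for
   i >= 1 and C (x) Cd = D.  The same closure property, applied to C and to Cd, yields
   Ext^i(P_C, vee I_Cd) = 0 and, by duality, Ext^i(wedge P_C, I_Cd) = 0.  Like flat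
   modules over a ring with a dualizing module, the modules in I_Cd have finite
   P_C-dimension, up to direct summands, so that Ext^i(GP_C, I_Cd) = 0; and C has
   a finite coresolution by modules in I_Cd, so that Ext^i(P_C, GI_Cd) = 0.
   Everything else follows from these vanishings by Auslander-Buchweitz
   approximations and dimension shifting.  Tensor products are avoided throughout:
   Tor_i(A, B) = 0 is replaced by Ext^i(A, Hom(B, J)) = 0 for all injective J. *)

From HB Require Import structures.
Require Import Defs.
From mathcomp Require Import all_boot all_algebra.
From mathcomp Require Import boolp classical_sets.

Set Implicit Arguments.
Unset Strict Implicit.
Unset Printing Implicit Defensive.

Import GRing.Theory.
Local Open Scope ring_scope.

(** * Linear maps, submodules and quotients *)

Section LinearMaps.
Variable R : comPzRingType.
Implicit Types A B M N X Y : lmodType R.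

(** Injective modules are the test objects throughout, yet no injective hull is built from scratch:
    that they detect nonzero elements is read off from the finite injective coresolution of D
    together with biduality. A tensor identity such as C (x) Cd = D thus becomes a pair of
    statements on maps into injective modules, namely injectivity and surjectivity of restriction
    along a pairing.

    Flatness occurs only in the modules Hom(J, I) with J and I injective. It is encoded by
    factorizations of maps from finitely generated modules through finite powers ([fac]), a property
    that passes to suitable syzygies. The dimension shifts stop because of one constant [n], the
    number of terms of an injective coresolution of D: Baer's criterion carries the bound from D
    over to all of [fac D], which forces a splitting after n syzygies.

    [Xt] recurses over all projective presentations, so that no Ext group and no connecting map is
    ever formed; extending and lifting maps does their work. *)

Definition lin A B (f : A -> B) (lf : linear f) : {linear A -> B} :=
  HB.pack f (GRing.isLinear.Build R A B *:%R f lf).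


Lemma linE A B (f : A -> B) (lf : linear f) x : lin lf x = f x.
Proof. by []. Qed.

Lemma compE A B X (g : {linear B -> X}) (f : {linear A -> B}) x :
  (g \o f : {linear A -> X}) x = g (f x).
Proof. by []. Qed.

Lemma laddE A B (f g : {linear A -> B}) x : (f \+ g : {linear A -> B}) x = f x + g x.
Proof. by []. Qed.

Lemma lsubE A B (f g : {linear A -> B}) x : (f \- g : {linear A -> B}) x = f x - g x.
Proof. by []. Qed.

Definition lE := (compE, laddE, lsubE).

Definition lid A : {linear A -> A} := idfun.
Definition lzero A B : {linear A -> B} := lhom_zero A B.

Lemma lin_ext A B (f g : {linear A -> B}) : (forall x, f x = g x) -> f = g.
Proof. exact: lhomP. Qed.

Lemma injection0 A B (f : {linear A -> B}) :
  (forall x, f x = 0 -> x = 0) -> injection f.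
Proof.
move=> f0 x y fxy; apply/eqP; rewrite -subr_eq0; apply/eqP; apply: f0.
by rewrite linearB fxy subrr.
Qed.

(** The universal property of the cokernel, for any surjection; with its kernel counterpart
    [lift_inj] it produces many of the maps in the diagram chases below. *)
Lemma descend A B X (g : {linear A -> B}) (f : {linear A -> X}) :
  surjection g -> (forall x, g x = 0 -> f x = 0) ->
  exists h : {linear B -> X}, forall x, h (g x) = f x.
Proof.
move=> gS gf; have /choice[s gs] : forall y, exists x, g x = y by exact: gS.
have fs x y : g x = g y -> f x = f y.
  move=> gxy; apply/eqP; rewrite -subr_eq0 -linearB; apply/eqP; apply: gf.
  by rewrite linearB gxy subrr.
have hl : linear (f \o s).
  by move=> a x y; rewrite /= -linearP; apply: fs; rewrite linearP !gs.
by exists (lin hl) => x; apply: fs; rewrite gs.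
Qed.

Lemma lift_inj A B X (f : {linear A -> B}) (h : {linear X -> B}) :
  injection f -> (forall x, exists a, f a = h x) ->
  exists k : {linear X -> A}, forall x, f (k x) = h x.
Proof.
move=> fI /choice[k fk].
have kl : linear k by move=> a x y; apply: fI; rewrite linearP !fk linearP.
by exists (lin kl) => x; apply: fk.
Qed.

Lemma linear_choice A B (r : A -> B -> Prop) :
  (forall x, exists y, r x y) ->
  (forall x y y', r x y -> r x y' -> y = y') ->
  (forall a x x' y y', r x y -> r x' y' -> r (a *: x + x') (a *: y + y')) ->
  exists f : {linear A -> B}, forall x, r x (f x).
Proof.
move=> /choice[f rf] ru rl.
have fl : linear f by move=> a x y; apply: ru (rf _) _; apply: rl.
by exists (lin fl).
Qed.

Lemma hom_linear A B X (h : A -> {linear B -> X}) :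
  (forall b, linear (fun a => h a b)) -> linear (h : A -> lhom B X).
Proof. by move=> hl a x y; apply: lhomP => b; apply: hl. Qed.

Definition hlin A B X (h : A -> {linear B -> X})
    (hl : forall b, linear (fun a => h a b)) : {linear A -> lhom B X} :=
  lin (hom_linear hl).

Lemma eval_linear A B (x : A) : linear (fun f : lhom A B => f x).
Proof. by []. Qed.

Lemma flip_linear A B X (h : {linear A -> lhom B X}) b : linear (fun a => h a b).
Proof. by move=> a x y; rewrite linearP. Qed.

Lemma lflip_linear A B X (h : {linear A -> lhom B X}) :
  linear (fun b => lin (flip_linear h b) : lhom A X).
Proof. by move=> a x y; apply: lhomP => u /=; rewrite linearP. Qed.

(** Takes the place of the adjunction and symmetry of the tensor product: source and target both
    encode the bilinear maps A x B -> X. *)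
Definition lflip A B X (h : {linear A -> lhom B X}) : {linear B -> lhom A X} :=
  lin (lflip_linear h).

Lemma lflipE A B X (h : {linear A -> lhom B X}) a b : lflip h b a = h a b.
Proof. by []. Qed.

End LinearMaps.

Section Submodules.
Variable R : comPzRingType.
Implicit Types A B : lmodType R.

Record submod (M : lmodType R) := Submod {
  sm_in :> M -> Prop;
  sm_0 : sm_in 0;
  sm_P : forall a x y, sm_in x -> sm_in y -> sm_in (a *: x + y)
}.

Section Sub.
Variables (M : lmodType R) (S : submod M).

Lemma sm_D x y : S x -> S y -> S (x + y).
Proof. by move=> Sx Sy; rewrite -[x]scale1r; apply: sm_P. Qed.
Lemma sm_Z a x : S x -> S (a *: x).
Proof. by move=> Sx; rewrite -[_ *: _]addr0; apply: sm_P => //; apply: sm_0. Qed.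
Lemma sm_N x : S x -> S (- x).
Proof. by rewrite -scaleN1r; apply: sm_Z. Qed.
Lemma sm_B x y : S x -> S y -> S (x - y).
Proof. by move=> Sx /sm_N; apply: sm_D. Qed.
Definition smod_sort : Type := {x : M | S x}.
HB.instance Definition _ := gen_eqMixin smod_sort.
HB.instance Definition _ := gen_choiceMixin smod_sort.

Lemma smodP (x y : smod_sort) : sval x = sval y -> x = y.
Proof.
case: x y => [x Sx] [y Sy] /= exy; case: _ / exy Sy => Sy.
by rewrite (Prop_irrelevance Sx Sy).
Qed.

Definition smod_zero : smod_sort := exist _ 0 (sm_0 S).
Definition smod_opp (x : smod_sort) : smod_sort := exist _ _ (sm_N (svalP x)).
Definition smod_add (x y : smod_sort) : smod_sort := exist _ _ (sm_D (svalP x) (svalP y)).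
Definition smod_scale a (x : smod_sort) : smod_sort := exist _ _ (sm_Z a (svalP x)).

Lemma smod_addA : associative smod_add.
Proof. by move=> x y z; apply: smodP; apply: addrA. Qed.
Lemma smod_addC : commutative smod_add.
Proof. by move=> x y; apply: smodP; apply: addrC. Qed.
Lemma smod_add0 : left_id smod_zero smod_add.
Proof. by move=> x; apply: smodP; apply: add0r. Qed.
Lemma smod_addN : left_inverse smod_zero smod_opp smod_add.
Proof. by move=> x; apply: smodP; apply: addNr. Qed.
HB.instance Definition _ := GRing.isZmodule.Build smod_sort
  smod_addA smod_addC smod_add0 smod_addN.

Lemma smod_scaleA a b x : smod_scale a (smod_scale b x) = smod_scale (a * b) x.
Proof. by apply: smodP; apply: scalerA. Qed.
Lemma smod_scale1 : left_id 1 smod_scale.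
Proof. by move=> x; apply: smodP; apply: scale1r. Qed.
Lemma smod_scaleDr : right_distributive smod_scale +%R.
Proof. by move=> a x y; apply: smodP; apply: scalerDr. Qed.
Lemma smod_scaleDl x : {morph smod_scale^~ x : a b / a + b}.
Proof. by move=> a b; apply: smodP; apply: scalerDl. Qed.
HB.instance Definition _ := GRing.Zmodule_isLmodule.Build R smod_sort
  smod_scaleA smod_scale1 smod_scaleDr smod_scaleDl.

Definition smod : lmodType R := smod_sort.

Lemma smod_val_linear : linear (fun x : smod => sval x).
Proof. by []. Qed.
Definition sincl : {linear smod -> M} := lin smod_val_linear.

Lemma sincl_inj : injection sincl.
Proof. by move=> x y; apply: smodP. Qed.

Lemma sinclP x : S x <-> exists y, sincl y = x.
Proof. by split=> [Sx|[y <-]]; [exists (exist _ x Sx) | apply: svalP]. Qed.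

(** A coset is the predicate of its members, so that extensionality turns congruence modulo [S] into
    equality. *)
Definition qmod_sort : Type := {A : M -> Prop | exists x, A = fun y => S (y - x)}.
HB.instance Definition _ := gen_eqMixin qmod_sort.
HB.instance Definition _ := gen_choiceMixin qmod_sort.

Definition qpi (x : M) : qmod_sort :=
  exist _ (fun y => S (y - x)) (ex_intro _ x erefl).
Definition qrep (X : qmod_sort) : M := projT1 (cid (svalP X)).

Lemma qpi_eq x y : qpi x = qpi y <-> S (x - y).
Proof.
split=> [/(congr1 (fun Z : qmod_sort => sval Z x)) /= e|Sxy].
  by move: (sm_0 S); rewrite -(subrr x) e.
suff e : sval (qpi x) = sval (qpi y).
  rewrite /qpi; move: e => /= e; move: (ex_intro _ x _) (ex_intro _ y _).
  by rewrite e => p q; rewrite (Prop_irrelevance p q).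
apply: funext => z; apply: propext => /=; split=> Sz.
  by rewrite -[z](subrK x) -addrA; apply: sm_D.
by rewrite -[z](subrK y) -addrA -[y - x]opprB; apply: sm_B.
Qed.

Lemma qrepK X : qpi (qrep X) = X.
Proof.
rewrite /qrep; case: cid => x /= e; case: X e => A p /= e.
by rewrite /qpi; subst A; rewrite (Prop_irrelevance (ex_intro _ x erefl) p).
Qed.

Lemma qpiW (P : qmod_sort -> Prop) : (forall x, P (qpi x)) -> forall X, P X.
Proof. by move=> Px X; rewrite -(qrepK X). Qed.

Lemma qrepP x : S (qrep (qpi x) - x).
Proof. by apply/qpi_eq; rewrite qrepK. Qed.

Definition qmod_opp (X : qmod_sort) : qmod_sort := qpi (- qrep X).
Definition qmod_add (X Y : qmod_sort) : qmod_sort := qpi (qrep X + qrep Y).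
Definition qmod_scale a (X : qmod_sort) : qmod_sort := qpi (a *: qrep X).

Lemma qmod_oppE x : qmod_opp (qpi x) = qpi (- x).
Proof. by apply/qpi_eq; rewrite -opprD; apply/sm_N/qrepP. Qed.
Lemma qmod_addE x y : qmod_add (qpi x) (qpi y) = qpi (x + y).
Proof.
by apply/qpi_eq; rewrite opprD addrACA; apply: sm_D; apply: qrepP.
Qed.
Lemma qmod_scaleE a x : qmod_scale a (qpi x) = qpi (a *: x).
Proof. by apply/qpi_eq; rewrite -scalerBr; apply/sm_Z/qrepP. Qed.

Lemma qmod_addA : associative qmod_add.
Proof.
by elim/qpiW=> x; elim/qpiW=> y; elim/qpiW=> z; rewrite !qmod_addE addrA.
Qed.
Lemma qmod_addC : commutative qmod_add.
Proof. by elim/qpiW=> x; elim/qpiW=> y; rewrite !qmod_addE addrC. Qed.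
Lemma qmod_add0 : left_id (qpi 0) qmod_add.
Proof. by elim/qpiW=> x; rewrite !qmod_addE add0r. Qed.
Lemma qmod_addN : left_inverse (qpi 0) qmod_opp qmod_add.
Proof. by elim/qpiW=> x; rewrite qmod_oppE !qmod_addE addNr. Qed.
HB.instance Definition _ := GRing.isZmodule.Build qmod_sort
  qmod_addA qmod_addC qmod_add0 qmod_addN.

Lemma qmod_plusE x y : qpi x + qpi y = qpi (x + y).
Proof. exact: qmod_addE. Qed.

Lemma qmod_scaleA a b x : qmod_scale a (qmod_scale b x) = qmod_scale (a * b) x.
Proof. by elim/qpiW: x => x; rewrite !qmod_scaleE scalerA. Qed.
Lemma qmod_scale1 : left_id 1 qmod_scale.
Proof. by elim/qpiW=> x; rewrite !qmod_scaleE scale1r. Qed.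
Lemma qmod_scaleDr : right_distributive qmod_scale +%R.
Proof.
move=> a; elim/qpiW=> x; elim/qpiW=> y.
by rewrite qmod_plusE !qmod_scaleE qmod_plusE scalerDr.
Qed.
Lemma qmod_scaleDl x : {morph qmod_scale^~ x : a b / a + b}.
Proof.
by move=> a b; elim/qpiW: x => x; rewrite !qmod_scaleE qmod_plusE scalerDl.
Qed.
HB.instance Definition _ := GRing.Zmodule_isLmodule.Build R qmod_sort
  qmod_scaleA qmod_scale1 qmod_scaleDr qmod_scaleDl.

Definition qmod : lmodType R := qmod_sort.

Lemma qpi_linear : linear (qpi : M -> qmod).
Proof.
by move=> a x y; rewrite -qmod_plusE -qmod_scaleE.
Qed.
Definition qproj : {linear M -> qmod} := lin qpi_linear.

Lemma qproj_surj : surjection qproj.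
Proof. by elim/qpiW=> x; exists x. Qed.

Lemma qproj0 x : qproj x = 0 <-> S x.
Proof. by rewrite qpi_eq subr0. Qed.

End Sub.

Lemma ker_subproof A B (f : {linear A -> B}) a x y :
  f x = 0 -> f y = 0 -> f (a *: x + y) = 0.
Proof. by rewrite linearP => -> ->; rewrite scaler0 addr0. Qed.
Definition kernel A B (f : {linear A -> B}) : submod A :=
  Submod (linear0 f) (@ker_subproof A B f).

Lemma im_subproof0 A B (f : {linear A -> B}) : exists x, f x = 0.
Proof. by exists 0; rewrite linear0. Qed.
Lemma im_subproof A B (f : {linear A -> B}) a x y :
  (exists u, f u = x) -> (exists u, f u = y) -> exists u, f u = a *: x + y.
Proof. by move=> [u <-] [v <-]; exists (a *: u + v); rewrite linearP. Qed.
Definition range A B (f : {linear A -> B}) : submod B :=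
  Submod (im_subproof0 f) (@im_subproof A B f).

Lemma corestrict_linear A B (f : {linear A -> B}) :
  linear (fun x => exist _ (f x) (ex_intro _ x erefl) : smod (range f)).
Proof. by move=> a x y; apply: smodP; rewrite /= linearP. Qed.
Definition corestrict A B (f : {linear A -> B}) : {linear A -> smod (range f)} :=
  lin (corestrict_linear f).

Lemma corestrict_surj A B (f : {linear A -> B}) : surjection (corestrict f).
Proof. by move=> [y [x xy]]; exists x; apply: smodP. Qed.

Lemma kernel_ses A B (f : {linear A -> B}) :
  surjection f -> short_exact (sincl (kernel f)) f.
Proof.
by move=> fS; split=> //; [apply: sincl_inj | move=> b; apply: (sinclP (kernel f))].
Qed.

Lemma cokernel_ses A B (f : {linear A -> B}) :
  injection f -> short_exact f (qproj (range f)).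
Proof.
move=> fI; split=> //; last exact: qproj_surj.
by move=> b; apply: (qproj0 (range f)).
Qed.

(** The maps are forgotten because vanishing arguments only need some sequence; this is the relation
    fed to [ext_structure]. *)
Definition ses A B (X : lmodType R) : Prop :=
  exists (f : {linear A -> B}) (g : {linear B -> X}), short_exact f g.

End Submodules.

(** * Products, direct sums and free modules *)

Section Products.
Variable R : comPzRingType.

Section Pi.
Variables (S : Type) (E : S -> lmodType R).

Definition pmod_sort : Type := forall s, E s.
HB.instance Definition _ := gen_eqMixin pmod_sort.
HB.instance Definition _ := gen_choiceMixin pmod_sort.

Lemma pmodP (x y : pmod_sort) : (forall s, x s = y s) -> x = y.
Proof. exact: functional_extensionality_dep. Qed.

Definition pmod_zero : pmod_sort := fun=> 0.
Definition pmod_opp (x : pmod_sort) : pmod_sort := fun s => - x s.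
Definition pmod_add (x y : pmod_sort) : pmod_sort := fun s => x s + y s.
Definition pmod_scale a (x : pmod_sort) : pmod_sort := fun s => a *: x s.

Lemma pmod_addA : associative pmod_add.
Proof. by move=> x y z; apply: pmodP => s; apply: addrA. Qed.
Lemma pmod_addC : commutative pmod_add.
Proof. by move=> x y; apply: pmodP => s; apply: addrC. Qed.
Lemma pmod_add0 : left_id pmod_zero pmod_add.
Proof. by move=> x; apply: pmodP => s; apply: add0r. Qed.
Lemma pmod_addN : left_inverse pmod_zero pmod_opp pmod_add.
Proof. by move=> x; apply: pmodP => s; apply: addNr. Qed.
HB.instance Definition _ := GRing.isZmodule.Build pmod_sort
  pmod_addA pmod_addC pmod_add0 pmod_addN.

Lemma pmod_scaleA a b x : pmod_scale a (pmod_scale b x) = pmod_scale (a * b) x.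
Proof. by apply: pmodP => s; apply: scalerA. Qed.
Lemma pmod_scale1 : left_id 1 pmod_scale.
Proof. by move=> x; apply: pmodP => s; apply: scale1r. Qed.
Lemma pmod_scaleDr : right_distributive pmod_scale +%R.
Proof. by move=> a x y; apply: pmodP => s; apply: scalerDr. Qed.
Lemma pmod_scaleDl x : {morph pmod_scale^~ x : a b / a + b}.
Proof. by move=> a b; apply: pmodP => s; apply: scalerDl. Qed.
HB.instance Definition _ := GRing.Zmodule_isLmodule.Build R pmod_sort
  pmod_scaleA pmod_scale1 pmod_scaleDr pmod_scaleDl.

Definition pmod : lmodType R := pmod_sort.

Lemma pcomp_linear s : linear (fun x : pmod => x s).
Proof. by []. Qed.
Definition pcomp s : {linear pmod -> E s} := lin (pcomp_linear s).

Lemma ptuple_linear (X : lmodType R) (f : forall s, {linear X -> E s}) :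
  linear (fun x => (fun s => f s x) : pmod).
Proof. by move=> a x y; apply: pmodP => s; apply: linearP. Qed.
Definition ptuple (X : lmodType R) (f : forall s, {linear X -> E s}) :
  {linear X -> pmod} := lin (ptuple_linear f).

Lemma injective_pmod : (forall s, injective_module (E s)) -> injective_module pmod.
Proof.
move=> EI A B i f iI.
have h s : {h : {linear B -> E s} | forall x, h (i x) = f x s}.
  by apply: cid; exact: (EI s A B i (pcomp s \o f) iI).
by exists (ptuple (fun s => sval (h s))) => x; apply: pmodP => s; apply: (svalP (h s)).
Qed.

End Pi.

Section DirectSum.
Variables (S : choiceType) (M : lmodType R).

Definition finsupp (x : pmod (fun _ : S => M)) : Prop :=
  exists l : seq S, forall s, s \notin l -> x s = 0.

Lemma finsupp0 : finsupp 0. Proof. by exists [::]. Qed.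
Lemma finsuppP a x y : finsupp x -> finsupp y -> finsupp (a *: x + y).
Proof.
move=> [l xl] [k yk]; exists (l ++ k) => s; rewrite mem_cat negb_or => /andP[sl sk].
rewrite -[LHS]/(a *: x s + y s) xl // yk //.
by rewrite scaler0 addr0.
Qed.

Definition dsub : submod (pmod (fun _ : S => M)) := Submod finsupp0 finsuppP.
Definition dsum : lmodType R := smod dsub.

Lemma dcomp_linear (s : S) : linear (fun x : dsum => sval x s).
Proof. by []. Qed.
Definition dcomp (s : S) : {linear dsum -> M} := lin (dcomp_linear s).

Lemma dsumP (x y : dsum) : (forall s, dcomp s x = dcomp s y) -> x = y.
Proof. by move=> xy; apply: smodP; apply: pmodP. Qed.

Lemma dinj_supp s (m : M) : dsub (fun t => if t == s then m else 0).
Proof. by exists [:: s] => t; rewrite inE => /negbTE->. Qed.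

Lemma dinj_linear s :
  linear (fun m => exist _ (fun t => if t == s then m else 0) (dinj_supp s m) : dsum).
Proof.
move=> a x y; apply: dsumP => t; rewrite linearP /dcomp /=.
by case: eqP => //; rewrite scaler0 addr0.
Qed.
Definition dinj s : {linear M -> dsum} := lin (dinj_linear s).

Lemma dcomp_inj t s m : dcomp t (dinj s m) = if t == s then m else 0.
Proof. by []. Qed.

Definition dsupp (x : dsum) : seq S := undup (projT1 (cid (svalP x))).

Lemma dsupp_uniq x : uniq (dsupp x). Proof. exact: undup_uniq. Qed.

Lemma dsupp0 x s : s \notin dsupp x -> dcomp s x = 0.
Proof. by rewrite mem_undup; apply: (projT2 (cid (svalP x))). Qed.

(** [dsupp x] is a chosen list that may exceed the support of [x] and does not behave well under
    addition; sums over it are compared with sums over a common larger list. *)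
Lemma dsupp_sum (V : zmodType) (F : S -> V) x l : uniq l ->
    (forall s, s \notin l -> F s = 0) -> (forall s, s \notin dsupp x -> F s = 0) ->
  \sum_(s <- dsupp x) F s = \sum_(s <- l) F s.
Proof.
move=> ul Fl Fx; rewrite (bigID (mem l)) /= [X in _ + X]big1 ?addr0 //.
rewrite [RHS](bigID (mem (dsupp x))) /= [X in _ + X]big1 ?addr0 //.
rewrite -!(big_filter _ (fun s => s \in _)); apply: perm_big; apply: uniq_perm.
- by rewrite filter_uniq ?dsupp_uniq.
- by rewrite filter_uniq.
by move=> s; rewrite !mem_filter andbC.
Qed.

Lemma dsum_gen x : x = \sum_(s <- dsupp x) dinj s (dcomp s x).
Proof.
apply: dsumP => t; rewrite linear_sum.
under eq_bigr do rewrite dcomp_inj.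
have [tx|tx] := boolP (t \in dsupp x); last first.
  rewrite dsupp0 // big1_seq // => s /andP[_ sx].
  by case: eqP => // ts; rewrite ts sx in tx.
rewrite (bigD1_seq t) ?dsupp_uniq //= eqxx big1 ?addr0 // => s /negbTE.
by rewrite eq_sym => ->.
Qed.

Section Lift.
Variables (Y : lmodType R) (u : S -> {linear M -> Y}).

Lemma dlift_linear : linear (fun x : dsum => \sum_(s <- dsupp x) u s (dcomp s x)).
Proof.
move=> a x y; set l := undup (dsupp (a *: x + y) ++ dsupp x ++ dsupp y).
have ul : uniq l by exact: undup_uniq.
have lE z : {subset dsupp z <= l} ->
  \sum_(s <- dsupp z) u s (dcomp s z) = \sum_(s <- l) u s (dcomp s z).
  move=> zl; apply: dsupp_sum => // s.
    by move=> /(contra (zl s)) /dsupp0 ->; rewrite linear0.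
  by move=> /dsupp0 ->; rewrite linear0.
rewrite !lE; first last.
- by move=> s sx; rewrite mem_undup !mem_cat sx.
- by move=> s sx; rewrite mem_undup !mem_cat sx !orbT.
- by move=> s sx; rewrite mem_undup !mem_cat sx !orbT.
rewrite scaler_sumr -big_split /=; apply: eq_bigr => s _.
by rewrite !linearP.
Qed.
Definition dlift : {linear dsum -> Y} := lin dlift_linear.

Lemma dlift_inj s m : dlift (dinj s m) = u s m.
Proof.
rewrite linE (@dsupp_sum _ _ _ [:: s]) //.
- by rewrite big_seq1 dcomp_inj eqxx.
- by move=> t; rewrite inE dcomp_inj => /negbTE->; rewrite linear0.
by move=> t /dsupp0 ->; rewrite linear0.
Qed.

End Lift.

Lemma dsum_ext (Y : lmodType R) (f g : {linear dsum -> Y}) :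
  (forall s m, f (dinj s m) = g (dinj s m)) -> forall x, f x = g x.
Proof.
by move=> fg x; rewrite [x]dsum_gen !linear_sum; apply: eq_bigr => s _; apply: fg.
Qed.

End DirectSum.

Lemma scale_linear (M : lmodType R) (m : M) : linear (fun r : R^o => r *: m).
Proof. by move=> a x y; rewrite scalerDl -scalerA. Qed.
Definition lscale (M : lmodType R) (m : M) : {linear R^o -> M} := lin (scale_linear m).

Lemma projective_dsum (S : choiceType) (P : lmodType R) :
  projective P -> projective (dsum S P).
Proof.
move=> PP A B g f gS.
have /choice[h hE] s : exists h : {linear P -> A}, forall x, g (h x) = f (dinj P s x).
  exact: (PP _ _ g (f \o dinj P s)).
exists (dlift h) => x; move: x.
apply: (dsum_ext (f := g \o dlift h)) => s m.
by rewrite compE dlift_inj hE.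
Qed.

Lemma projective_ring : projective (R^o : lmodType R).
Proof.
move=> A B g f gS; have [a ga] := gS (f 1); exists (lscale a) => x.
by rewrite linE linearZ ga -linearZ /= [_ *: _]mulr1.
Qed.

Definition free_mod (S : choiceType) : lmodType R := dsum S R^o.

Lemma projective_free S : projective (free_mod S).
Proof. by apply: projective_dsum; apply: projective_ring. Qed.

Definition fbase (S : choiceType) (s : S) : free_mod S := dinj (R^o : lmodType R) s 1.

Definition flift (S : choiceType) (M : lmodType R) (m : S -> M) :
  {linear free_mod S -> M} := dlift (fun s => lscale (m s)).

Lemma flift_base (S : choiceType) (M : lmodType R) (m : S -> M) s :
  flift m (fbase s) = m s.
Proof. by rewrite dlift_inj linE scale1r. Qed.

Lemma free_ext (S : choiceType) (M : lmodType R) (f g : {linear free_mod S -> M}) :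
  (forall s, f (fbase s) = g (fbase s)) -> forall x, f x = g x.
Proof.
move=> fg; apply: dsum_ext => s r.
have -> : dinj R^o s r = r *: fbase s by rewrite -linearZ /= [_ *: _]mulr1.
by rewrite !linearZ fg.
Qed.

Lemma flift_surj (M : lmodType R) : surjection (flift (@idfun M)).
Proof. by move=> m; exists (fbase m); rewrite flift_base. Qed.

Lemma enough_projectives (M : lmodType R) :
  exists (K P : lmodType R) (f : {linear K -> P}) (g : {linear P -> M}),
    projective P /\ short_exact f g.
Proof.
exists (smod (kernel (flift (@idfun M)))), (free_mod M), (sincl _), (flift idfun).
by split; [apply: projective_free | apply: kernel_ses; apply: flift_surj].
Qed.

Definition prodM (A B : lmodType R) : lmodType R := (A * B)%type.

Lemma pfst_linear (A B : lmodType R) : linear (fst : prodM A B -> A).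
Proof. by []. Qed.
Definition pfst (A B : lmodType R) : {linear prodM A B -> A} :=
  lin (@pfst_linear A B).

Lemma psnd_linear (A B : lmodType R) : linear (snd : prodM A B -> B).
Proof. by []. Qed.
Definition psnd (A B : lmodType R) : {linear prodM A B -> B} :=
  lin (@psnd_linear A B).

Lemma ppair_linear (A B X : lmodType R) (f : {linear X -> A}) (g : {linear X -> B}) :
  linear (fun x => (f x, g x) : prodM A B).
Proof. by move=> a x y; apply: injective_projections; rewrite /= linearP. Qed.
Definition ppair (A B X : lmodType R) (f : {linear X -> A}) (g : {linear X -> B}) :
  {linear X -> prodM A B} := lin (ppair_linear f g).

Lemma prodM_ext (A B : lmodType R) (x y : prodM A B) :
  pfst A B x = pfst A B y -> psnd A B x = psnd A B y -> x = y.
Proof. exact: injective_projections. Qed.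

Lemma prodM_gen (A B : lmodType R) (x : prodM A B) :
  x = ppair (lid A) (lzero A B) (pfst A B x) + ppair (lzero B A) (lid B) (psnd A B x).
Proof. by apply: prodM_ext; rewrite linearD linE /= ?addr0 ?add0r. Qed.

Lemma projective_prod (P Q : lmodType R) :
  projective P -> projective Q -> projective (prodM P Q).
Proof.
move=> PP PQ A B g f gS.
have [h1 h1E] := PP A B g (f \o ppair (lid P) (lzero P Q)) gS.
have [h2 h2E] := PQ A B g (f \o ppair (lzero Q P) (lid Q)) gS.
exists ((h1 \o pfst P Q) \+ (h2 \o psnd P Q)) => x.
by rewrite !lE linearD h1E h2E !lE -linearD -prodM_gen.
Qed.

Lemma projective_retract (P Q : lmodType R) (i : {linear Q -> P}) (p : {linear P -> Q}) :
  (forall x, p (i x) = x) -> projective P -> projective Q.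
Proof.
move=> pi PP A B g f gS; have [h hE] := PP A B g (f \o p) gS.
by exists (h \o i) => x /=; rewrite hE /= pi.
Qed.

Lemma projective_split (A P : lmodType R) (g : {linear A -> P}) :
  projective P -> surjection g -> exists s : {linear P -> A}, forall x, g (s x) = x.
Proof. by move=> PP; apply: (PP A P g (lid P)). Qed.

End Products.

(** * Vanishing of Ext *)

Section Ext.
Variable R : comPzRingType.
Implicit Types A B M N X Y Z K P I : lmodType R.

(* [Xt e M N] says that Ext^(e+1)(M, N) = 0. *)
Fixpoint Xt (e : nat) M N : Prop :=
  forall K P (f : {linear K -> P}) (g : {linear P -> M}),
    projective P -> short_exact f g ->
    if e is d.+1 then Xt d K N
    else forall h : {linear K -> N},
      exists k : {linear P -> N}, forall x, k (f x) = h x.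

Definition perp M N : Prop := forall e, Xt e M N.

Lemma exact_comp0 A B X (f : {linear A -> B}) (g : {linear B -> X}) :
  exact f g -> forall x, g (f x) = 0.
Proof. by move=> fg x; apply/fg; exists x. Qed.

Lemma short_exactI A B X (f : {linear A -> B}) (g : {linear B -> X}) :
  injection f -> surjection g -> (forall x, g (f x) = 0) ->
  (forall y, g y = 0 -> exists x, f x = y) -> short_exact f g.
Proof.
move=> fI gS gf ex; split=> // b; split; first exact: ex.
by move=> [a <-].
Qed.

Lemma ses_syzygy A B X K P (f : {linear A -> B}) (g : {linear B -> X})
    (k : {linear K -> P}) (p : {linear P -> B}) :
  short_exact f g -> short_exact k p ->
  exists (L : lmodType R) (i : {linear L -> P}) (j : {linear K -> L})
    (q : {linear L -> A}),
    [/\ short_exact i (g \o p), short_exact j q & forall x, i (j x) = k x].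
Proof.
move=> [fI fg gS] [kI kp pS].
have gpS : surjection (g \o p).
  by move=> x; have [b <-] := gS x; have [a <-] := pS b; exists a.
pose L := kernel (g \o p).
have [j jE] : exists j : {linear K -> smod L}, forall x, sincl L (j x) = k x.
  apply: lift_inj; first exact: sincl_inj.
  by move=> x; apply/sinclP; rewrite /= (exact_comp0 kp) linear0.
have [q qE] : exists q : {linear smod L -> A}, forall x, f (q x) = p (sincl L x).
  apply: (lift_inj (h := p \o sincl L)) => // x.
  by apply/fg; apply: (svalP x).
exists (smod L), (sincl L), j, q; split=> //; first exact: kernel_ses.
apply: short_exactI.
- by move=> x y /(congr1 (sincl L)); rewrite !jE; apply: kI.
- move=> a; have [b pb] := pS (f a).
  have Lb : L b by rewrite /= pb (exact_comp0 fg).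
  by exists (exist _ b Lb); apply: fI; rewrite qE.
- by move=> x; apply: fI; rewrite qE jE linear0 (exact_comp0 kp).
move=> y qy; have [x kx] : exists x, k x = sincl L y.
  by apply/kp; rewrite -qE qy linear0.
by exists x; apply: (@sincl_inj _ _ L); rewrite jE.
Qed.

Definition is_pullback B P X U (g : {linear B -> X}) (p : {linear P -> X})
    (u1 : {linear U -> P}) (u2 : {linear U -> B}) : Prop :=
  [/\ forall x, p (u1 x) = g (u2 x),
      forall x y, u1 x = u1 y -> u2 x = u2 y -> x = y &
      forall x y, p x = g y -> exists u, u1 u = x /\ u2 u = y].

Lemma pullback_exists B P X (g : {linear B -> X}) (p : {linear P -> X}) :
  exists (U : lmodType R) (u1 : {linear U -> P}) (u2 : {linear U -> B}),
    is_pullback g p u1 u2.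
Proof.
pose S := kernel ((p \o pfst P B) \- (g \o psnd P B)).
exists (smod S), (pfst P B \o sincl S), (psnd P B \o sincl S); split.
- by move=> x; apply/eqP; rewrite -subr_eq0; apply/eqP; exact: (svalP x).
- by move=> x y e1 e2; apply: smodP; apply: prodM_ext.
move=> x y e; have k : S (x, y) by rewrite /= e subrr.
by exists (exist _ (x, y) k).
Qed.

Section Pullback.
Variables (B P X U : lmodType R) (g : {linear B -> X}) (p : {linear P -> X}).
Variables (pb1 : {linear U -> P}) (pb2 : {linear U -> B}).
Hypothesis upb : is_pullback g p pb1 pb2.

Lemma pb_tuple (Z : lmodType R) (u : {linear Z -> P}) (v : {linear Z -> B}) :
  (forall z, p (u z) = g (v z)) ->
  exists w : {linear Z -> U},
    (forall z, pb1 (w z) = u z) /\ (forall z, pb2 (w z) = v z).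
Proof.
have [pbE pb_ext pb_mk] := upb => uv; have /choice[w wE] z : exists w, pb1 w = u z /\ pb2 w = v z.
  exact: pb_mk.
have wl : linear w.
  move=> a x y; apply: pb_ext; rewrite linearP.
    by rewrite !(proj1 (wE _)) linearP.
  by rewrite !(proj2 (wE _)) linearP.
by exists (lin wl); split=> z; have [] := wE z.
Qed.

Lemma pullback_ses1 (K : lmodType R) (k : {linear K -> P}) : short_exact k p ->
  exists j : {linear K -> U},
    short_exact j pb2 /\ forall x, pb1 (j x) = k x.
Proof.
have [pbE pb_ext pb_mk] := upb; move=> [kI kp pS]; have [|j [j1 j2]] := @pb_tuple K k (lzero K B).
  by move=> z; rewrite (exact_comp0 kp) linear0.
exists j; split=> //; apply: short_exactI.
- by move=> x y /(congr1 pb1); rewrite !j1; apply: kI.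
- by move=> b; have [x px] := pS (g b); have [u [_ u2]] := pb_mk _ _ px; exists u.
- by move=> x; rewrite j2.
move=> u u2; have [x kx] : exists x, k x = pb1 u.
  by apply/kp; rewrite pbE u2 linear0.
by exists x; apply: pb_ext; rewrite ?j1 ?j2.
Qed.

Lemma pullback_ses2 (A : lmodType R) (f : {linear A -> B}) : short_exact f g ->
  exists j : {linear A -> U},
    short_exact j pb1 /\ forall x, pb2 (j x) = f x.
Proof.
have [pbE pb_ext pb_mk] := upb; move=> [fI fg gS]; have [|j [j1 j2]] := @pb_tuple A (lzero A P) f.
  by move=> z; rewrite (exact_comp0 fg) linear0.
exists j; split=> //; apply: short_exactI.
- by move=> x y /(congr1 pb2); rewrite !j2; apply: fI.
- by move=> b; have [x /esym px] := gS (p b); have [u [u1 _]] := pb_mk _ _ px; exists u.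
- by move=> x; rewrite j1.
move=> u u1; have [x kx] : exists x, f x = pb2 u.
  by apply/fg; rewrite -pbE u1 linear0.
by exists x; apply: pb_ext; rewrite ?j1 ?j2.
Qed.

End Pullback.

(** Carries the extension property from projective presentations of [M] to every short exact
    sequence ending in [M], by comparing both inside the pullback of [B] and [P] over [M]. *)
Lemma Xt0_extend A B M N (f : {linear A -> B}) (g : {linear B -> M}) :
  Xt 0 M N -> short_exact f g ->
  forall h : {linear A -> N}, exists k : {linear B -> N}, forall x, k (f x) = h x.
Proof.
move=> MN fg h; have [K [P [k [p [PP kp]]]]] := enough_projectives M.
have [U [u1 [u2 upb]]] := pullback_exists g p.
have [jk [kpb j1]] := pullback_ses1 upb kp.
have [jf [fpb j2]] := pullback_ses2 upb fg.
have [fI fgE gS] := fg; have [kI kpE pS] := kp.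
have [s sE] := PP _ _ g p gS; have [pbE pb_ext pb_mk] := upb.
have [d dE] : exists d : {linear K -> A}, forall x, f (d x) = s (k x).
  apply: (lift_inj (h := s \o k)) => // x; apply/fgE.
  by rewrite /= sE (exact_comp0 kpE).
have [t tE] := MN _ _ k p PP kp (h \o d).
have [u uE] : exists u : {linear U -> A},
    forall x, f (u x) = u2 x - s (u1 x).
  apply: (lift_inj (h := u2 \- (s \o u1))).
    by [].
  by move=> x; apply/fgE; rewrite !lE linearB sE pbE subrr.
(* The map h u + t u1 on the pullback kills the kernel [K] of its projection to [B], hence lives on
   [B]; on [A], where u1 = 0 and [u] is the identity, it is [h]. *)
have [||w wE] := @descend R _ _ N (u2)
    ((h \o u) \+ (t \o u1)) _ _.
- by case: kpb.
- move=> x x2; have [_ ex _] := kpb; have [y yx] : exists y, jk y = x by apply/ex.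
  rewrite !lE -yx j1 tE lE -linearD; have -> : u (jk y) + d y = 0.
    apply: fI; rewrite linearD uE dE j1 linear0.
    by rewrite (exact_comp0 ex) sub0r addNr.
  by rewrite linear0.
exists w => a; have [x [x1 x2]] : exists x, u1 x = 0 /\ u2 x = f a.
  by apply: pb_mk; rewrite linear0 (exact_comp0 fgE).
rewrite -x2 wE !lE x1 linear0 addr0; congr (h _); apply: fI.
by rewrite uE x1 linear0 subr0.
Qed.

Lemma Xt_projective e P N : projective P -> Xt e P N.
Proof.
elim: e P => [|e IHe] P PP K Q f g PQ fg; last first.
  have [fI ex gS] := fg; have [s sE] := projective_split PP gS.
  apply: IHe.
  have [r rE] : exists r : {linear Q -> K}, forall x, f (r x) = x - s (g x).
    apply: (lift_inj (h := lid Q \- (s \o g))) => // x; apply/ex.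
    by rewrite /= linearB sE subrr.
  apply: (projective_retract (i := f) (p := r)) => // x.
  by apply: fI; rewrite rE (exact_comp0 ex) linear0 subr0.
have [fI ex gS] := fg; have [s sE] := projective_split PP gS => h.
have [r rE] : exists r : {linear Q -> K}, forall x, f (r x) = x - s (g x).
  apply: (lift_inj (h := lid Q \- (s \o g))) => // x; apply/ex.
  by rewrite /= linearB sE subrr.
exists (h \o r) => x /=; congr (h _); apply: fI.
by rewrite rE (exact_comp0 ex) linear0 subr0.
Qed.

(** A map on the syzygy [K] of [B] is extended in two stages, to [L] since L/K = A and then to [P]
    since P/L = X. *)
Lemma Xt0_mid A B X N : ses A B X -> Xt 0 A N -> Xt 0 X N -> Xt 0 B N.
Proof.
move=> [f [g fg]] AN XN K P k p PP kp h.
have [L [i [j [q [ip jq ij]]]]] := ses_syzygy fg kp.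
have [t tE] := Xt0_extend AN jq h.
have [u uE] := Xt0_extend XN ip t.
by exists u => x; rewrite -ij uE tE.
Qed.

(** A map on [K] extends to the pullback, whose quotient by [K] is [B]. Subtracting a map that comes
    from [B] makes it vanish on [A], and it descends to [P]. *)
Lemma Xt0_quot A B X N (f : {linear A -> B}) (g : {linear B -> X}) :
  short_exact f g ->
  (forall h : {linear A -> N}, exists k : {linear B -> N}, forall x, k (f x) = h x) ->
  Xt 0 B N -> Xt 0 X N.
Proof.
move=> fg ext BN K P k p PP kp h.
have [U [u1 [u2 upb]]] := pullback_exists g p.
have [jk [kpb j1]] := pullback_ses1 upb kp.
have [jf [fpb j2]] := pullback_ses2 upb fg.
have [u uE] := Xt0_extend BN kpb h.
have [v vE] := ext (u \o jf).
have [fpbI fpbE fpbS] := fpb; have [_ kpbE _] := kpb.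
have [||w wE] := @descend R _ _ N (u1)
  (u \- (v \o u2)) _ _ => //.
  move=> x /fpbE[y <-]; by rewrite !lE j2 vE lE subrr.
by exists w => x; rewrite -j1 wE !lE uE (exact_comp0 kpbE) linear0 subr0.
Qed.

(* The long exact sequence in the first variable is obtained by rotation: for
   projective [P], the sequence [0 -> A -> B -> X -> 0] yields
   [0 -> K -> L -> A -> 0] with [K], [L] syzygies of [B], [X] ([ses_syzygy]), and
   [0 -> K -> U -> B -> 0], [0 -> A -> U -> P -> 0] with [K] a syzygy of [X]. *)
Lemma Xt_quot_from_mid_sub e N :
  (forall A B X, ses A B X ->
    (Xt e A N -> Xt e X N -> Xt e B N) /\ (Xt e B N -> Xt e.+1 X N -> Xt e A N)) ->
  forall A B X, ses A B X -> Xt e A N -> Xt e.+1 B N -> Xt e.+1 X N.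
Proof.
move=> ms A B X [f [g fg]] AN BN K P k p PP kp.
have [U [u1 [u2 upb]]] := pullback_exists g p.
have [jk [kpb j1]] := pullback_ses1 upb kp.
have [jf [fpb j2]] := pullback_ses2 upb fg.
have UN : Xt e U N.
  by apply: (proj1 (ms _ _ _ _)) AN _; [exists jf, u1 | apply: Xt_projective].
by apply: (proj2 (ms _ _ _ _)) UN BN; exists jk, u2.
Qed.

(** The two claims share one induction: together in degree [e] they yield the quotient case from [e]
    to [e.+1], which the claim on [A] in degree [e.+1] consumes. *)
Lemma Xt_mid_sub e A B X N : ses A B X ->
  (Xt e A N -> Xt e X N -> Xt e B N) /\ (Xt e B N -> Xt e.+1 X N -> Xt e A N).
Proof.
elim: e A B X => [|e IHe] A B X ABX.
  split=> [|BN XN]; first exact: Xt0_mid.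
  have [f [g fg]] := ABX; have [K [P [k [p [PP kp]]]]] := enough_projectives B.
  have [L [i [j [q [ip jq ij]]]]] := ses_syzygy fg kp.
  apply: (Xt0_quot jq); last exact: XN ip.
  by move=> h; have [t tE] := BN _ _ k p PP kp h; exists (t \o i) => x /=; rewrite ij.
have quot := Xt_quot_from_mid_sub IHe.
have [f [g fg]] := ABX; split=> [AN XN K P k p PP kp|BN XN].
  have [L [i [j [q [ip jq ij]]]]] := ses_syzygy fg kp.
  by apply: (proj2 (IHe _ _ _ _)) (XN _ _ _ _ PP ip) AN; exists j, q.
have [K [P [k [p [PP kp]]]]] := enough_projectives B.
have [L [i [j [q [ip jq ij]]]]] := ses_syzygy fg kp.
by apply: quot (BN _ _ _ _ PP kp) (XN _ _ _ _ PP ip); exists j, q.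
Qed.

Lemma Xt_mid e A B X N : ses A B X -> Xt e A N -> Xt e X N -> Xt e B N.
Proof. by move=> s; apply: (proj1 (Xt_mid_sub e N s)). Qed.

Lemma Xt_sub e A B X N : ses A B X -> Xt e B N -> Xt e.+1 X N -> Xt e A N.
Proof. by move=> s; apply: (proj2 (Xt_mid_sub e N s)). Qed.

Lemma Xt_quot e A B X N : ses A B X -> Xt e A N -> Xt e.+1 B N -> Xt e.+1 X N.
Proof. by apply: Xt_quot_from_mid_sub => A' B' X'; apply: Xt_mid_sub. Qed.

Lemma Xt0_lift M A B X (f : {linear A -> B}) (g : {linear B -> X}) :
  short_exact f g -> Xt 0 M A ->
  forall h : {linear M -> X}, exists k : {linear M -> B}, forall x, g (k x) = h x.
Proof.
move=> fg MA h; have [K [P [k [p [PP kp]]]]] := enough_projectives M.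
have [fI fgE gS] := fg; have [kI kpE pS] := kp.
have [s sE] := PP _ _ g (h \o p) gS.
have [d dE] : exists d : {linear K -> A}, forall x, f (d x) = s (k x).
  apply: (lift_inj (h := s \o k)) => // x; apply/fgE.
  by rewrite /= sE /= (exact_comp0 kpE) linear0.
have [t tE] := MA _ _ k p PP kp d.
have [w wE] : exists w : {linear M -> B}, forall x, w (p x) = s x - f (t x).
  apply: (descend (f := s \- (f \o t))) => // x /kpE[y <-].
  by rewrite /= tE dE subrr.
exists w => x; have [y <-] := pS x.
by rewrite wE linearB sE (exact_comp0 fgE) subr0.
Qed.

Lemma Xt_mid_r e M A B X : ses A B X -> Xt e M A -> Xt e M X -> Xt e M B.
Proof.
move=> ABX; elim: e M => [|e IHe] M MA MX K P k p PP kp; last first.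
  by apply: IHe; [apply: MA kp | apply: MX kp].
have [f [g fg]] := ABX; have [fI fgE gS] := fg => h.
have [u uE] := MX _ _ k p PP kp (g \o h).
have [v vE] := PP _ _ g u gS.
have [d dE] : exists d : {linear K -> A}, forall x, f (d x) = h x - v (k x).
  apply: (lift_inj (h := h \- (v \o k))) => // x; apply/fgE.
  by rewrite /= linearB vE uE subrr.
have [t tE] := MA _ _ k p PP kp d.
by exists (v \+ (f \o t)) => x /=; rewrite tE dE addrC subrK.
Qed.

Lemma Xt0_sub_r M A B X (f : {linear A -> B}) (g : {linear B -> X}) :
  short_exact f g ->
  (forall h : {linear M -> X}, exists k : {linear M -> B}, forall x, g (k x) = h x) ->
  Xt 0 M B -> Xt 0 M A.
Proof.
move=> [fI fgE gS] lift MB K P k p PP kp h; have [kI kpE pS] := kp.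
have [u uE] := MB _ _ k p PP kp (f \o h).
have [v vE] : exists v : {linear M -> X}, forall x, v (p x) = g (u x).
  apply: (descend (f := g \o u)) => // x /kpE[y <-].
  by rewrite /= uE /= (exact_comp0 fgE).
have [w wE] := lift v.
have [d dE] : exists d : {linear P -> A}, forall x, f (d x) = u x - w (p x).
  apply: (lift_inj (h := u \- (w \o p))) => // x; apply/fgE.
  by rewrite /= linearB wE vE subrr.
by exists d => x; apply: fI; rewrite dE uE (exact_comp0 kpE) linear0 subr0.
Qed.

Lemma Xt_quot_r e M A B X : ses A B X -> Xt e M B -> Xt e.+1 M A -> Xt e M X.
Proof.
move=> ABX; elim: e M => [|e IHe] M MB MA K P k p PP kp; last first.
  by apply: IHe; [apply: MB kp | apply: MA kp].
have [f [g fg]] := ABX => h.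
have [u uE] := Xt0_lift fg (MA _ _ k p PP kp) h.
have [v vE] := MB _ _ k p PP kp u.
by exists (g \o v) => x /=; rewrite vE uE.
Qed.

Lemma Xt_sub_r e M A B X : ses A B X -> Xt e M X -> Xt e.+1 M B -> Xt e.+1 M A.
Proof.
move=> ABX; elim: e M => [|e IHe] M MX MB K P k p PP kp; last first.
  by apply: IHe; [apply: MX kp | apply: MB kp].
have [f [g fg]] := ABX; apply: (Xt0_sub_r fg); last exact: MB kp.
move=> h; have [_ _ gS] := fg.
have [u uE] := MX _ _ k p PP kp h; have [v vE] := PP _ _ g u gS.
by exists (v \o k) => x /=; rewrite vE uE.
Qed.

Lemma Xt_injective e M I : injective_module I -> Xt e M I.
Proof.
move=> II; elim: e M => [|e IHe] M K P k p PP kp; last exact: IHe.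
by move=> h; apply: II; case: kp.
Qed.

Lemma is_zero_projective Z : is_zero Z -> projective Z.
Proof.
by move=> Z0 A B g f gS; exists (lzero Z A) => x; rewrite (Z0 x) !linear0.
Qed.

Lemma is_zero_injective Z : is_zero Z -> injective_module Z.
Proof.
move=> Z0 A B i f iI; exists (lzero B Z) => x.
by rewrite (Z0 (f x)) (Z0 (lzero B Z (i x))).
Qed.

Lemma Xt_pres e M N K P : projective P -> ses K P M -> Xt e K N -> Xt e.+1 M N.
Proof. by move=> PP s KN; apply: Xt_quot s KN _; apply: Xt_projective. Qed.

Lemma Xt_retract_r e M N N' (i : {linear N' -> N}) (p : {linear N -> N'}) :
  (forall x, p (i x) = x) -> Xt e M N -> Xt e M N'.
Proof.
move=> pi; elim: e M => [|e IHe] M MN K P k q PP kq; last by apply: IHe; apply: MN kq.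
move=> h; have [u uE] := MN _ _ k q PP kq (i \o h).
by exists (p \o u) => x /=; rewrite uE /= pi.
Qed.

Lemma Xt_retract_l e M M' N (i : {linear M' -> M}) (p : {linear M -> M'}) :
  (forall x, p (i x) = x) -> Xt e M N -> Xt e M' N.
Proof.
elim: e M M' i p => [|e IHe] M M' i p pi MN K P k q PP kq.
  have [U [u1 [u2 upb]]] := pullback_exists p q.
  have [jk [kpb j1]] := pullback_ses1 upb kq => h.
  have [u uE] := Xt0_extend MN kpb h; have [_ kqE _] := kq; have [_ pb_ext _] := upb.
  have [|w [w1 w2]] := @pb_tuple _ _ _ _ _ _ _ _ upb P (lid P) (i \o q).
    by move=> z; rewrite /= pi.
  exists (u \o w) => x /=; rewrite -uE; congr (u _); apply: pb_ext.
    by rewrite w1 j1.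
  have [_ kpbE _] := kpb.
  by rewrite w2 /= (exact_comp0 kqE) linear0 (exact_comp0 kpbE).
have [kI kqE qS] := kq.
have [K2 [P2 [k2 [p2 [PP2 kp2]]]]] := enough_projectives M.
have [k2I kp2E p2S] := kp2.
(* Adding the cover [P] of M' to a cover [P2] of [M] makes the syzygy of M' a retract of that of
   [M]: x goes to (x, 0), and (x, y) back to x + l y, where [l] lifts p p2 through [q]. *)
pose c : {linear prodM P P2 -> M} := (i \o q \o pfst P P2) \+ (p2 \o psnd P P2).
have cS : surjection c.
  by move=> m; have [y <-] := p2S m; exists (0, y); rewrite /= !linear0 add0r.
have K3N := MN _ _ _ _ (projective_prod PP PP2) (kernel_ses cS).
have [l lE] := PP2 _ _ q (p \o p2) qS.
have [a aE] : exists a : {linear K -> smod (kernel c)},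
    forall x, sincl (kernel c) (a x) = (k x, 0).
  have kl : linear (fun x => (k x, 0 : P2)).
    by move=> r x y; apply: injective_projections; rewrite /= ?linearP ?scaler0 ?addr0.
  apply: (lift_inj (h := lin kl)); first exact: sincl_inj.
  move=> x; apply/(sinclP (kernel c)).
  by rewrite /= (exact_comp0 kqE) !linear0 addr0.
have [b bE] : exists b : {linear smod (kernel c) -> K},
    forall x, k (b x) = (sincl (kernel c) x).1 + l (sincl (kernel c) x).2.
  apply: (lift_inj (h := (fst \o sincl (kernel c)) \+ (l \o snd \o sincl (kernel c)))) => // x.
  apply/kqE; rewrite /= linearD lE /=.
  by have /(congr1 p) /= := svalP x; rewrite linearD pi linear0.
apply: (IHe _ _ a b _ K3N) => x; apply: kI.
by rewrite bE aE /= linear0 addr0.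
Qed.

End Ext.

(** * Resolutions and syzygies *)

Section Resolutions.
Variable R : comPzRingType.
Implicit Types A B M N X Y K P T : lmodType R.

Lemma lexact_lcomplex M (L : lseq M) : lexact L -> lcomplex L.
Proof.
by move=> [_ e0 e]; split=> [x|n x]; [apply/e0 | apply/e]; exists x.
Qed.

Lemma rexact_rcomplex M (L : rseq M) : rexact L -> rcomplex L.
Proof.
by move=> [_ e0 e]; split=> [x|n x]; [apply/e0 | apply/e]; exists x.
Qed.

Section Cons.
Variables (K P M : lmodType R) (k : {linear K -> P}) (p : {linear P -> M}).

Definition lcons_obj (L : lseq K) n : lmodType R :=
  if n is m.+1 then lobj L m else P.

Definition lcons_diff (L : lseq K) n :
    {linear lcons_obj L n.+1 -> lcons_obj L n} :=
  match n with 0 => k \o laug L | m.+1 => ldiff L m end.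

Definition lcons (L : lseq K) : lseq M := @LSeq R M (lcons_obj L) (lcons_diff L) p.

Lemma lcons_exact L : short_exact k p -> lexact L -> lexact (lcons L).
Proof.
move=> [kI kp pS] [LS L0 Ln]; split=> //=.
- move=> b; split=> [/kp[a <-]|[a <-]]; last by rewrite /= (exact_comp0 kp).
  by have [c <-] := LS a; exists c.
case=> [|n]; last exact: Ln.
move=> b; split=> [|/L0 /= ->]; last by rewrite linear0.
by move=> /= kb; apply/L0; apply: kI; rewrite kb linear0.
Qed.

End Cons.

Lemma lshift M (L : lseq M) : lexact L ->
  exists (K : lmodType R) (i : {linear K -> lobj L 0}) (q : {linear lobj L 1 -> K}),
    [/\ short_exact i (laug L), forall x, i (q x) = ldiff L 0 x &
        lexact (LSeq (fun n => ldiff L n.+1) q)].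
Proof.
move=> [LS L0 Ln]; pose S := kernel (laug L).
have [q qE] : exists q : {linear lobj L 1 -> smod S},
    forall x, sincl S (q x) = ldiff L 0 x.
  apply: lift_inj; first exact: sincl_inj.
  by move=> x; apply/(sinclP S)/L0; exists x.
exists (smod S), (sincl S), q; split=> //; first exact: kernel_ses.
split=> [y|b|n] /=; last exact: Ln.
  have /L0[x xy] : laug L (sincl S y) = 0 by exact: (svalP y).
  by exists x; apply: (@sincl_inj _ _ S); rewrite qE.
rewrite -(Ln 0 b) -qE; split=> [->|]; first by rewrite linear0.
by rewrite -(linear0 (sincl S)) => /(@sincl_inj _ _ S).
Qed.

Lemma rshift M (L : rseq M) : rexact L ->
  exists (K : lmodType R) (q : {linear robj L 0 -> K}) (i : {linear K -> robj L 1}),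
    [/\ short_exact (raug L) q, forall x, i (q x) = rdiff L 0 x &
        rexact (RSeq (fun n => rdiff L n.+1) i)].
Proof.
move=> [LI L0 Ln]; pose S := kernel (rdiff L 1).
have [q qE] : exists q : {linear robj L 0 -> smod S},
    forall x, sincl S (q x) = rdiff L 0 x.
  apply: lift_inj; first exact: sincl_inj.
  by move=> x; apply/(sinclP S)/(Ln 0); exists x.
exists (smod S), q, (sincl S); split=> //; last first.
  split=> [|b|n] /=; [exact: sincl_inj| |exact: Ln].
  by rewrite (Ln 0); split=> [/(Ln 0)/(sinclP S)|/(sinclP S)/(Ln 0)].
apply: short_exactI => //.
- move=> y; have /(Ln 0)[x xy] : rdiff L 1 (sincl S y) = 0 by exact: (svalP y).
  by exists x; apply: (@sincl_inj _ _ S); rewrite qE.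
- move=> x; apply: (@sincl_inj _ _ S); rewrite qE linear0.
  by apply/L0; exists x.
by move=> y qy; apply/L0; rewrite -qE qy linear0.
Qed.

(* [Z n] is the [n+1]-st syzygy. *)
Record lsyzygies M (L : lseq M) (Z : nat -> lmodType R)
    (f : forall n, {linear Z n -> lobj L n})
    (g : forall n, {linear lobj L n.+1 -> Z n}) : Prop := {
  lsyz0 : short_exact (f 0) (laug L);
  lsyzS : forall n, short_exact (f n.+1) (g n);
  lsyz_diff : forall n x, ldiff L n x = f n (g n x)
}.

Record rsyzygies M (L : rseq M) (Z : nat -> lmodType R)
    (f : forall n, {linear Z n -> robj L n.+1})
    (g : forall n, {linear robj L n -> Z n}) : Prop := {
  rsyz0 : short_exact (raug L) (g 0);
  rsyzS : forall n, short_exact (f n) (g n.+1);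
  rsyz_diff : forall n x, rdiff L n x = f n (g n x)
}.

Lemma compose_exact A B X X' Y (g : {linear A -> B}) (f : {linear B -> X})
    (g' : {linear X -> X'}) (f' : {linear X' -> Y}) (d : {linear A -> X})
    (d' : {linear X -> Y}) :
  surjection g -> exact f g' -> injection f' ->
  (forall x, d x = f (g x)) -> (forall x, d' x = f' (g' x)) -> exact d d'.
Proof.
move=> gS fg fI dE dE' b; split=> [|[a <-]]; last first.
  by rewrite dE' dE (exact_comp0 fg) linear0.
rewrite dE' -(linear0 f') => /fI/fg[c <-].
by have [a <-] := gS c; exists a; rewrite dE.
Qed.

Lemma exact_injr A B X Y (f : {linear A -> B}) (g : {linear B -> X})
    (i : {linear X -> Y}) (h : {linear B -> Y}) :
  exact f g -> injection i -> (forall x, h x = i (g x)) -> exact f h.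
Proof.
move=> fg iI hE b; rewrite -fg hE; split=> [|->]; last by rewrite linear0.
by rewrite -(linear0 i) => /iI.
Qed.

Lemma exact_surjl A B X Y (p : {linear Y -> A}) (f : {linear A -> B})
    (g : {linear B -> X}) (h : {linear Y -> B}) :
  exact f g -> surjection p -> (forall x, h x = f (p x)) -> exact h g.
Proof.
move=> fg pS hE b; rewrite fg; split=> -[a <-]; last by exists (p a).
by have [c <-] := pS a; exists c.
Qed.

Lemma lsyz_exact M (L : lseq M) (Z : nat -> lmodType R) f g : @lsyzygies M L Z f g -> lexact L.
Proof.
move=> [[f0I f0E aS] fS dE]; split=> //.
  by have [_ _ gS] := fS 0; apply: exact_surjl f0E gS (dE 0).
have fI m : injection (f m) by case: m => [//|m]; case: (fS m).
move=> n; have [_ fE _] := fS n; have [_ _ gS] := fS n.+1.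
exact: compose_exact gS fE (fI n) (dE n.+1) (dE n).
Qed.

Lemma rsyz_exact M (L : rseq M) (Z : nat -> lmodType R) f g : @rsyzygies M L Z f g -> rexact L.
Proof.
move=> [[aI aE g0S] fS dE]; split=> //.
  by have [fI _ _] := fS 0; apply: exact_injr aE fI (dE 0).
have gS m : surjection (g m) by case: m => [//|m]; case: (fS m).
move=> n; have [_ fE _] := fS n; have [fI _ _] := fS n.+1.
exact: compose_exact (gS n) fE fI (dE n) (dE n.+1).
Qed.

Definition hom_onto T A B (g : {linear A -> B}) : Prop :=
  forall h : {linear T -> B}, exists k : {linear T -> A}, forall x, g (k x) = h x.
Definition hom_ext N A B (f : {linear A -> B}) : Prop :=
  forall h : {linear A -> N}, exists k : {linear B -> N}, forall x, k (f x) = h x.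

Lemma hom_post_short T A B X (f : {linear A -> B}) (g : {linear B -> X}) :
  short_exact f g -> hom_onto T g -> short_exact (hom_post T f) (hom_post T g).
Proof.
move=> [fI fE _] gT; apply: short_exactI.
- move=> u v uv; apply: lhomP => x; apply: fI.
  by have /(congr1 (fun w : lhom T B => w x)) := uv.
- by move=> h; have [k kE] := gT h; exists k; apply: lhomP => x; apply: kE.
- by move=> u; apply: lhomP => x; apply: (exact_comp0 fE).
move=> v gv; have [|u uE] := @lift_inj R A B T f v fI _; last first.
  by exists u; apply: lhomP => x; apply: uE.
by move=> x; apply/fE; have /(congr1 (fun w : lhom T X => w x)) := gv.
Qed.

Lemma hom_pre_short N A B X (f : {linear A -> B}) (g : {linear B -> X}) :
  short_exact f g -> hom_ext N f -> short_exact (hom_pre N g) (hom_pre N f).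
Proof.
move=> [fI fE gS] fN; apply: short_exactI.
- move=> u v uv; apply: lhomP => x; have [y <-] := gS x.
  by have /(congr1 (fun w : lhom B N => w y)) := uv.
- by move=> h; have [k kE] := fN h; exists k; apply: lhomP => x; apply: kE.
- by move=> u; apply: lhomP => x; rewrite /= /hom_pre /= (exact_comp0 fE) linear0.
move=> v fv; have [|u uE] := @descend R B X N g v gS _; last first.
  by exists u; apply: lhomP => x; apply: uE.
by move=> x /fE[y <-]; have /(congr1 (fun w : lhom A N => w y)) := fv.
Qed.

Lemma lsyz_hom_post M (L : lseq M) (Z : nat -> lmodType R) f g T : @lsyzygies M L Z f g ->
  hom_onto T (laug L) -> (forall n, hom_onto T (g n)) -> lexact (hom_lseq T L).
Proof.
move=> [f0 fS dE] aT gT.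
apply: (@lsyz_exact _ (hom_lseq T L) (fun n => lhom T (Z n))
  (fun n => hom_post T (f n)) (fun n => hom_post T (g n))); split.
- exact: hom_post_short.
- by move=> n; apply: hom_post_short.
by move=> n u; apply: lhomP => x; apply: dE.
Qed.

Lemma lsyz_hom_pre M (L : lseq M) (Z : nat -> lmodType R) f g N : @lsyzygies M L Z f g ->
  (forall n, hom_ext N (f n)) -> rexact (lseq_hom L N).
Proof.
move=> [f0 fS dE] fN.
apply: (@rsyz_exact _ (lseq_hom L N) (fun n => lhom (Z n) N)
  (fun n => hom_pre N (g n)) (fun n => hom_pre N (f n))); split.
- exact: hom_pre_short.
- by move=> n; apply: hom_pre_short.
by move=> n u; apply: lhomP => x; rewrite /= /hom_pre /= dE.
Qed.

Lemma rsyz_hom_post M (L : rseq M) (Z : nat -> lmodType R) f g T : @rsyzygies M L Z f g ->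
  (forall n, hom_onto T (g n)) -> rexact (hom_rseq T L).
Proof.
move=> [g0 fS dE] gT.
apply: (@rsyz_exact _ (hom_rseq T L) (fun n => lhom T (Z n))
  (fun n => hom_post T (f n)) (fun n => hom_post T (g n))); split.
- exact: hom_post_short.
- by move=> n; apply: hom_post_short.
by move=> n u; apply: lhomP => x; apply: dE.
Qed.

Lemma rsyz_hom_pre M (L : rseq M) (Z : nat -> lmodType R) f g N : @rsyzygies M L Z f g ->
  hom_ext N (raug L) -> (forall n, hom_ext N (f n)) -> lexact (rseq_hom L N).
Proof.
move=> [g0 fS dE] aN fN.
apply: (@lsyz_exact _ (rseq_hom L N) (fun n => lhom (Z n) N)
  (fun n => hom_pre N (g n)) (fun n => hom_pre N (f n))); split.
- exact: hom_pre_short.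
- by move=> n; apply: hom_pre_short.
by move=> n u; apply: lhomP => x; rewrite /= /hom_pre /= dE.
Qed.

Section Build.
Variables (C : lmodType R -> Prop) (Q : lmodType R -> lmodType R -> lmodType R -> Prop).

Record lstep M := LStep {
  ls_syz : lmodType R; ls_mid : lmodType R;
  ls_f : {linear ls_syz -> ls_mid}; ls_g : {linear ls_mid -> M};
  ls_ses : short_exact ls_f ls_g;
  ls_Q : Q ls_syz ls_mid M;
  ls_C : C ls_syz
}.

(** Dependent choice: the class [C] is stable under forming syzygies, and [Q] records what is known
    about each short exact sequence of the resulting resolution. *)
Lemma lbuild :
  (forall M, C M -> exists K X, [/\ ses K X M, Q K X M & C K]) ->
  forall M, C M -> exists (L : lseq M) (Z : nat -> lmodType R)
    (f : forall n, {linear Z n -> lobj L n})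
    (g : forall n, {linear lobj L n.+1 -> Z n}),
    [/\ lsyzygies f g, Q (Z 0) (lobj L 0) M &
        forall n, Q (Z n.+1) (lobj L n.+1) (Z n)].
Proof.
move=> step M CM.
have next (K : {M | C M}) : lstep (sval K).
  have : exists s : lstep (sval K), True.
    have [K' [X [[f [g fg]] QK CK]]] := step _ (svalP K).
    by exists (LStep fg QK CK).
  by move=> /cid[].
pose z := fix z n : {M | C M} :=
  if n is m.+1 then exist _ _ (ls_C (next (z m))) else exist _ M CM.
pose L := @LSeq R M (fun n => ls_mid (next (z n)))
  (fun n => ls_f (next (z n)) \o ls_g (next (z n.+1))) (ls_g (next (z 0))).
exists L, (fun n => ls_syz (next (z n))), (fun n => ls_f (next (z n))),
  (fun n => ls_g (next (z n.+1))).
split; [split=> // | exact: (ls_Q (next (z 0))) | ].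
- exact: (ls_ses (next (z 0))).
- by move=> n; apply: (ls_ses (next (z n.+1))).
by move=> n; apply: (ls_Q (next (z n.+1))).
Qed.

Record rstep M := RStep {
  rs_syz : lmodType R; rs_mid : lmodType R;
  rs_f : {linear M -> rs_mid}; rs_g : {linear rs_mid -> rs_syz};
  rs_ses : short_exact rs_f rs_g;
  rs_Q : Q M rs_mid rs_syz;
  rs_C : C rs_syz
}.

Lemma rbuild :
  (forall M, C M -> exists X K, [/\ ses M X K, Q M X K & C K]) ->
  forall M, C M -> exists (L : rseq M) (Z : nat -> lmodType R)
    (f : forall n, {linear Z n -> robj L n.+1})
    (g : forall n, {linear robj L n -> Z n}),
    [/\ rsyzygies f g, Q M (robj L 0) (Z 0) &
        forall n, Q (Z n) (robj L n.+1) (Z n.+1)].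
Proof.
move=> step M CM.
have next (K : {M | C M}) : rstep (sval K).
  have : exists s : rstep (sval K), True.
    have [X [K' [[f [g fg]] QK CK]]] := step _ (svalP K).
    by exists (RStep fg QK CK).
  by move=> /cid[].
pose z := fix z n : {M | C M} :=
  if n is m.+1 then exist _ _ (rs_C (next (z m))) else exist _ M CM.
pose L := @RSeq R M (fun n => rs_mid (next (z n)))
  (fun n => rs_f (next (z n.+1)) \o rs_g (next (z n))) (rs_f (next (z 0))).
exists L, (fun n => rs_syz (next (z n))), (fun n => rs_f (next (z n.+1))),
  (fun n => rs_g (next (z n))).
split; [split=> // | exact: (rs_Q (next (z 0))) | ].
- exact: (rs_ses (next (z 0))).
- by move=> n; apply: (rs_ses (next (z n.+1))).
by move=> n; apply: (rs_Q (next (z n.+1))).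
Qed.

End Build.

Lemma projective_resolution_exists M : exists L : lseq M, projective_resolution L.
Proof.
have [||L [Z [f [g [s q0 q]]]]] :=
    @lbuild (fun=> True) (fun _ P _ => projective P) _ M => //.
  move=> N _; have [K [P [f [g [PP fg]]]]] := enough_projectives N.
  by exists K, P; split=> //; exists f, g.
by exists L; split; [apply: lsyz_exact s | case].
Qed.

(** Prepending a presentation to a resolution, or cutting off its first term, shifts the degree by
    one. What remains is degree 1, where a cocycle is a map from the first syzygy to [N] and a
    coboundary one that extends to P_0. *)
Lemma Ext_eq0_Xt e M N : Ext_eq0 e.+1 M N <-> Xt e M N.
Proof.
split; elim: e M => [|e IHe] M MN.
- move=> K P k p PP kp h.
  have [L [Lex LP]] := projective_resolution_exists K.
  have cP n : projective (lobj (lcons k p L) n) by case: n.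
  have [MN1 _] := MN (lcons k p L) (conj (lcons_exact kp Lex) cP) (h \o laug L).
  have [|a aE] := MN1.
    apply: lhomP => x.
    by rewrite /= /hom_pre /= (proj1 (lexact_lcomplex Lex)) linear0.
  exists a => x; have [LS _ _] := Lex; have [y <-] := LS x.
  by have /(congr1 (fun w : lhom _ _ => w y)) := aE.
- move=> K P k p PP kp; apply: IHe => L [Lex LP].
  have cP n : projective (lobj (lcons k p L) n) by case: n.
  exact: (MN (lcons k p L) (conj (lcons_exact kp Lex) cP)).
- move=> L [Lex LP]; have [K [i [q [iq iqE Kex]]]] := lshift Lex => b.
  split=> [b0|[a <-]]; last first.
    apply: lhomP => x; rewrite /= /hom_pre /=.
    by rewrite (proj2 (lexact_lcomplex Lex)) linear0.
  have [qS qE _] := Kex.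
  have [|c cE] := @descend R _ _ N q b qS _.
    by move=> x /qE[y <-]; have /(congr1 (fun w : lhom _ _ => w y)) := b0.
  have [a aE] := MN _ _ i (laug L) (LP 0) iq c.
  by exists a; apply: lhomP => x; rewrite -cE -aE iqE.
move=> L [Lex LP]; have [K [i [q [iq iqE Kex]]]] := lshift Lex.
have KN := MN _ _ i (laug L) (LP 0) iq.
exact: (IHe K KN (LSeq (fun n => ldiff L n.+1) q) (conj Kex (fun n => LP n.+1))).
Qed.

End Resolutions.

(** * Relative homological algebra *)

(* The axioms below are self-dual, so that each statement on the classes
   [X], [omega] yields the one on [Y], [nu] by reversing the sequences. *)
Record ext_structure (T : Type) (S : T -> T -> T -> Prop) (E : nat -> T -> T -> Prop)
    (sum : T -> T -> T) (zero : T -> Prop) : Prop := {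
  pushout : forall K X M H X', S K X M -> S K H X' ->
    exists Z, S H Z M /\ S X Z X';
  pullback : forall K X M H X', S M X K -> S X' H K ->
    exists Z, S M Z H /\ S X' Z X;
  quot_iso : forall H Z M W X, S H Z M -> S Z W X -> exists H', S M H' X /\ S H W H';
  sub_iso : forall H Z M W X, S M Z H -> S X W Z -> exists H', S X H' M /\ S H' W H;
  split_mono : forall W Z X W' X', S W Z X -> E 0 X W -> S X W' X' -> S Z (sum W W') X';
  split_epi : forall W Z X W' X', S X Z W -> E 0 W X -> S X' W' X -> S X' (sum W W') Z;
  ext_mid : forall e A B X N, S A B X -> E e A N -> E e X N -> E e B N;
  ext_sub : forall e A B X N, S A B X -> E e B N -> E e.+1 X N -> E e A N;
  ext_quot : forall e A B X N, S A B X -> E e A N -> E e.+1 B N -> E e.+1 X N;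
  ext_midr : forall e A B X N, S A B X -> E e N A -> E e N X -> E e N B;
  ext_subr : forall e A B X N, S A B X -> E e N X -> E e.+1 N B -> E e.+1 N A;
  ext_quotr : forall e A B X N, S A B X -> E e N B -> E e.+1 N A -> E e N X;
  ext_zero : forall e Z N, zero Z -> E e Z N;
  ext_zeror : forall e Z N, zero Z -> E e N Z;
  zero_quot : forall A, exists Z, zero Z /\ S A A Z;
  zero_sub : forall A, exists Z, zero Z /\ S Z A A
}.

Lemma ext_structure_op T (S : T -> T -> T -> Prop) E sum zero :
  ext_structure S E sum zero ->
  ext_structure (fun A B X => S X B A) (fun e A B => E e B A) sum zero.
Proof.
case=> po pb qi si sm se m s q mr sr qr z zr zq zs.
by split=> *; eauto.
Qed.

Section Relative.
Variables (T : Type) (S : T -> T -> T -> Prop) (E : nat -> T -> T -> Prop).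
Variables (sum : T -> T -> T) (zero : T -> Prop).
Hypothesis ES : ext_structure S E sum zero.
Implicit Types (A B M N X K H V W Z : T) (C D : T -> Prop).

Definition orth C D := forall e A B, C A -> D B -> E e A B.

(** The index counts terms, not the top degree. Ending in a zero object makes the empty resolution
    the base case and keeps sequences of maps out of the inductions. *)
Inductive coarse C : nat -> T -> Prop :=
| coarse_zero M : zero M -> coarse C 0 M
| coarse_step n K X M : S K X M -> C X -> coarse C n K -> coarse C n.+1 M.

Definition fin_res C M := exists n, coarse C n M.

(* The largest class [C] of objects orthogonal to [D] in which [D] cogenerates:
   this replaces the infinite coresolution in the definition of [GP_]. *)
Definition gor (D : T -> Prop) M := exists C : T -> Prop, C M /\
  forall K, C K -> (forall e V, D V -> E e K V) /\
    exists V K', [/\ D V, C K' & S K V K'].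

Lemma gor_step D M : gor D M -> (forall e V, D V -> E e M V) /\
  exists V K, [/\ D V, gor D K & S M V K].
Proof.
move=> [C [CM Cstep]]; have [MD [V [K [DV CK sK]]]] := Cstep M CM.
by split=> //; exists V, K; split=> //; exists C.
Qed.

Lemma gor_orth D : orth (gor D) D.
Proof. by move=> e M V /gor_step[+ _]; apply. Qed.

(** Each term of the resolution lowers the degree by one until the zero object is reached; [n <= e]
    leaves room for all [n] shifts. *)
Lemma fin_res_orth C D : orth C D ->
  forall n H N e, coarse C n H -> D N -> (n <= e)%N -> E e H N.
Proof.
move=> CD n H N + cH DN; elim: cH => [M zM e _|m K X M sKM CX _ IH [//|e] me].
  exact: (ext_zero ES).
by apply: (ext_quot ES sKM); [apply: IH | apply: CD].
Qed.

Lemma fin_res_orthr C D : orth C D -> orth C (fin_res D).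
Proof.
move=> CD e A N CA [n cN]; elim: cN e => [M zM e|m K X M sKM DX _ IH e].
  exact: (ext_zeror ES).
by apply: (ext_quotr ES sKM); [apply: CD | apply: IH].
Qed.

(* Dimension shifting in both variables: Ext^e(H, N) = Ext^(e+n)(H, N') vanishes
   when [N'] is an [n]-th [D]-syzygy of [N] and [n] is the length of [H]. *)
Lemma fin_res_generated C D G :
    (forall N, G N -> exists V N', [/\ D V, G N' & S N' V N]) ->
  orth C G -> orth (fin_res C) D -> orth (fin_res C) G.
Proof.
move=> Ggen CG CD e H N [n cH] GN.
suff: forall j e N, G N -> (n <= e + j)%N -> E e H N.
  by move/(_ n e N GN); apply; apply: leq_addl.
elim=> [|j IH] {GN}e {}N GN ne.
  by apply: fin_res_orth CG _ _ _ _ cH GN _; rewrite -[e]addn0.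
have [V [N' [DV GN' sN]]] := Ggen N GN.
apply: (ext_quotr ES sN); first by apply: CD => //; exists n.
by apply: IH => //; rewrite addSnnS.
Qed.

Section Cogenerator.
Variable D : T -> Prop.
Hypothesis D0 : forall Z, zero Z -> D Z.
Hypothesis Dsum : forall A B, D A -> D B -> D (sum A B).
Hypothesis DD : orth D D.

Lemma sub_gor M : D M -> gor D M.
Proof.
move=> DM; exists D; split=> // K DK; split=> [e V DV|]; first exact: DD.
by have [Z [zZ sZ]] := zero_quot ES K; exists K, Z; split=> //; apply: D0.
Qed.

Lemma zero_gor M : zero M -> gor D M.
Proof. by move=> /D0; apply: sub_gor. Qed.

(** A horseshoe argument, with the extensions of members of [gor D] as witness class. Pushing [B]
    out along A -> V gives an extension of [X] by [V]; it splits, and X -> V' then embeds it, and so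
    [B], in the sum of [V] and V'. *)
Lemma gor_extension A B X : S A B X -> gor D A -> gor D X -> gor D B.
Proof.
move=> sB gA gX; exists (fun B => exists A X, [/\ S A B X, gor D A & gor D X]).
split; first by exists A, X.
move=> {gA gX sB A B X} B [A [X [sB gA gX]]].
have [AD [V [A' [DV gA' sA]]]] := gor_step gA.
have [XD [V' [X' [DV' gX' sX]]]] := gor_step gX.
split=> [e W DW|]; first by apply: (ext_mid ES sB); [apply: AD | apply: XD].
have [Z [sZ sBZ]] := pushout ES sB sA.
have sZX := split_mono ES sZ (XD 0 V DV) sX.
have [B' [sB' sBV]] := quot_iso ES sBZ sZX.
by exists (sum V V'), B'; split=> //; [apply: Dsum | exists A', X'].
Qed.

(** Both Auslander-Buchweitz approximations come out of one induction. The hull K -> H of the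
    syzygy, pushed out along K -> X, gives the cover Z -> M with kernel [H]; embedding [Z] in an
    object [V] of [D] then gives the hull V/H of [M]. *)
Lemma gor_approx M : fin_res (gor D) M ->
  (exists K X, [/\ S K X M, fin_res D K & gor D X]) /\
  (exists H X, [/\ S M H X, fin_res D H & gor D X]).
Proof.
move=> [n cM]; elim: cM => {n M} [M zM|n K X M sM gX _ [_ IH]].
  have [Z [zZ sZ]] := zero_quot ES M; have [Z' [zZ' sZ']] := zero_sub ES M.
  split.
    by exists Z', M; split=> //; [exists 0; apply: coarse_zero | apply: zero_gor].
  by exists M, Z; split=> //; [exists 0; apply: coarse_zero | apply: zero_gor].
have [H [X' [sK [m cH] gX']]] := IH.
have [Z [sZ sXZ]] := pushout ES sM sK.
have gZ := gor_extension sXZ gX gX'.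
split; first by exists H, Z; split=> //; exists m.
have [_ [V [X'' [DV gX'' sV]]]] := gor_step gZ.
have [H' [sMH sHV]] := quot_iso ES sZ sV.
by exists H', X''; split=> //; exists m.+1; apply: coarse_step sHV DV cH.
Qed.

(** The hull M -> H with cokernel in [gor D] squeezes Ext(M, -) between Ext(H, -) and Ext of the
    cokernel in the next degree. *)
Lemma gor_fin_res_orth G :
  orth (gor D) G -> orth (fin_res D) G -> orth (fin_res (gor D)) G.
Proof.
move=> gG DG e M N /gor_approx[_ [H [X [sM cH gX]]]] GN.
by apply: (ext_sub ES sM); [apply: DG | apply: gG].
Qed.

Lemma fin_res_gor M : fin_res D M -> fin_res (gor D) M.
Proof.
move=> [n cM]; exists n; elim: cM => [N|m K X N sN DX _]; first exact: coarse_zero.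
by apply: coarse_step sN _; apply: sub_gor.
Qed.

End Cogenerator.
End Relative.

(** * Pushouts, pullbacks and splittings: modules satisfy the axioms *)

Section ModuleExt.
Variable R : comPzRingType.
Implicit Types A B M N X Y H K W Z : lmodType R.

Definition zeroM : lmodType R := pmod (fun _ : void => R^o : lmodType R).

Lemma zeroMP : is_zero zeroM.
Proof. by move=> x; apply: pmodP; case. Qed.

Lemma ses_id_zero A Z : is_zero Z -> ses A A Z.
Proof.
move=> Z0; exists (lid A), (lzero A Z); split=> //.
- by move=> b; split=> // _; exists b.
- by move=> y; exists 0; rewrite (Z0 y) linear0.
Qed.

Lemma ses_zero_id A Z : is_zero Z -> ses Z A A.
Proof.
move=> Z0; exists (lzero Z A), (lid A); split=> //.
- by move=> x y _; rewrite (Z0 x) (Z0 y).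
- by move=> b; split=> [/= ->|[a <-]] //; exists 0.
- by move=> y; exists y.
Qed.

Lemma ses_pushout K X M H Y : ses K X M -> ses K H Y ->
  exists Z, ses H Z M /\ ses X Z Y.
Proof.
move=> [k [p [kI kp pS]]] [h [q [hI hq qS]]].
pose f := ppair k (lzero K H \- h).
have fE x : f x = (k x, - h x) by rewrite /f linE /= sub0r.
have fI : injection f by move=> x y; rewrite !fE => -[/kI].
have [_ fpi piS] := cokernel_ses fI; move: (qproj _) fpi piS => pi fpi piS.
have piE x : pi (k x, 0) = pi (0, h x).
  apply/eqP; rewrite -subr_eq0 -linearB; apply/eqP/fpi; exists x.
  by rewrite fE; apply: injective_projections; rewrite /= ?subr0 ?sub0r.
have [u uE] : exists u : {linear qmod (range f) -> M},
    forall x, u (pi x) = p (pfst X H x).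
  apply: (descend (f := p \o pfst X H) piS) => x /fpi[y <-].
  by rewrite compE fE linE (exact_comp0 kp).
have [v vE] : exists v : {linear qmod (range f) -> Y},
    forall x, v (pi x) = q (psnd X H x).
  apply: (descend (f := q \o psnd X H) piS) => x /fpi[y <-].
  by rewrite compE fE linE linearN (exact_comp0 hq) oppr0.
exists (qmod (range f)); split.
- exists (pi \o ppair (lzero H X) (lid H)), u; apply: short_exactI.
  + apply: injection0 => y; rewrite compE linE => /fpi[x]; rewrite fE => -[/= kx <-].
    by have -> : x = 0; [apply: kI; rewrite kx linear0 | rewrite linear0 oppr0].
  + by move=> m; have [x <-] := pS m; exists (pi (x, 0)); rewrite uE.
  + by move=> x; rewrite compE uE linear0.
  move=> z; have [[x y] <-] := piS z; rewrite uE => /kp[w wx]; exists (y + h w).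
  move: (wx : k w = x) => <-; rewrite compE linE /=.
  have -> : (k w, y) = (k w, 0) + (0, y) :> prodM X H.
    by apply: injective_projections; rewrite /= ?addr0 ?add0r.
  rewrite linearD piE -linearD; congr (pi _).
  by apply: injective_projections; rewrite /= ?addr0 1?addrC.
exists (pi \o ppair (lid X) (lzero X H)), v; apply: short_exactI.
- apply: injection0 => y; rewrite compE linE => /fpi[x]; rewrite fE => -[/= <- hx].
  have -> : x = 0; last by rewrite linear0.
  by apply: hI; rewrite linear0 -[h x]opprK hx oppr0.
- by move=> m; have [x <-] := qS m; exists (pi (0, x)); rewrite vE.
- by move=> x; rewrite compE vE linear0.
move=> z; have [[x y] <-] := piS z; rewrite vE => /hq[w wy]; exists (x + k w).
move: (wy : h w = y) => <-; rewrite compE linE /=.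
have -> : (x, h w) = (0, h w) + (x, 0) :> prodM X H.
  by apply: injective_projections; rewrite /= ?addr0 ?add0r.
rewrite linearD -piE -linearD; congr (pi _).
by apply: injective_projections; rewrite /= ?addr0 1?addrC.
Qed.

Lemma ses_pullback K X M H Y : ses M X K -> ses Y H K ->
  exists Z, ses M Z H /\ ses Y Z X.
Proof.
move=> [f [g fg]] [h [p hp]]; have [U [u1 [u2 upb]]] := pullback_exists g p.
have [j [ju _]] := pullback_ses1 upb hp; have [i [iu _]] := pullback_ses2 upb fg.
by exists U; split; [exists i, u1 | exists j, u2].
Qed.

Lemma ses_sub_iso H Z M W X : ses M Z H -> ses X W Z ->
  exists H', ses X H' M /\ ses H' W H.
Proof.
move=> [f [g fg]] [k [p kp]]; have [L [i [j [q [ip jq _]]]]] := ses_syzygy fg kp.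
by exists L; split; [exists j, q | exists i, (g \o p)].
Qed.

Lemma ses_quot_iso H Z M W X : ses H Z M -> ses Z W X ->
  exists H', ses M H' X /\ ses H W H'.
Proof.
move=> [h [p [hI hp pS]]] [i [q [iI iq qS]]].
have ihI : injection (i \o h) by move=> x y /iI/hI.
have sH := cokernel_ses ihI; have [_ ihpi piS] := sH.
move: (qproj _) sH ihpi piS => pi sH ihpi piS.
have [m mE] : exists m : {linear M -> qmod (range (i \o h))},
    forall x, m (p x) = pi (i x).
  apply: (descend (f := pi \o i)) => // x /hp[y <-].
  by rewrite compE; apply/ihpi; exists y.
have [r rE] : exists r : {linear qmod (range (i \o h)) -> X},
    forall x, r (pi x) = q x.
  by apply: descend => // x /ihpi[y <-]; rewrite compE (exact_comp0 iq).
exists (qmod (range (i \o h))); split; last by exists (i \o h), pi.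
exists m, r; apply: short_exactI.
- apply: injection0 => y; have [z <-] := pS y; rewrite mE => /ihpi[x] /iI <-.
  by rewrite (exact_comp0 hp).
- by move=> x; have [w <-] := qS x; exists (pi w); rewrite rE.
- by move=> y; have [z <-] := pS y; rewrite mE rE (exact_comp0 iq).
by move=> y; have [w <-] := piS y; rewrite rE => /iq[z <-]; exists (p z).
Qed.

Lemma ses_split_mono W Z X V Y : ses W Z X -> Xt 0 X W -> ses X V Y ->
  ses Z (prodM W V) Y.
Proof.
move=> [w [p wp]] XW [i [q [iI iq qS]]].
have [r rE] := Xt0_extend XW wp (lid W); have [wI wpE pS] := wp.
exists (ppair r (i \o p)), (q \o psnd W V); apply: short_exactI.
- apply: injection0 => z; rewrite linE => -[rz]; rewrite -(linear0 i) => /iI.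
  by move=> /wpE[y yz]; move: rz; rewrite -yz rE /= => ->; rewrite linear0.
- by move=> y; have [v <-] := qS y; exists (0, v).
- by move=> z; rewrite /= (exact_comp0 iq).
move=> [a b] /= /iq[x <-]; have [z <-] := pS x.
exists (z + w (a - r z)); apply: injective_projections => /=.
  by rewrite linearD rE /= addrC subrK.
by rewrite linearD (exact_comp0 wpE) addr0.
Qed.

Lemma ses_split_epi W Z X V Y : ses X Z W -> Xt 0 W X -> ses Y V X ->
  ses Y (prodM W V) Z.
Proof.
move=> [x [p xp]] WX [j [q [jI jq qS]]].
have [s sE] := Xt0_lift xp WX (lid W); have [xI xpE pS] := xp.
exists (ppair (lzero Y W) j), ((s \o pfst W V) \+ (x \o q \o psnd W V)).
apply: short_exactI.
- by apply: injection0 => y /(congr1 snd) /= jy; apply: jI; rewrite jy linear0.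
- move=> z; have /xpE[y yz] : p (z - s (p z)) = 0 by rewrite linearB sE subrr.
  have [v vy] := qS y; exists (p z, v).
  by rewrite laddE !compE /= vy yz addrC subrK.
- by move=> y; rewrite laddE !compE /= linear0 (exact_comp0 jq) linear0 addr0.
move=> [a b]; rewrite laddE !compE /= => e.
have a0 : a = 0 by rewrite -[a]sE -[s a](addrK (x (q b))) e linearB
  (exact_comp0 xpE) linear0 subr0.
move: e; rewrite a0 linear0 add0r -(linear0 x) => /xI/jq[y <-].
by exists y.
Qed.

Lemma module_ext_structure :
  ext_structure (@ses R) (@Xt R) (@prodM R) (@is_zero R).
Proof.
split.
- exact: ses_pushout.
- exact: ses_pullback.
- exact: ses_quot_iso.
- exact: ses_sub_iso.
- exact: ses_split_mono.
- exact: ses_split_epi.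
- exact: Xt_mid.
- exact: Xt_sub.
- exact: Xt_quot.
- by move=> e A B X N; apply: Xt_mid_r.
- by move=> e A B X N; apply: Xt_sub_r.
- by move=> e A B X N; apply: Xt_quot_r.
- by move=> e Z N Z0; apply/Xt_projective/is_zero_projective.
- by move=> e Z N Z0; apply/Xt_injective/is_zero_injective.
- by move=> A; exists zeroM; split; [exact: zeroMP | apply: ses_id_zero zeroMP].
- by move=> A; exists zeroM; split; [exact: zeroMP | apply: ses_zero_id zeroMP].
Qed.

End ModuleExt.

(** * Finitely generated modules over a noetherian ring *)

Section FinGen.
Variable R : comPzRingType.
Implicit Types A B M N X Y K : lmodType R.

Lemma fg_finType (T : finType) M (g : T -> M) :
  (forall x, exists r : T -> R, x = \sum_i r i *: g i) -> finitely_generated M.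
Proof.
move=> gen; exists #|T|, (fun k => g (enum_val k)) => x; have [r ->] := gen x.
exists (fun k => r (enum_val k)).
by rewrite (big_enum_val (A := T) (fun i => r i *: g i)).
Qed.

Lemma fg_surj A B (f : {linear A -> B}) :
  surjection f -> finitely_generated A -> finitely_generated B.
Proof.
move=> fS [n [g gen]]; exists n, (fun i => f (g i)) => y.
have [x <-] := fS y; have [r ->] := gen x; exists r.
by rewrite linear_sum; apply: eq_bigr => i _; rewrite linearZ.
Qed.

Lemma fg_zero M : is_zero M -> finitely_generated M.
Proof. by move=> M0; exists 0, (fun=> 0) => x; exists (fun=> 0); rewrite big_ord0. Qed.

Lemma fg_ses A B X : ses A B X -> finitely_generated A -> finitely_generated X ->
  finitely_generated B.
Proof.
move=> [f [g [fI fg gS]]] [n [a agen]] [m [x xgen]].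
have /choice[b gb] i : exists b, g b = x i by apply: gS.
apply: (fg_finType (g := fun t : 'I_n + 'I_m =>
  match t with inl i => f (a i) | inr j => b j end)) => y.
have [s ys] := xgen (g y).
have /fg[z zy] : g (y - \sum_i s i *: b i) = 0.
  rewrite linearB ys linear_sum; apply/eqP; rewrite subr_eq0; apply/eqP.
  by apply: eq_bigr => i _; rewrite linearZ gb.
have [r zr] := agen z.
exists (fun t => match t with inl i => r i | inr j => s j end).
rewrite big_sumType /= -[LHS](subrK (\sum_i s i *: b i)) -zy zr linear_sum.
by congr (_ + _); apply: eq_bigr => i _; rewrite linearZ.
Qed.

Lemma fg_ring : finitely_generated (R^o : lmodType R).
Proof.
exists 1, (fun=> 1) => x; exists (fun=> x).
by rewrite big_ord1 [_ *: _]mulr1.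
Qed.

Lemma fg_dsum n M : finitely_generated M -> finitely_generated (dsum 'I_n M).
Proof.
move=> [m [g gen]].
apply: (fg_finType (g := fun p : 'I_n * 'I_m => dinj M p.1 (g p.2))) => x.
have /choice[r rE] i : exists r : 'I_m -> R, dcomp M i x = \sum_j r j *: g j.
  exact: gen.
exists (fun p => r p.1 p.2).
rewrite -(pair_bigA _ (fun i j => r i j *: dinj M i (g j))) /=.
rewrite [LHS]dsum_gen (@dsupp_sum _ _ _ _ _ _ (enum 'I_n)) ?enum_uniq //.
- rewrite big_enum; apply: eq_bigr => i _.
  by rewrite rE linear_sum; apply: eq_bigr => j _; rewrite linearZ.
- by move=> s; rewrite mem_enum.
by move=> s /dsupp0 ->; rewrite linear0.
Qed.

Lemma dsum_ord n M (x : dsum 'I_n M) : x = \sum_i dinj M i (dcomp M i x).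
Proof.
rewrite [LHS]dsum_gen (@dsupp_sum _ _ _ _ _ _ (enum 'I_n)) ?enum_uniq //.
- by rewrite big_enum.
- by move=> s; rewrite mem_enum.
by move=> s /dsupp0 ->; rewrite linear0.
Qed.

Lemma fg_free M : finitely_generated M <->
  exists n (g : {linear free_mod R 'I_n -> M}), surjection g.
Proof.
split=> [[n [g gen]]|[n [g gS]]]; last by apply: fg_surj gS _; apply/fg_dsum/fg_ring.
exists n, (flift g) => x; have [r ->] := gen x.
exists (\sum_i r i *: fbase R i).
by rewrite linear_sum; apply: eq_bigr => i _; rewrite linearZ_LR flift_base.
Qed.

(** A recursive model of R^n next to [free_mod], so that [fg_sub] can split off one coordinate at a
    time. *)
Fixpoint power n : lmodType R :=
  if n is m.+1 then prodM (power m) (R^o : lmodType R) else zeroM R.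

Lemma fg_power M : finitely_generated M ->
  exists n (g : {linear power n -> M}), surjection g.
Proof.
move=> [n [g gen]]; exists n.
suff [f fE] : exists f : {linear power n -> M},
    forall r : 'I_n -> R, exists x, f x = \sum_i r i *: g i.
  by exists f => x; have [r ->] := gen x; apply: fE.
elim: n g {gen} => [|n IH] g.
  by exists (lzero (zeroM R) M) => r; exists 0; rewrite big_ord0.
have [f fE] := IH (fun i => g (widen_ord (leqnSn n) i)).
exists ((f \o pfst _ _) \+ (lscale (g ord_max) \o psnd _ _)) => r.
have [x xE] := fE (fun i => r (widen_ord (leqnSn n) i)).
by exists (x, r ord_max); rewrite big_ord_recr /= xE.
Qed.

Section EvalTuple.
Variables (n : nat) (A B : lmodType R) (g : 'I_n -> A).

Lemma evtup_linear :
  linear (fun f : lhom A B => \sum_i dinj B i (f (g i)) : dsum 'I_n B).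
Proof.
move=> a f h; rewrite scaler_sumr -big_split; apply: eq_bigr => i _.
exact: (linearP (dinj B i) a (f (g i)) (h (g i))).
Qed.
(** When [g] generates [A], this embeds Hom(A, B) in a finite power of [B]. Finite generation of
    Hom(A, B) and the extension of functionals on it to injective modules both rest on this
    embedding. *)
Definition evtup : {linear lhom A B -> dsum 'I_n B} := lin evtup_linear.

Lemma evtupE f : evtup f = \sum_i dinj B i (f (g i)).
Proof. by []. Qed.

Lemma evtup_comp f j : dcomp B j (evtup f) = f (g j).
Proof.
rewrite evtupE linear_sum.
rewrite (bigD1 j) // dcomp_inj eqxx big1 => [|i ij]; first exact: addr0.
by rewrite dcomp_inj eq_sym; case: (i == j) ij.
Qed.

Lemma evtup_inj :
  (forall x, exists r : 'I_n -> R, x = \sum_i r i *: g i) -> injection evtup.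
Proof.
move=> gen f h fh; apply: lhomP => x; have [r ->] := gen x.
rewrite !linear_sum; apply: eq_bigr => i _; rewrite !linearZ; congr (_ *: _).
by rewrite -!evtup_comp fh.
Qed.

End EvalTuple.

Hypothesis noeth : noetherian R.

Lemma fg_ideal (S : submod (R^o : lmodType R)) : finitely_generated (smod S).
Proof.
have idS : ideal (S : R -> Prop).
  split; [exact: sm_0 | by move=> x y; apply: sm_D | by move=> a x; apply: sm_Z].
have [n [x xE]] := noeth idS.
have Sx (i : 'I_n) : S (x i).
  apply/xE; exists (fun j : nat => (j == i :> nat)%:R).
  rewrite (bigD1 i) //= eqxx mul1r big1 ?addr0 // => j ji.
  by rewrite (negbTE ji : (j == i :> nat) = false) mul0r.
exists n, (fun i : 'I_n => exist _ (x i : R^o) (Sx i) : smod S) => y.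
have /xE[r yE] := svalP y; exists r; apply: smodP.
rewrite [LHS]yE -[RHS]/(sincl S _) linear_sum; apply: eq_bigr => i _.
by rewrite linearZ.
Qed.

Lemma fg_range A B (f : {linear A -> B}) :
  finitely_generated A -> finitely_generated (smod (range f)).
Proof. exact: fg_surj (@corestrict_surj _ _ _ f). Qed.

Lemma ses_range A B (f : {linear A -> B}) : ses (smod (kernel f)) A (smod (range f)).
Proof.
exists (sincl (kernel f)), (corestrict f); apply: short_exactI.
- exact: sincl_inj.
- exact: corestrict_surj.
- by move=> x; apply: smodP; apply: (svalP x).
by move=> y /(congr1 (sincl (range f))) /= fy; apply/(sinclP (kernel f)).
Qed.

(** A pullback reduces to submodules of some [power n]; for these the last coordinate has an ideal
    as image and a submodule of the smaller power as kernel. *)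
Lemma fg_sub M N (i : {linear N -> M}) :
  injection i -> finitely_generated M -> finitely_generated N.
Proof.
move=> iI /fg_power[n [g gS]].
suff {M N i iI g gS}fgP N (i : {linear N -> power n}) : injection i -> finitely_generated N.
  have [U [u1 [u2 upb]]] := pullback_exists g i.
  have [_ pb_ext pb_mk] := upb.
  apply: (@fg_surj _ _ u1); last apply: (fgP _ u2).
    by move=> x; have [y /esym xy] := gS (i x); have [u [<- _]] := pb_mk _ _ xy; exists u.
  have [pbE _ _] := upb.
  by move=> x y xy; apply: pb_ext => //; apply: iI; rewrite !pbE xy.
elim: n N i => [|n IH] N i iI.
  by apply: fg_zero => x; apply: iI; rewrite linear0; apply: zeroMP.
apply: fg_ses (ses_range (psnd _ _ \o i)) _ _; last exact: fg_ideal.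
apply: (IH _ (pfst _ _ \o i \o sincl _)) => x y xy.
apply: (@sincl_inj _ _ (kernel (psnd (power n) (R^o : lmodType R) \o i))).
apply: iI; apply: prodM_ext => //.
by have := svalP x; have := svalP y => /= -> ->.
Qed.

Lemma fg_presentation M : finitely_generated M ->
  exists n K (k : {linear K -> free_mod R 'I_n}) (p : {linear free_mod R 'I_n -> M}),
    short_exact k p /\ finitely_generated K.
Proof.
move=> /fg_free[n [g gS]]; exists n, (smod (kernel g)), (sincl _), g.
split; first exact: kernel_ses.
by apply: (fg_sub (@sincl_inj _ _ (kernel g))); apply/fg_dsum/fg_ring.
Qed.

Lemma fg_hom A B : finitely_generated A -> finitely_generated B ->
  finitely_generated (lhom A B).
Proof.
move=> [n [g gen]] fB.
by apply: (fg_sub (evtup_inj gen (B := B))); apply: fg_dsum.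
Qed.

End FinGen.

(** * Duality into an injective module, faithful modules *)

Section HomDuality.
Variable R : comPzRingType.
Implicit Types A B M N X Y K P I : lmodType R.

Lemma ses_hom_post T A B X : ses A B X -> Xt 0 T A ->
  ses (lhom T A) (lhom T B) (lhom T X).
Proof.
move=> [f [g fg]] TA; exists (hom_post T f), (hom_post T g).
by apply: hom_post_short => // h; apply: Xt0_lift fg TA h.
Qed.

Lemma ses_hom_pre N A B X : ses A B X -> Xt 0 X N ->
  ses (lhom X N) (lhom B N) (lhom A N).
Proof.
move=> [f [g fg]] XN; exists (hom_pre N g), (hom_pre N f).
by apply: hom_pre_short => // h; apply: Xt0_extend XN fg h.
Qed.

Lemma injective_lhom P I : projective P -> injective_module I ->
  injective_module (lhom P I).
Proof.
move=> PP II A B i f iI.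
have iS : surjection (hom_pre I i).
  by move=> h; have [k kE] := II _ _ i h iI; exists k; apply: lhomP.
have [h hE] := PP _ _ (hom_pre I i) (lflip f) iS.
exists (lflip h) => a; apply: lhomP => p.
have /(congr1 (fun w : lhom A I => w a)) := hE p.
by [].
Qed.

(** Both sides say Hom(Tor_(e+1)(A, B), I) = 0; this is the symmetry of Tor in the language of
    Ext. *)
Lemma Xt_sym e A B I : injective_module I ->
  Xt e A (lhom B I) -> Xt e B (lhom A I).
Proof.
move=> II; elim: e A => [|e IHe] A AB;
  have [K [P [k [p [PP kp]]]]] := enough_projectives A.
  have kp' : short_exact (hom_pre I p) (hom_pre I k).
    by apply: hom_pre_short => // h; have [kI _ _] := kp; apply: II.
  apply: (Xt0_sub_r kp'); last by apply/Xt_injective/injective_lhom.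
  move=> h; have [g gE] := AB _ _ k p PP kp (lflip h).
  exists (lflip g) => b; apply: lhomP => x.
  by have /(congr1 (fun w : lhom B I => w b)) := gE x.
apply: (@Xt_sub_r R e B _ (lhom P I) (lhom K I)).
- by apply: ses_hom_pre (Xt_injective 0 _ II); exists k, p.
- by apply: IHe; apply: AB kp.
by apply/Xt_injective/injective_lhom.
Qed.

Definition dmap (S : choiceType) A B (f : {linear A -> B}) :
  {linear dsum S A -> dsum S B} := dlift (fun s => dinj B s \o f).

Lemma dmap_comp S A B (f : {linear A -> B}) x s :
  dcomp B s (dmap S f x) = f (dcomp A s x).
Proof.
move: x; apply: (dsum_ext (f := dcomp B s \o dmap S f) (g := f \o dcomp A s)).
move=> t m; rewrite !compE dlift_inj compE !dcomp_inj.
by case: eqP => //; rewrite linear0.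
Qed.

Lemma dmap_short S A B X (f : {linear A -> B}) (g : {linear B -> X}) :
  short_exact f g -> short_exact (dmap S f) (dmap S g).
Proof.
move=> [fI fg gS]; apply: short_exactI.
- move=> x y xy; apply: dsumP => s; apply: fI.
  by rewrite -!dmap_comp xy.
- have /choice[r rE] : forall x, exists y, g y = x by apply: gS.
  move=> x; exists (\sum_(s <- dsupp x) dinj B s (r (dcomp X s x))).
  rewrite [RHS]dsum_gen linear_sum; apply: eq_bigr => s _.
  by rewrite dlift_inj compE rE.
- by move=> x; apply: dsumP => s; rewrite !dmap_comp (exact_comp0 fg) linear0.
move=> y gy; have /choice[r rE] s : exists a, f a = dcomp B s y.
  by apply/fg; rewrite -dmap_comp gy linear0.
exists (\sum_(s <- dsupp y) dinj A s (r s)).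
rewrite [RHS]dsum_gen linear_sum; apply: eq_bigr => s _.
by rewrite dlift_inj compE rE.
Qed.

Lemma Xt_dsum S e A N : Xt e A N -> Xt e (dsum S A) N.
Proof.
elim: e A => [|e IHe] A AN; have [K [P [k [p [PP kp]]]]] := enough_projectives A.
  apply: (Xt0_quot (dmap_short S kp)); last exact/Xt_projective/projective_dsum.
  move=> h; have /choice[u uE] s : exists u : {linear P -> N},
      forall x, u (k x) = h (dinj K s x).
    exact: (AN _ _ k p PP kp (h \o dinj K s)).
  exists (dlift u); apply: (dsum_ext (f := dlift u \o dmap S k)) => s m.
  by rewrite !compE dlift_inj compE dlift_inj uE.
apply: (@Xt_pres R e _ N (dsum S K) (dsum S P)); first exact: projective_dsum.
  by exists (dmap S k), (dmap S p); apply: dmap_short.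
by apply: IHe; apply: AN kp.
Qed.

Definition faithful M : Prop := forall r : R, (forall x : M, r *: x = 0) -> r = 0.

(* For [B = <g, B'>] and [b = (B' : g)]: an element of [N] killed by [b] gives a
   map [B -> B/B' = R/b -> N], and [theta : B' -> N] gives the maps
   [theta (r -)] on [B] for [r] in [b].  Hence a product of such ideals kills
   [B] but no nonzero element of [N]. *)
Lemma killing_scalars n B N (g : 'I_n -> B) :
  (forall x, exists r : 'I_n -> R, x = \sum_i r i *: g i) ->
  (forall (f : {linear B -> N}) b, f b = 0) ->
  exists S : R -> Prop, (forall a b, S a -> a *: (b : B) = 0) /\
    forall x : N, (forall a, S a -> a *: x = 0) -> x = 0.
Proof.
elim: n B g => [|n IH] B g gen B0.
  exists (fun a => a = 1); split=> [a b _|x /(_ 1)]; last by rewrite scale1r; apply.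
  by have [r ->] := gen b; rewrite big_ord0 scaler0.
pose h := flift (fun i => g (widen_ord (leqnSn n) i)); pose B' := range h.
pose b r := B' (r *: g ord_max).
have genB x : exists p r, x = h p + r *: g ord_max.
  have [r ->] := gen x; rewrite big_ord_recr.
  exists (\sum_(i < n) r (widen_ord (leqnSn n) i) *: fbase R i), (r ord_max).
  rewrite linear_sum; congr (_ + _); apply: eq_bigr => i _.
  by rewrite linearZ_LR flift_base.
have bN (x : N) : (forall r, b r -> r *: x = 0) -> x = 0.
  move=> bx.
  have [||f fE] := @descend R _ B N
    ((h \o pfst _ (R^o : lmodType R)) \+ (lscale (g ord_max) \o psnd _ _)) (lscale x \o psnd _ _).
  - by move=> y; have [p [r ->]] := genB y; exists (p, r).
  - move=> [p r] /= e; apply: bx; exists (- p).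
    by apply/eqP; rewrite linearN eq_sym -addr_eq0 addrC; apply/eqP.
  have := fE (0, 1); rewrite B0 !lE /= => e.
  by rewrite -[x]scale1r; rewrite [RHS]e.
have B'0 (f : {linear smod B' -> N}) c : f c = 0.
  apply: bN => r br.
  have [|m mE] := @lift_inj R _ B B (sincl B') (r *: (idfun : lhom B B) : lhom B B)
      (@sincl_inj _ _ B').
    move=> x; apply/(sinclP B'); have [p [s ->]] := genB x.
    rewrite -[_ (_ + _)]/(r *: (h p + s *: g ord_max)) scalerDr.
    apply: sm_D; first by apply: sm_Z; exists p.
    by rewrite scalerA mulrC -scalerA; apply: sm_Z.
  rewrite -linearZ_LR.
  have -> : r *: c = m (sincl B' c) by apply: smodP; rewrite -[RHS]/(sincl B' _) mE.
  exact: (B0 (f \o m)).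
have [|S [SB SN]] := IH (smod B')
    (fun i => exist _ (g (widen_ord (leqnSn n) i)) (ex_intro _ (fbase R i) (flift_base _ i))) _ B'0.
  move=> [y [p yp]].
  exists (fun i => dcomp _ i p : R); apply: smodP => /=.
  rewrite -[RHS]/(sincl B' _) linear_sum -yp [in LHS](dsum_ord p) linear_sum.
  apply: eq_bigr => i _; rewrite linearZ_LR.
  exact: (dlift_inj (fun i => lscale (g (widen_ord (leqnSn n) i)))).
exists (fun a => exists c r, [/\ S c, b r & a = c * r]); split.
  move=> _ y [c [r [Sc br ->]]]; rewrite -scalerA.
  have B'ry : B' (r *: y).
    have [p [s ->]] := genB y; rewrite scalerDr; apply: sm_D.
      by apply: sm_Z; exists p.
    by rewrite scalerA mulrC -scalerA; apply: sm_Z.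
  by have /(congr1 (sincl B')) := SB c (exist _ _ B'ry) Sc.
move=> x Sx; apply: bN => r br; apply: SN => a Sa.
by rewrite scalerA; apply: Sx; exists a, r.
Qed.

(** For N = Hom(Q, E) and by adjunction, this is Nakayama's lemma: B (x) Q = 0 forces Q = 0, as far
    as maps to [E] can tell. *)
Lemma hom_faithful0 B N : finitely_generated B -> faithful B ->
  (forall (f : {linear B -> N}) b, f b = 0) -> is_zero N.
Proof.
move=> [n [g gen]] Bf B0 x; have [S [SB SN]] := killing_scalars gen B0.
by apply: SN => a Sa; rewrite (Bf a) ?scale0r // => y; apply: SB.
Qed.

End HomDuality.

(** * Biduality with respect to a dualizing module *)

Section DualFree.
Variables (R : comPzRingType) (D : lmodType R) (n : nat).
Let F := free_mod R 'I_n.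

Lemma lhom_sumE (A B : lmodType R) (I : Type) (r : seq I) (G : I -> lhom A B) x :
  (\sum_(i <- r) G i : lhom A B) x = \sum_(i <- r) G i x.
Proof. by elim/big_rec2: _ => // i y z _ <-. Qed.

Lemma coord_linear (i : 'I_n) :
  linear (fun d => lscale d \o dcomp R^o i : lhom F D).
Proof.
move=> a x y; apply: lhomP => p.
rewrite -[LHS]/(dcomp R^o i p *: (a *: x + y)) scalerDr scalerA mulrC -scalerA.
by [].
Qed.
Definition coord i : {linear D -> lhom F D} := lin (coord_linear i).

Lemma coordE i d y : coord i d y = (dcomp R^o i y : R) *: d.
Proof. by []. Qed.

Lemma coord_sum (h : lhom F D) : h = \sum_i coord i (h (fbase R i)).
Proof.
apply: lhomP => x.
rewrite lhom_sumE [in LHS](dsum_ord x) linear_sum; apply: eq_bigr => i _.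
rewrite coordE -linearZ_LR; congr (h _).
by rewrite /fbase -linearZ_LR; congr (dinj _ _ _); rewrite [RHS]mulr1.
Qed.

Lemma perp_dual_free : perp D D -> perp (lhom F D) D.
Proof.
move=> DD; pose il := evtup D (fun i : 'I_n => fbase R i) => e.
apply: (@Xt_retract_l R e (dsum 'I_n D) (lhom F D) D il (dlift coord)); last first.
  exact/Xt_dsum/DD.
move=> h; rewrite [RHS]coord_sum evtupE linear_sum.
by apply: eq_bigr => i _; rewrite dlift_inj.
Qed.

Lemma dual_free_inj (y : F) : faithful D -> (forall h : {linear F -> D}, h y = 0) -> y = 0.
Proof.
move=> Df hy; apply: dsumP => i; rewrite linear0; apply: Df => d.
exact: (hy (coord i d)).
Qed.

Lemma dual_free_surj (z : {linear lhom F D -> D}) :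
  (forall f : {linear D -> D}, exists r : R, forall d, f d = r *: d) ->
  exists y, forall h : lhom F D, z h = h y.
Proof.
move=> Dscal; have /choice[r rE] i : exists r : R, forall d, z (coord i d) = r *: d.
  exact: (Dscal (z \o coord i)).
exists (\sum_i r i *: fbase R i) => h.
rewrite [in LHS](coord_sum h) !linear_sum; apply: eq_bigr => i _.
by rewrite rE linearZ_LR.
Qed.

End DualFree.

Section Biduality.
Variables (R : comPzRingType) (D : lmodType R).
Implicit Types A B M N X Y K P I : lmodType R.

Hypothesis noeth : noetherian R.
Hypothesis Dscal : forall f : {linear D -> D}, exists r : R, forall d, f d = r *: d.
Hypothesis Dfaith : faithful D.
Hypothesis DD : perp D D.

Lemma perp_presentation A : finitely_generated A -> perp A D ->
  exists m K (k : {linear K -> free_mod R 'I_m}) (p : {linear free_mod R 'I_m -> A}),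
    [/\ short_exact k p, finitely_generated K & perp K D].
Proof.
move=> fA AD; have [m [K [k [p [kp fK]]]]] := fg_presentation noeth fA.
exists m, K, k, p; split=> // d.
apply: (@Xt_sub R d K (free_mod R 'I_m) A D); [by exists k, p | | exact: AD].
exact/Xt_projective/projective_free.
Qed.

Variable n : nat.
Hypothesis Did : forall e M, (n <= e)%N -> Xt e M D.

(** Dualizing 0 -> K -> F -> A -> 0 identifies Ext^i(Hom(A, D), D) with Ext^(i+1)(Hom(K, D), D). The
    counter [j] is the number of shifts left until the degree passes the bound [n]. *)
Lemma perp_dual A : finitely_generated A -> perp A D -> perp (lhom A D) D.
Proof.
move=> fA AD e; have: (n <= e + n)%N by apply: leq_addl.
move: {2}n => j; elim: j A e fA AD => [|j IH] A e fA AD ne.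
  by apply: Did; rewrite addn0 in ne.
have [m [K [k [p [kp fK KD]]]]] := perp_presentation fA AD.
have sA : ses K (free_mod R 'I_m) A by exists k, p.
apply: Xt_sub (ses_hom_pre sA (AD 0)) _ _; first exact: perp_dual_free DD _.
by apply: IH => //; rewrite addSnnS.
Qed.

(** As Ext^1(Hom(K, D), D) = 0, a functional on Hom(A, D) extends to Hom(F, D), where it is
    evaluation at some y in the free module [F]; the image of y in [A] is the required element. *)
Lemma bidual_surj A : finitely_generated A -> perp A D ->
  forall z : {linear lhom A D -> D}, exists a, forall h : lhom A D, z h = h a.
Proof.
move=> fA AD z; have [m [K [k [p [kp fK KD]]]]] := perp_presentation fA AD.
have kp' : short_exact (hom_pre D p) (hom_pre D k).
  by apply: hom_pre_short => // h; apply: Xt0_extend (AD 0) kp h.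
have [w wE] := Xt0_extend (perp_dual fK KD 0) kp' z.
have [y yE] := dual_free_surj w Dscal.
by exists (p y) => h; rewrite -wE yE.
Qed.

(** If y in [F] maps to [a], evaluation at y kills Hom(A, D) and so is a functional on Hom(K, D). By
    surjectivity it is evaluation at some c in [K], whence y = c in [F] and a = 0. *)
Lemma bidual_inj A : finitely_generated A -> perp A D ->
  forall a, (forall h : {linear A -> D}, h a = 0) -> a = 0.
Proof.
move=> fA AD a ha; have [m [K [k [p [kp fK KD]]]]] := perp_presentation fA AD.
have [_ kpE pS] := kp; have [y ya] := pS a.
have [_ kpE' kS'] : short_exact (hom_pre D p) (hom_pre D k).
  by apply: hom_pre_short => // h; apply: Xt0_extend (AD 0) kp h.
have yl : linear (fun h : lhom (free_mod R 'I_m) D => h y) by [].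
have [w wE] : exists w : {linear lhom K D -> D}, forall h, w (hom_pre D k h) = h y.
  apply: (descend (f := lin yl)) => // h /kpE'[g <-].
  by rewrite linE -[LHS]/(g (p y)) ya ha.
have [c cE] := bidual_surj fK KD w.
have -> : a = p (k c); last by rewrite (exact_comp0 kpE).
rewrite -ya; congr (p _); apply/eqP; rewrite -subr_eq0; apply/eqP.
apply: (dual_free_inj Dfaith) => h; rewrite linearB -wE cE.
by rewrite -[X in X - _]/(h (k c)) subrr.
Qed.

End Biduality.

(** * Tensor evaluation and factorization through finite powers *)

Section Evaluation.
Variable R : comPzRingType.
Implicit Types A B M N X Y K P I E V G : lmodType R.

Lemma lhom_at A B (f g : lhom A B) : f = g -> forall x, f x = g x.
Proof. by move=> ->. Qed.

Lemma factor_injective I A B (r : {linear A -> B}) (h : {linear A -> I}) :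
  injective_module I -> (forall x, r x = 0 -> h x = 0) ->
  exists l : {linear B -> I}, forall x, l (r x) = h x.
Proof.
move=> II rh.
have [|l lE] := @descend R A (smod (range r)) I (corestrict r) h (@corestrict_surj _ _ _ r).
  by move=> x /(congr1 (sincl (range r))) /= rx; apply: rh.
have [k kE] := II _ _ (sincl (range r)) l (@sincl_inj _ _ _).
by exists k => x; rewrite -lE -kE.
Qed.

Lemma evh_linear A X I (a : A) (h : lhom X I) : linear (fun f : lhom A X => h (f a)).
Proof. by move=> r f g; rewrite -linearP. Qed.
(** The image of a (x) h under the tensor evaluation map A (x) Hom(X, I) -> Hom(Hom(A, X), I). *)
Definition evh A X I (a : A) (h : lhom X I) : lhom (lhom A X) I :=
  lin (evh_linear a h).

Lemma evhE A X I (a : A) (h : lhom X I) f : evh a h f = h (f a).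
Proof. by []. Qed.

(** Surjectivity of tensor evaluation: the functional extends from Hom(A, X) to the finite power of
    [X] that contains it. *)
Lemma evh_span A X I (k : {linear lhom A X -> I}) :
  finitely_generated A -> injective_module I ->
  exists n (a : 'I_n -> A) (h : 'I_n -> lhom X I),
    forall f, k f = \sum_i evh (a i) (h i) f.
Proof.
move=> [n [g gen]] II.
have [l lE] := II _ _ (evtup X g) k (evtup_inj gen (B := X)).
exists n, g, (fun i => l \o dinj X i) => f.
by rewrite -lE evtupE linear_sum.
Qed.

Section Finite.
Hypothesis noeth : noetherian R.

(* This is the isomorphism A (x) Hom(X, I) = Hom(Hom(A, X), I). *)
Lemma evaluation A X I E (b : {linear A -> lhom (lhom X I) E}) :
  finitely_generated A -> injective_module I ->
  exists xi : {linear lhom (lhom A X) I -> E}, forall a h, b a h = xi (evh a h).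
Proof.
move=> fA II; have [n [K [k [p [kp fK]]]]] := fg_presentation noeth fA.
have [kI kpE pS] := kp; pose F := free_mod R 'I_n.
pose xF : lhom (lhom (lhom F X) I) E :=
  \sum_i (b (p (fbase R i)) \o hom_pre I (coord X i) : lhom (lhom (lhom F X) I) E).
have xE y h : xF (evh y h) = b (p y) h.
  rewrite lhom_sumE [in RHS](dsum_ord y) !linear_sum lhom_sumE; apply: eq_bigr => i _.
  have -> : dinj R^o i (dcomp R^o i y) = (dcomp R^o i y : R) *: fbase R i.
    by rewrite /fbase -linearZ_LR; congr (dinj _ _ _); rewrite [RHS]mulr1.
  rewrite !linearZ_LR compE -[RHS](linearZ_LR (b (p (fbase R i)))).
  by congr (b _ _); apply: lhomP => x; rewrite -[LHS]/(h (_ *: x)) linearZ_LR.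
(* A functional that vanishes on Hom(A, X) factors through restriction to Hom(K, X), where
   functionals are sums of evaluations at elements of [K]; on these [xF] vanishes because [p]
   does. *)
have xF0 u : hom_pre I (hom_pre X p) u = 0 -> xF u = 0.
  move=> u0; have [|w wE] := @factor_injective I _ _ (hom_pre X k) u II.
    move=> f fk; have [|f' fE] := @descend R F A X p f pS.
      by move=> y /kpE[c <-]; have := lhom_at fk c.
    have -> : f = hom_pre X p f' by apply: lhomP => y; rewrite -fE.
    by have := lhom_at u0 f'.
  have [m [c [l cl]]] := evh_span w fK II.
  have -> : u = \sum_j evh (k (c j)) (l j).
    by apply: lhomP => f; rewrite lhom_sumE -wE cl; apply: eq_bigr.
  by rewrite linear_sum big1 // => j _; rewrite xE (exact_comp0 kpE) linear0.
have pI : injection (hom_pre X p).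
  move=> f f' ff; apply: lhomP => a; have [y <-] := pS a.
  by have := lhom_at ff y.
have rS : surjection (hom_pre I (hom_pre X p)).
  by move=> u; have [v vE] := II _ _ _ u pI; exists v; apply: lhomP.
have [xi xiE] := descend rS xF0.
exists xi => a h; have [y <-] := pS a.
by rewrite -xE -xiE; congr (xi _); apply: lhomP.
Qed.

(* [fac X] plays the role of the class of the X (x) F with F flat: by Lazard's
   theorem these are the filtered colimits of finite powers of X. *)
Definition fac X Y : Prop := forall B, finitely_generated B ->
  forall f : {linear B -> Y}, exists m (e : 'I_m -> {linear B -> X})
    (u : 'I_m -> {linear X -> Y}), forall b, f b = \sum_i u i (e i b).

(** A map from the finitely generated syzygy of [A] to [Y] passes through a finite power of [X], and
    each coordinate extends to the free module. *)
Lemma fac_Xt e A X Y : finitely_generated A -> fac X Y -> Xt e A X -> Xt e A Y.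
Proof.
move=> fA XY; elim: e A fA => [|e IH] A fA AX;
  have [n [K [k [p [kp fK]]]]] := fg_presentation noeth fA;
  have PF := @projective_free R 'I_n.
  apply: (Xt0_quot kp); last exact: Xt_projective.
  move=> h; have [m [c [u uE]]] := XY K fK h.
  have /choice[d dE] i : exists d : {linear free_mod R 'I_n -> X},
      forall x, d (k x) = c i x by exact: (AX _ _ k p PF kp).
  exists (\sum_i (u i \o d i : lhom _ Y) : lhom _ Y) => x.
  by rewrite uE lhom_sumE; apply: eq_bigr => i _; rewrite compE dE.
by apply: Xt_pres PF _ (IH K fK (AX _ _ _ _ PF kp)); exists k, p.
Qed.

Lemma dd_linear X I E (z : {linear I -> E}) (h : lhom X I) :
  linear (fun x : X => z (h x)).
Proof. by move=> a x y; rewrite !linearP. Qed.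
Definition dd X I E (z : {linear I -> E}) : {linear X -> lhom (lhom X I) E} :=
  @hlin R X (lhom X I) E (fun x => z \o lin (eval_linear (B := I) x)) (dd_linear z).

(** The module is X (x) Hom(I, E), with Hom(I, E) flat. By [evaluation] a map from [B] becomes a
    functional on Hom(Hom(B, X), I), which sits in a finite power of [I]; the components I -> E of
    its extension give the maps X -> Y. *)
Lemma fac_double_dual X I E : finitely_generated X ->
  injective_module I -> injective_module E -> fac X (lhom (lhom X I) E).
Proof.
move=> fX II IE B fB f; have [xi xiE] := evaluation f fB II.
have [m [e egen]] := fg_hom noeth fB fX.
have [l lE] := IE _ _ (evtup I e) xi (evtup_inj egen (B := I)).
exists m, e, (fun i => dd X (l \o dinj I i)) => x; apply: lhomP => h.
rewrite xiE -lE evtupE lhom_sumE linear_sum.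
by apply: eq_bigr.
Qed.

Lemma fg_dsum_image S B X (f : {linear B -> dsum S X}) : finitely_generated B ->
  exists l : seq S, forall x, f x = \sum_(s <- l) dinj X s (dcomp X s (f x)).
Proof.
move=> [n [g gen]].
pose l := flatten [seq dsupp (f (g i)) | i <- enum 'I_n].
have l0 s x : s \notin l -> dcomp X s (f x) = 0.
  move=> sl; have [r ->] := gen x; rewrite !linear_sum big1 // => i _.
  rewrite !linearZ_LR dsupp0 ?scaler0 //; apply: contra sl => si.
  by apply/flattenP; exists (dsupp (f (g i))) => //; apply: map_f; rewrite mem_enum.
exists (undup l) => x.
rewrite [LHS]dsum_gen (@dsupp_sum _ _ _ _ _ _ (undup l)) ?undup_uniq //.
  by move=> s; rewrite mem_undup => /l0 ->; rewrite linear0.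
by move=> s /dsupp0 ->; rewrite linear0.
Qed.

Lemma fac_dsum S X : fac X (dsum S X).
Proof.
move=> B fB f; have [l lE] := fg_dsum_image f fB; pose t := in_tuple l.
exists (size l), (fun j => dcomp X (tnth t j) \o f), (fun j => dinj X (tnth t j)).
by move=> x; rewrite lE big_tnth.
Qed.

Definition hom_cover X Y : {linear dsum (lhom X Y) X -> Y} :=
  @dlift R (lhom X Y) X Y (fun s => s).

Lemma hom_cover_surj X Y : fac X Y -> surjection (hom_cover X Y).
Proof.
move=> XY y; have [m [e [u uE]]] := XY _ (fg_ring R) (lscale y).
exists (\sum_i dinj X (u i : lhom X Y) (e i 1)).
rewrite linear_sum -[RHS]scale1r -[RHS]/(lscale y 1) uE.
by apply: eq_bigr => i _; rewrite dlift_inj.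
Qed.

(** The cover is indexed by all maps X -> Y, so a map to [Y] that factors through a finite power of
    [X] lifts to it. This lifting property plays the part of purity of the kernel. *)
Lemma fac_syzygy X Y Y' (i : {linear Y' -> dsum (lhom X Y) X}) :
  finitely_generated X -> fac X Y -> short_exact i (hom_cover X Y) -> fac X Y'.
Proof.
move=> fX XY [iI iE piS] B fB f.
have [m [e [v vE]]] := fac_dsum fB (i \o f).
pose t : {linear B -> dsum 'I_m X} :=
  (\sum_j (dinj X j \o e j : lhom B (dsum 'I_m X)) : lhom B (dsum 'I_m X)).
have tE b : t b = \sum_j dinj X j (e j b) by rewrite lhom_sumE.
pose Q := qmod (range t); pose q : {linear dsum 'I_m X -> Q} := qproj (range t).
pose w : {linear dsum 'I_m X -> Y} := hom_cover X Y \o dlift v.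
have [|w' wE] := @descend R _ _ Y q w (@qproj_surj _ _ _).
  move=> x /qproj0[b <-]; rewrite compE.
  have -> : dlift v (t b) = i (f b); last by rewrite (exact_comp0 iE).
  rewrite -[RHS]/((i \o f) b) vE tE linear_sum.
  by apply: eq_bigr => j _; rewrite dlift_inj.
have fQ : finitely_generated Q by apply: fg_surj (@qproj_surj _ _ _) _; apply: fg_dsum.
have [m' [e' [u uE]]] := XY Q fQ w'.
pose s : {linear Q -> dsum (lhom X Y) X} :=
  (\sum_k (dinj X (u k : lhom X Y) \o e' k : lhom Q _) : lhom Q _).
have sE x : hom_cover X Y (s x) = w' x.
  rewrite uE lhom_sumE linear_sum; apply: eq_bigr => k _.
  by rewrite compE dlift_inj.
(* The lift [s] corrects [v] to a map into the kernel Y'; since q t = 0, the correction disappears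
   on the image of [B]. *)
have /choice[d dE] j : exists d : {linear X -> Y'},
    forall x, i (d x) = v j x - s (q (dinj X j x)).
  apply: (lift_inj (h := v j \- (s \o q \o dinj X j))) => // x; apply/iE.
  by rewrite lsubE linearB !compE sE wE compE dlift_inj subrr.
exists m, e, d => b; apply: iI; rewrite linear_sum.
under eq_bigr do rewrite dE.
rewrite sumrB -vE -!linear_sum -tE.
have -> : q (t b) = 0 by apply/qproj0; exists b.
by rewrite linear0 subr0.
Qed.

End Finite.
End Evaluation.

(** * Bass classes *)

Section Bass.
Variable R : comPzRingType.
Implicit Types A B M N X Y K P I E V G : lmodType R.

Hypothesis noeth : noetherian R.
Hypothesis cogen : forall X (x : X),
  (forall E (f : {linear X -> E}), injective_module E -> f x = 0) -> x = 0.

(* The Bass class of a semidualizing module [B], with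
   Tor_i(B, Hom(B, G)) = 0 and B (x) Hom(B, G) = G tested against injective modules. *)
Record bass B G : Prop := Bass {
  bass_perp : perp B G;
  bass_tor : forall E, injective_module E -> perp B (lhom (lhom B G) E);
  bass_inj : forall E, injective_module E -> forall z : {linear G -> E},
    (forall (f : {linear B -> G}) b, z (f b) = 0) -> forall x, z x = 0;
  bass_surj : forall E, injective_module E ->
    forall beta : {linear B -> lhom (lhom B G) E},
    exists z : {linear G -> E}, forall b (f : lhom B G), beta b f = z (f b)
}.

Lemma bass_zero B Z : is_zero Z -> bass B Z.
Proof.
move=> Z0; have H0 (f : lhom B Z) : f = 0 by apply: lhomP => b; rewrite (Z0 (f b)).
have HE0 E : is_zero (lhom (lhom B Z) E).
  by move=> h; apply: lhomP => f; rewrite (H0 f) linear0.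
split.
- by move=> e; apply/Xt_injective/is_zero_injective.
- by move=> E _ e; apply/Xt_injective/is_zero_injective.
- by move=> E _ z _ x; rewrite (Z0 x) linear0.
by move=> E _ beta; exists (lzero Z E) => b f; rewrite (H0 f) linear0.
Qed.

(* If Q is the cokernel of Hom(B, V) -> Hom(B, Y), then B (x) Q is the cokernel
   of V -> Y, so Q = 0 by Nakayama's lemma ([hom_faithful0]). *)
Lemma bass_ses B G V Y : finitely_generated B -> faithful B ->
  ses G V Y -> bass B V -> bass B Y -> bass B G.
Proof.
move=> fB Bf [f [g fg]] [Vp Vt Vi Vs] [Yp Yt Yi Ys].
have [fI fE gS] := fg.
have gB : hom_onto B g.
  pose p := qproj (range (hom_post B g)).
  have Q0 : is_zero (qmod (range (hom_post B g))).
    move=> x; apply: cogen => E psi EI; move: psi x.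
    suff H0 : is_zero (lhom (qmod (range (hom_post B g))) E).
      by move=> psi x; rewrite (H0 psi).
    apply: (hom_faithful0 fB Bf) => beta b.
    have [z zE] := Ys E EI (hom_pre E p \o beta).
    have z0 x : z x = 0.
      have [v <-] := gS x.
      have := Vi E EI (z \o g) _ v; rewrite compE; apply=> h c.
      rewrite compE -[g (h c)]/((g \o h : lhom B Y) c) -zE.
      rewrite -[LHS]/(beta c (p (hom_post B g h))).
      have -> : p (hom_post B g h) = 0 by apply/qproj0; exists h.
      by rewrite linear0.
    apply: lhomP => y; have [h <-] := @qproj_surj _ _ (range (hom_post B g)) y.
    by have := zE b h; rewrite z0.
  move=> h; have /qproj0[k kh] : p h = 0 by apply: Q0.
  by exists k => x; rewrite -kh.
have sB : short_exact (hom_post B f) (hom_post B g) by apply: hom_post_short.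
have sH E : injective_module E -> short_exact (hom_pre E (hom_post B g)) (hom_pre E (hom_post B f)).
  by move=> EI; apply: hom_pre_short => // h; have [I _ _] := sB; apply: EI.
have Gp : perp B G.
  case=> [|e]; first exact: Xt0_sub_r fg gB (Vp 0).
  by apply: Xt_sub_r (Yp e) (Vp e.+1); exists f, g.
split=> // E EI.
- move=> e; apply: (Xt_quot_r _ (Vt E EI e) (Yt E EI e.+1)).
  by exists (hom_pre E (hom_post B g)), (hom_pre E (hom_post B f)); apply: sH.
(* A four-lemma chase: extend [z] to z' on [V]. The pairing defined by z' vanishes on Hom(B, G), so
   it comes from one on Hom(B, Y), that is, from a map [chi] on [Y]. Then z' and chi g agree on [V],
   and chi g is zero on [G]. *)
- move=> z z0 x; have [z' zE] := EI _ _ f z fI.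
  have bl c : linear (fun k : lhom B V => z' (k c)) by move=> a k l; rewrite -linearP.
  have bbl : linear (fun c => lin (bl c) : lhom (lhom B V) E).
    by move=> a c d; apply: lhomP => k; rewrite /= !linearP.
  have [HI HE HS] := sH E EI.
  have [beta betaE] : exists beta : {linear B -> lhom (lhom B Y) E},
      forall c, hom_pre E (hom_post B g) (beta c) = lin bbl c.
    apply: lift_inj => // c; apply/HE; apply: lhomP => k.
    by rewrite -[LHS]/(z' (f (k c))) zE z0.
  have [chi chiE] := Ys E EI beta.
  have z'E v : (z' \- (chi \o g)) v = 0.
    apply: Vi => // k c; rewrite lsubE compE.
    rewrite -[g (k c)]/((g \o k : lhom B Y) c) -chiE.
    rewrite -[beta c _]/(hom_pre E (hom_post B g) (beta c) k) betaE.
    by rewrite -[X in _ - X]/(z' (k c)) subrr.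
  have := z'E (f x); rewrite lsubE compE zE (exact_comp0 fE) linear0 subr0.
  by [].
move=> beta; have [gam gamE] := Xt0_lift (sH E EI) (Yt E EI 0) beta.
have [z zE] := Vs E EI gam; exists (z \o f) => b h.
by rewrite -gamE -[LHS]/(gam b (f \o h)) zE.
Qed.

Lemma bass_coarse B (C : lmodType R -> Prop) n G : finitely_generated B -> faithful B ->
  (forall V, C V -> bass B V) ->
  coarse (fun A B X => ses X B A) (@is_zero R) C n G -> bass B G.
Proof.
move=> fB Bf CB; elim=> [M|m K V M sM CV _ IH]; first exact: bass_zero.
by apply: bass_ses sM (CB V CV) IH.
Qed.

(* The pairing [e] identifies [X'] with Hom(B, X) and, after dualizing into [I],
   [X] with B (x) X'. *)
Lemma bass_dual B X X' (e : {linear B -> lhom X' X}) I :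
  finitely_generated B -> finitely_generated X -> injective_module I ->
  (forall x', (forall b, e b x' = 0) -> x' = 0) ->
  (forall f : {linear B -> X}, exists x', forall b, f b = e b x') ->
  (forall h : {linear X -> I}, (forall b x', h (e b x') = 0) -> forall x, h x = 0) ->
  (forall psi : {linear B -> lhom X' I}, exists h : {linear X -> I},
    forall b x', psi b x' = h (e b x')) ->
  perp B X -> perp B (lhom X' I) -> bass B (lhom X' I).
Proof.
move=> fB fX II eI eS tI tS BX BG.
have [inv invE] : exists inv : {linear lhom B X -> X'}, forall f, lflip e (inv f) = f.
  apply: (lift_inj (f := lflip e) (h := lid (lhom B X))).
    apply: injection0 => x' ex; apply: eI => b; exact: (lhom_at ex b).
  by move=> f; have [x' fE] := eS f; exists x'; apply: lhomP => b; rewrite fE.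
have eK x' : inv (lflip e x') = x'.
  apply/eqP; rewrite -subr_eq0; apply/eqP; apply: eI => b.
  by rewrite -lflipE linearB invE subrr.
have jl b : linear (fun h : lhom X I => h \o e b : lhom X' I).
  by move=> a h k; apply: lhomP.
have jjl (h : lhom X I) : linear (fun b => h \o e b : lhom X' I).
  by move=> a b c; apply: lhomP => x'; rewrite /= !linearP.
have jjjl : linear (fun h : lhom X I => lin (jjl h) : lhom B (lhom X' I)).
  by move=> a h k; apply: lhomP => b; apply: lhomP.
pose j := lin jjjl.
have jE h b x' : j h b x' = h (e b x') by [].
have [jv jvE] : exists jv : {linear lhom B (lhom X' I) -> lhom X I}, forall f, j (jv f) = f.
  apply: (lift_inj (f := j) (h := lid (lhom B (lhom X' I)))).
    apply: injection0 => h jh; apply: lhomP => x; apply: tI => b x'.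
    by rewrite -jE jh.
  move=> f; have [h hE] := tS f; exists h; apply: lhomP => b; apply: lhomP => x'.
  by rewrite hE.
split=> // E EI.
(* [j] identifies Hom(X, I) with Hom(B, Hom(X', I)), so the module in question is a retract of
   Hom(Hom(X, I), E), which lies in [fac X]. *)
- move=> d; apply: (@Xt_retract_r R d B (lhom (lhom X I) E) _ (hom_pre E j) (hom_pre E jv)).
    by move=> u; apply: lhomP => f; rewrite -[LHS]/(u (j (jv f))) jvE.
  by apply: fac_Xt => //; apply: fac_double_dual.
- move=> z z0 gam; have [m [b [h hE]]] := evh_span (gam \o inv) fB II.
  have -> : gam = \sum_i j (h i) (b i).
    apply: lhomP => x'; rewrite lhom_sumE -[in LHS](eK x').
    rewrite -[LHS]/((gam \o inv) (lflip e x')) hE; apply: eq_bigr => i _.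
    by [].
  by rewrite linear_sum big1.
move=> beta; have [xi xiE] := evaluation noeth (hom_pre E j \o beta) fB II.
exists (xi \o hom_pre I inv) => b f; rewrite -[in LHS](jvE f).
rewrite -[LHS]/((hom_pre E j \o beta) b (jv f)) xiE compE; congr (xi _).
apply: lhomP => k; rewrite -[RHS]/(f b (inv k)) -[in RHS](jvE f) jE.
by rewrite -[e b (inv k)]/(lflip e (inv k) b) invE.
Qed.

End Bass.

(** * Finite resolutions, isomorphisms and duals of tensor products *)

Section FiniteResolutions.
Variable R : comPzRingType.
Implicit Types A B M N X Y K P I E V G W : lmodType R.
Implicit Types C : lmodType R -> Prop.

Definition opses A B X : Prop := ses X B A.
Definition fin_left C := fin_res (@ses R) (@is_zero R) C.
Definition fin_right C := fin_res opses (@is_zero R) C.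

Lemma wedge_fin_left C M : wedge C M -> fin_left C M.
Proof.
(* Degrees 0 to [n] carry [n.+1] terms. *)
move=> [n [L [Lex LC L0]]]; exists n.+1.
elim: n M L Lex LC L0 => [|n IH] M L Lex LC L0;
  have [K [i [q [iq iqE Kex]]]] := lshift Lex.
  apply: (@coarse_step _ _ _ _ 0 K (lobj L 0)); [by exists i, (laug L)|exact: LC|].
  apply: coarse_zero => x; have [/(_ x)[y <-] _ _] := Kex.
  by rewrite /= in y *; rewrite (L0 1 _ y) // linear0.
apply: (@coarse_step _ _ _ _ n.+1 K (lobj L 0)); [by exists i, (laug L)|exact: LC|].
apply: (IH K _ Kex) => k kn; [exact: LC | exact: L0].
Qed.

Lemma vee_fin_right C M : vee C M -> fin_right C M.
Proof.
move=> [n [L [Lex LC L0]]]; exists n.+1.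
elim: n M L Lex LC L0 => [|n IH] M L Lex LC L0;
  have [K [q [i [iq iqE Kex]]]] := rshift Lex.
  apply: (@coarse_step _ _ _ _ 0 K (robj L 0)); [by exists (raug L), q|exact: LC|].
  apply: coarse_zero => x; have [KI _ _] := Kex; apply: KI.
  by rewrite /= (L0 1 _ (i x)) // (L0 1 _ (i 0)).
apply: (@coarse_step _ _ _ _ n.+1 K (robj L 0)); [by exists (raug L), q|exact: LC|].
apply: (IH K _ Kex) => k kn; [exact: LC | exact: L0].
Qed.

Lemma coarse_lhom C I n H : injective_module I ->
  coarse (@ses R) (@is_zero R) C n H ->
  coarse opses (@is_zero R) (fun V => exists2 W, C W & V = lhom W I) n (lhom H I).
Proof.
move=> II; elim=> [M zM|m K X M sM CX _ IH].
  by apply: coarse_zero => h; apply: lhomP => x; rewrite (zM x) linear0.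
apply: coarse_step IH; last by exists X.
exact: ses_hom_pre sM (Xt_injective 0 _ II).
Qed.

Lemma iso_ses A B (f : {linear A -> B}) Z : injection f -> surjection f ->
  is_zero Z -> ses A B Z.
Proof.
move=> fI fS zZ; exists f, (lzero B Z); split=> //.
by move=> z; exists 0; rewrite (zZ z).
Qed.

Lemma linear_inverse A B (f : {linear A -> B}) : injection f -> surjection f ->
  exists g : {linear B -> A}, (forall x, f (g x) = x) /\ (forall x, g (f x) = x).
Proof.
move=> fI fS; have [g gE] := @lift_inj R A B B f (lid B) fI fS.
by exists g; split=> // x; apply: fI; rewrite gE.
Qed.

Lemma isomorphicP A B : isomorphic A B <->
  exists f : {linear A -> B}, injection f /\ surjection f.
Proof.
split=> [[f [g fK gK]]|[f [fI fS]]]; exists f.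
  by split=> [|y]; [exact: (can_inj fK) | exists (g y)].
by have [g [fg gf]] := linear_inverse fI fS; exists g.
Qed.

(** For projective [P] and injective [I], Hom(P, I) is injective, so that dualizing turns modules in
    [P_ K] into modules in [I_ K]. *)
Lemma tensor_hom K P W (t : K -> P -> W) I : is_tensor t ->
  exists f : {linear lhom W I -> lhom K (lhom P I)}, injection f /\ surjection f.
Proof.
move=> [[t1 t2] tU].
have fl1 (h : lhom W I) c : linear (fun p => h (t c p)).
  by move=> a p q; rewrite t2 linearP.
have fl2 (h : lhom W I) : linear (fun c => lin (fl1 h c) : lhom P I).
  by move=> a c d; apply: lhomP => p; rewrite /= t1 linearP.
have fl3 : linear (fun h : lhom W I => lin (fl2 h) : lhom K (lhom P I)).
  by move=> a g h; apply: lhomP => c; apply: lhomP.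
exists (lin fl3); split=> [g h gh|h].
  have [|k [kE kU]] := tU I (fun c p => g (t c p)).
    by split=> [p a c d|c a p q]; rewrite ?t1 ?t2 linearP.
  have -> : g = k.
    by apply/esym; apply: kU.
  apply: kU => c p; have := lhom_at (lhom_at gh c) p.
  by move=> e; rewrite -[LHS]/(lin fl3 h c p) -e.
have [|k [kE kU]] := tU I (fun c p => h c p).
  by split=> [p a c d|c a p q]; rewrite ?linearP.
by exists k; apply: lhomP => c; apply: lhomP => p; apply: kE.
Qed.

End FiniteResolutions.

(** * Bass classes of C and Cd, and the basic vanishings *)

Section Core.
Variables (R : comPzRingType) (D C : lmodType R).
Implicit Types A B M N X Y K P I E V G W : lmodType R.

Hypothesis noeth : noetherian R.

Lemma semidualizingP M : semidualizing M ->
  [/\ finitely_generated M, forall f : {linear M -> M}, exists r : R, forall x, f x = r *: x,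
      faithful M & perp M M].
Proof.
move=> [fM [g hK gK] MM]; split=> //.
- by move=> f; exists (g f) => x; rewrite -[LHS]/((f : lhom M M) x) -[in LHS](gK f).
- move=> r r0; apply: (can_inj hK); apply: lhomP => x.
  by rewrite -[LHS]/(r *: x) -[RHS]/(0 *: x) r0 scale0r.
by move=> e; apply/Ext_eq0_Xt; apply: MM.
Qed.

Hypothesis sD : semidualizing D.
Hypothesis sC : semidualizing C.
Variable n : nat.
Hypothesis Dinj : coarse (@opses R) (@is_zero R) (@injective_module R) n D.

Lemma D_injdim e M : (n <= e)%N -> Xt e M D.
Proof.
apply: (fin_res_orth (ext_structure_op (@module_ext_structure R))
  (C := @injective_module R) (D := fun=> True) _ Dinj) => // d A B AI _.
exact: Xt_injective.
Qed.

(* If A = R x has no nonzero map into an injective module, then Hom(A, D) = 0 and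
   Ext^i(A, D) = 0, whence A = 0 by biduality. *)
Lemma injective_cogenerator X (x : X) :
  (forall E (f : {linear X -> E}), injective_module E -> f x = 0) -> x = 0.
Proof.
move=> x0; pose A := smod (range (lscale x)).
have fA : finitely_generated A by apply/fg_range/fg_ring.
have AE E (f : {linear A -> E}) a : injective_module E -> f a = 0.
  move=> EI; have [g gE] := EI _ _ (sincl (range (lscale x))) f (@sincl_inj _ _ _).
  have [r ra] : exists r, lscale x r = sincl (range (lscale x)) a.
    exact: (svalP a).
  by rewrite -gE -ra /lscale linE linearZ_LR (x0 E g EI) scaler0.
have AD m Y : coarse (@opses R) (@is_zero R) (@injective_module R) m Y ->
    perp A Y /\ forall (h : {linear A -> Y}) a, h a = 0.
  elim=> [M zM|k K J M [f [g fg]] JI _ [IHp IH0]].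
    by split=> [e|h a]; [apply/Xt_injective/is_zero_injective | apply: zM].
  have [fI _ _] := fg; split=> [[|e]|h a].
  - apply: (Xt0_sub_r fg); last exact: Xt_injective.
    by move=> h; exists (lzero A J) => y; rewrite IH0 linear0.
  - by apply: Xt_sub_r (IHp e) _; [exists f, g | apply: Xt_injective].
  by apply: fI; rewrite linear0 -[LHS]/((f \o h) a) AE.
have [fD Dscal Df DD] := semidualizingP sD; have [AD1 AD0] := AD _ _ Dinj.
have xA : range (lscale x) x by exists 1; rewrite /lscale linE scale1r.
have := @bidual_inj _ _ noeth Dscal Df DD n (fun e M => @D_injdim e M) A fA AD1
  (exist _ x xA : A) (fun h => AD0 h _).
by move=> /(congr1 (sincl (range (lscale x)))).
Qed.

Let Cd : lmodType R := lhom C D.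

(** An isomorphism is a short exact sequence with zero last term, so [bass_ses] also provides
    invariance. *)
Lemma bass_iso B G V (f : {linear G -> V}) : finitely_generated B -> faithful B ->
  injection f -> surjection f -> bass B V -> bass B G.
Proof.
move=> fB Bf fI fS BV; apply: (bass_ses injective_cogenerator fB Bf _ BV).
  exact: iso_ses fI fS (@zeroMP R).
exact/bass_zero/zeroMP.
Qed.

Lemma lscale_linear M : linear (fun x : M => lscale x : lhom R^o M).
Proof.
move=> a x y; apply: lhomP => r; rewrite -[LHS]/((r : R) *: (a *: x + y)).
by rewrite scalerDr scalerA mulrC -scalerA.
Qed.

(** Write J = Hom(R, J) and apply [bass_dual] to scalar multiplication C x R -> C: Hom(C, C) = R and
    C (x) R = C. *)
Lemma bass_injective J : injective_module J -> bass C J.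
Proof.
move=> JI; have [fC Cscal Cf CC] := semidualizingP sC.
apply: (@bass_iso C J (lhom R^o J) (lin (@lscale_linear J))) => //.
- move=> x y /lhom_at/(_ 1); rewrite -[LHS]/(1 *: x) -[RHS]/(1 *: y).
  by rewrite !scale1r.
- move=> h; exists (h 1); apply: lhomP => r.
  by rewrite -[LHS]/((r : R) *: h 1) -linearZ_LR; congr (h _); apply: mulr1.
have RJ : injective_module (lhom R^o J) by apply: injective_lhom JI; apply: projective_ring.
pose e : {linear C -> lhom R^o C} := lin (@lscale_linear C).
have eE c r : e c r = (r : R) *: c by [].
apply: (bass_dual noeth (e := e)) => //.
- by move=> h h0 x; have := h0 x 1; rewrite eE scale1r.
- move=> psi; have pl : linear (fun c => psi c 1) by move=> a x y; rewrite linearP.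
  exists (lin pl) => c r; rewrite eE linearZ_LR linE.
  by rewrite -linearZ_LR; congr (psi c _); apply/esym/mulr1.
by move=> d; apply: Xt_injective.
Qed.

Lemma bass_injdim m X : coarse (@opses R) (@is_zero R) (@injective_module R) m X ->
  bass C X.
Proof.
move=> cX; have [fC _ Cf _] := semidualizingP sC.
exact: (bass_coarse injective_cogenerator fC Cf bass_injective cX).
Qed.

Lemma bass_D : bass C D. Proof. exact: bass_injdim Dinj. Qed.

Lemma fg_Cd : finitely_generated Cd.
Proof. by apply: fg_hom => //; [case: (semidualizingP sC)|case: (semidualizingP sD)]. Qed.

Lemma perp_Cd_D : perp Cd D.
Proof.
have [fD Dscal Df DD] := semidualizingP sD; have [fC Cscal Cf CC] := semidualizingP sC.
by apply: (perp_dual noeth DD D_injdim fC (bass_perp bass_D)).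
Qed.

Lemma C_bidual_surj (f : {linear Cd -> D}) : exists c, forall h : Cd, f h = h c.
Proof.
have [fD Dscal Df DD] := semidualizingP sD; have [fC Cscal Cf CC] := semidualizingP sC.
exact: (bidual_surj noeth Dscal DD D_injdim fC (bass_perp bass_D)).
Qed.

Lemma C_bidual_inj (c : C) : (forall h : {linear C -> D}, h c = 0) -> c = 0.
Proof.
have [fD Dscal Df DD] := semidualizingP sD; have [fC Cscal Cf CC] := semidualizingP sC.
exact: (bidual_inj noeth Dscal Df DD D_injdim fC (bass_perp bass_D)).
Qed.

Lemma C_bidual_inverse : exists p : {linear lhom Cd D -> C},
  (forall (h : Cd) f, h (p f) = f h) /\
  forall c, p ((lflip (lid Cd) : {linear C -> lhom Cd D}) c) = c.
Proof.
pose j : {linear C -> lhom Cd D} := lflip (lid Cd).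
have jI : injection j.
  by apply: injection0 => c jc; apply: C_bidual_inj => h; apply: (lhom_at jc h).
have jS : surjection j.
  by move=> f; have [c cE] := C_bidual_surj f; exists c; apply: lhomP => h; rewrite cE.
have [p [pK Kp]] := linear_inverse jI jS.
by exists p; split=> // h f; rewrite -[LHS]/(j (p f) h) pK.
Qed.

Lemma faithful_Cd : faithful Cd.
Proof.
move=> r r0; have [fC Cscal Cf CC] := semidualizingP sC; apply: Cf => c.
apply: C_bidual_inj => h; rewrite linearZ_LR.
exact: (lhom_at (r0 h) c).
Qed.

(** [bass_dual] for the evaluation pairing C x Cd -> D: Hom(C, D) = Cd by definition, and C (x) Cd =
    D because [D] is in the Bass class of [C]. *)
Lemma bass_Cd I : injective_module I -> bass C (lhom Cd I).
Proof.
move=> II; have [fD Dscal Df DD] := semidualizingP sD.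
have [fC Cscal Cf CC] := semidualizingP sC.
pose e : {linear C -> lhom Cd D} := lflip (lid Cd).
have eE c h : e c h = h c by [].
apply: (bass_dual noeth (e := e)) => //.
- by move=> h h0; apply: lhomP => c; rewrite -eE h0.
- by move=> f; exists f.
- by move=> h h0 x; apply: (bass_inj bass_D II) => f b; rewrite -eE.
- by move=> psi; have [z zE] := bass_surj bass_D II psi; exists z => b f; rewrite zE.
- exact: bass_perp bass_D.
exact: bass_tor bass_D _ II.
Qed.

(** The same pairing read from the other side, with Hom(Cd, D) = C by biduality. *)
Lemma bass_CdC I : injective_module I -> bass Cd (lhom C I).
Proof.
move=> II; have [fD Dscal Df DD] := semidualizingP sD.
have [fC Cscal Cf CC] := semidualizingP sC.
apply: (bass_dual noeth (e := lid Cd)) => //.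
- exact: fg_Cd.
- by move=> c; apply: C_bidual_inj.
- by move=> f; have [c cE] := C_bidual_surj f; exists c.
- move=> h h0 x; apply: (bass_inj bass_D II) => f b; exact: h0.
- move=> psi; have [z zE] := bass_surj bass_D II (lflip psi).
  by exists z => f b; rewrite -zE.
- exact: perp_Cd_D.
by move=> e; apply: Xt_sym => //; apply: bass_tor bass_D _ II e.
Qed.

(* Ext^i(Cd, Hom(C, X)) = Ext^i(C (x) Cd, X) = Ext^i(D, X), by induction on a
   finite injective coresolution of X. *)
Lemma perp_Cd_Cd : perp Cd Cd.
Proof.
suff: forall m X, coarse (@opses R) (@is_zero R) (@injective_module R) m X -> perp D X ->
    perp Cd (lhom C X) /\ forall psi : {linear Cd -> lhom C X},
      exists h : {linear D -> X}, forall f c, psi f c = h (f c).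
  by move=> /(_ n D Dinj); case=> //; case: (semidualizingP sD).
move=> m X; elim=> [{m}{}X zX DX|{m X} m Y J X sX JI cY IH DX].
  have H0 (h : lhom C X) : h = 0 by apply: lhomP => c; apply: zX.
  split=> [e|psi]; first exact/Xt_injective/is_zero_injective.
  by exists (lzero D X) => f c; apply: zX.
have DY : perp D Y by move=> e; apply: Xt_quot_r sX (Xt_injective e D JI) (DX e.+1).
have [IHp IHs] := IH DY.
have BX : bass C X by apply: (@bass_injdim m.+1); apply: coarse_step sX JI cY.
have [f [g fg]] := sX; have [fI fE gS] := fg.
have sCX : short_exact (hom_post C f) (hom_post C g).
  by apply: hom_post_short => // h; apply: Xt0_lift fg (bass_perp BX 0) h.
have JC : perp Cd (lhom C J).
  by move=> e; apply: Xt_sym => //; apply: bass_tor bass_D _ JI e.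
have tJ (psi : {linear Cd -> lhom C J}) :
    exists h : {linear D -> J}, forall f c, psi f c = h (f c).
  by have [z zE] := bass_surj bass_D JI (lflip psi); exists z => k c; rewrite -zE.
split=> [[|e]|psi].
- apply: (Xt0_sub_r sCX) (JC 0) => psi; have [h hE] := IHs psi.
  have [k kE] := Xt0_lift fg (DX 0) h.
  have kl (a : Cd) : linear (fun c => k (a c)) by move=> r x y; rewrite !linearP.
  have kkl : linear (fun a : Cd => lin (kl a) : lhom C J).
    by move=> r a b; apply: lhomP => c; rewrite /= -linearP.
  exists (lin kkl) => a; apply: lhomP => c.
  by rewrite hE -kE.
- by apply: Xt_sub_r (IHp e) (JC e.+1); exists (hom_post C f), (hom_post C g).
have [h hE] := tJ (hom_post C f \o psi).
(* On the values a c the composite g h is zero by exactness; every functional from [D] to an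
   injective module that kills these values is zero, and injective modules detect elements. *)
have gh d : g (h d) = 0.
  apply: injective_cogenerator => E z EI.
  apply: (bass_inj bass_D EI (z := z \o g \o h)) => a c.
  rewrite !compE -hE -[(hom_post C f \o psi) a c]/(f (psi a c)).
  by rewrite (exact_comp0 fE) linear0.
have [k kE] : exists k : {linear D -> X}, forall d, f (k d) = h d.
  by apply: lift_inj => // d; apply/fE.
by exists k => a c; apply: fI; rewrite kE -hE.
Qed.

(** By symmetry this concerns Ext(Cd, Hom(Hom(Cd, J), I)), whose second argument lies in [fac Cd];
    thus it reduces to Ext(Cd, Cd) = 0. *)
Lemma perp_I_I I J : injective_module I -> injective_module J ->
  perp (lhom Cd J) (lhom Cd I).
Proof.
move=> II JI e; apply: Xt_sym => //.
apply: (fac_Xt noeth fg_Cd); last exact: perp_Cd_Cd.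
exact: (fac_double_dual noeth fg_Cd).
Qed.

(** Hom(Cd, -) keeps the injective coresolution of [D] exact, because Ext(Cd, -) vanishes on [D] and
    hence on each cosyzygy. By biduality Hom(Cd, D) is [C]. *)
Lemma C_coresolution : fin_right (fun V => exists2 I, injective_module I & V = lhom Cd I)
  (lhom Cd D).
Proof.
exists n; elim: Dinj perp_Cd_D => [X zX _|m Y J X sX JI _ IH CX].
  by apply: coarse_zero => h; apply: lhomP => c; apply: zX.
apply: coarse_step (IH _); first exact: ses_hom_post sX (CX 0).
  by exists J.
by move=> e; apply: Xt_quot_r sX (Xt_injective e _ JI) (CX e.+1).
Qed.

Lemma perp_C_of_I N : (forall I, injective_module I -> perp (lhom Cd I) N) -> perp C N.
Proof.
move=> IN e; have [m cC] := C_coresolution.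
have [p [_ Kp]] := C_bidual_inverse.
apply: (Xt_retract_l Kp).
suff gen k X : coarse (@opses R) (@is_zero R)
    (fun V => exists2 I, injective_module I & V = lhom Cd I) k X -> perp X N.
  exact: gen cC e.
elim=> [{k}{}X zX|{k X} k Y V X sX [I II VI] _ IH] d.
  by apply: Xt_projective; apply: is_zero_projective.
by apply: Xt_sub sX _ (IH d.+1); rewrite VI; apply: IN.
Qed.

Lemma perp_C_fin_right N :
  fin_right (fun V => exists2 I, injective_module I & isomorphic V (lhom Cd I)) N ->
  perp C N.
Proof.
move=> [m cN]; have [fC _ Cf _] := semidualizingP sC.
apply: bass_perp; apply: (bass_coarse injective_cogenerator fC Cf _ cN).
move=> V [I II /isomorphicP[f [fI fS]]].
exact: bass_iso fC Cf fI fS (bass_Cd II).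
Qed.

(** By symmetry this concerns Ext(Cd, Hom(H, I)), and Hom(H, I) has a finite coresolution by modules
    Hom(C, Hom(P, I)) of the Bass class of [Cd]. *)
Lemma perp_fin_left H I : injective_module I -> fin_left (P_ C) H ->
  perp H (lhom Cd I).
Proof.
move=> II [m cH] e; apply: Xt_sym => //.
apply: bass_perp.
apply: (bass_coarse injective_cogenerator fg_Cd faithful_Cd _ (coarse_lhom II cH)).
move=> _ [W [P [t [PP tP]]] ->]; have [f [fI fS]] := tensor_hom I tP.
apply: bass_iso fg_Cd faithful_Cd fI fS (bass_CdC _).
exact: injective_lhom.
Qed.

End Core.

(** * Baer's criterion *)

Section Baer.
Variable R : comPzRingType.
Implicit Types A B Y : lmodType R.
Local Open Scope classical_set_scope.

(** T = S + Rx, and T/S is cyclic, hence finitely generated. *)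
Lemma baer_step B Y (S : submod B) (f : {linear smod S -> Y}) (x : B) :
  (forall A, finitely_generated A -> Xt 0 A Y) ->
  exists (T : submod B) (g : {linear smod T -> Y}), T x /\
    forall s, exists t, sincl T t = sincl S s /\ g t = f s.
Proof.
move=> AY; pose u : {linear prodM (smod S) (R^o : lmodType R) -> B} :=
  (sincl S \o pfst _ _) \+ (lscale x \o psnd _ _).
pose T := range u.
have uE s r : u (s, r) = sincl S s + (r : R) *: x by [].
have [j jE] : exists j : {linear smod S -> smod T}, forall s, sincl T (j s) = sincl S s.
  apply: lift_inj; first exact: sincl_inj.
  by move=> s; apply/(sinclP T); exists (s, 0); rewrite uE scale0r addr0.
have jI : injection j.
  by move=> s t st; apply: (@sincl_inj _ _ S); rewrite -!jE st.
have sj := cokernel_ses jI.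
have fQ : finitely_generated (qmod (range j)).
  have Tx : T x by exists (0, 1); rewrite uE linear0 add0r scale1r.
  apply: (@fg_surj _ _ _ (lscale (qproj (range j) (exist _ x Tx : smod T)))); last exact: fg_ring.
  move=> q; have [t <-] := @qproj_surj _ _ (range j) q.
  have [[s r] tE] := svalP t; exists r.
  rewrite /lscale linE -linearZ_LR; apply/eqP; rewrite -subr_eq0 -linearB; apply/eqP.
  apply/qproj0; exists (- s); apply: (@sincl_inj _ _ T).
  rewrite jE linearN linearB linearZ_LR.
  have -> : sincl T t = sincl S s + (r : R) *: x by rewrite -uE tE.
  by rewrite opprD addrCA subrr addr0.
have [g gE] := Xt0_extend (AY _ fQ) sj f.
exists T, g; split; first by exists (0, 1); rewrite uE linear0 add0r scale1r.
by move=> s; exists (j s).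
Qed.

Lemma baer Y : (forall A, finitely_generated A -> Xt 0 A Y) -> injective_module Y.
Proof.
move=> AY A B i f iI.
pose ext (G : set (prodM B Y)) := [set p | (exists a, p = (i a, f a)) \/ G p].
pose lin_graph (G : set (prodM B Y)) :=
  (forall a p q, ext G p -> ext G q -> ext G (a *: p + q)) /\
  forall y, ext G (0, y) -> y = 0.
have graph0 : lin_graph set0.
  split=> [a p q [[b ->]|//] [[c ->]|//]|y [[a [ia ->]]|//]].
    by left; exists (a *: b + c); apply: prodM_ext; rewrite /= linearP.
  by have -> : a = 0; [apply: iI; rewrite -ia linear0 | rewrite linear0].
have [|G [[Gl Gf] Gmax]] := @Zorn_bigcup (prodM B Y) lin_graph.
  move=> F FP Ftot.
  have chain p q : ext (\bigcup_(X in F) X) p -> ext (\bigcup_(X in F) X) q ->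
      exists X, [/\ lin_graph X, ext X p, ext X q &
                    forall z, ext X z -> ext (\bigcup_(X in F) X) z].
    have sub X : F X -> forall z, ext X z -> ext (\bigcup_(X in F) X) z.
      by move=> FX z [|Xz]; [left | right; exists X].
    move=> [[a ->]|[X FX Xp]] [[b ->]|[Z FZ Zq]].
    - exists set0; split=> //; [by left; exists a | by left; exists b |].
      by move=> z [za|//]; left.
    - by exists Z; split; [exact: FP | left; exists a | right | exact: sub].
    - by exists X; split; [exact: FP | right | left; exists b | exact: sub].
    have [XZ|ZX] := Ftot _ _ FX FZ.
      by exists Z; split; [exact: FP | right; apply: XZ | right | exact: sub].
    by exists X; split; [exact: FP | right | right; apply: ZX | exact: sub].
  split=> [a p q Fp Fq|y Fy].
    by have [X [[Xl _] Xp Xq XF]] := chain p q Fp Fq; apply/XF/Xl.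
  by have [X [[_ Xf] Xy _ _]] := chain _ _ Fy Fy; apply: Xf.
have G0 : ext G 0 by left; exists 0; apply: prodM_ext; rewrite /= linear0.
pose S : submod (prodM B Y) := Submod G0 Gl.
have total x : exists y, S (x, y).
  pose p : {linear smod S -> B} := pfst B Y \o sincl S.
  have pI : injection p.
    apply: injection0 => -[[b y] Sy] /= b0; apply: smodP => /=.
    have Sy0 : ext G (0, y) by rewrite -b0.
    by rewrite (Gf y Sy0) b0.
  have [q qE] : exists q : {linear smod (range p) -> smod S},
      forall z, p (q z) = sincl (range p) z.
    by apply: (lift_inj (h := sincl (range p))) => // z; apply/(sinclP (range p)); exists z.
  have [T [g [Tx Tg]]] := baer_step (psnd B Y \o sincl S \o q) x AY.
  pose G' : set (prodM B Y) := [set z | exists t, z = (sincl T t, g t)].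
  have SG' z : S z -> G' z.
    move=> Sz; pose s : smod S := exist _ z Sz.
    have ps : range p (p s) by exists s.
    have [t [tE gt]] := Tg (exist _ _ ps).
    exists t; apply: prodM_ext; rewrite /= ?tE // gt.
    have qs : q (exist _ _ ps) = s by apply: pI; rewrite qE.
    by rewrite !compE qs.
  have extG' z : ext G' z -> G' z by case=> // -[a ->]; apply: SG'; left; exists a.
  have G'lin : lin_graph G'.
    split=> [a z w /extG'[t ->] /extG'[t' ->]|y /extG'[t [t0 ->]]].
      by right; exists (a *: t + t'); apply: prodM_ext; rewrite linearP /= ?linearP.
    have -> : t = 0 by apply: (@sincl_inj _ _ T); rewrite linear0; apply/esym.
    by rewrite linear0.
  have /contrapT G'G : ~ ~ (G' `<=` G).
    move=> nG; apply: (Gmax G') G'lin; split=> // z Gz.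
    by apply: SG'; right.
  by exists (g (exist _ x Tx)); right; apply: G'G; exists (exist _ x Tx).
have [||h hE] := @linear_choice R B Y (fun x y => S (x, y)) total.
- move=> x y y' Sy Sy'; apply/eqP; rewrite -subr_eq0; apply/eqP; apply: Gf.
  rewrite -[0](subrr x); exact: (sm_B Sy Sy').
- by move=> a x x' y y' Sy Sy'; apply: (sm_P a Sy Sy').
exists h => a; apply/eqP; rewrite -subr_eq0; apply/eqP; apply: Gf.
have Sa : S (i a, f a) by left; exists a.
rewrite -[0](subrr (i a)); exact: (sm_B (hE (i a)) Sa).
Qed.

End Baer.

(** * Finite P_C-dimension *)

Section FiniteDimension.
Variables (R : comPzRingType) (D C : lmodType R).
Implicit Types A B M N X Y K P I J E V G W : lmodType R.

Hypothesis noeth : noetherian R.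
Hypothesis sD : semidualizing D.
Hypothesis sC : semidualizing C.
Variable n : nat.
Hypothesis Dinj : coarse (@opses R) (@is_zero R) (@injective_module R) n D.
Let Cd : lmodType R := lhom C D.

(** A product with one factor for each element of [Y], chosen to detect that element. *)
Lemma enough_injectives Y : exists E (f : {linear Y -> E}),
  injective_module E /\ injection f.
Proof.
have ex (y : Y) : exists E (f : {linear Y -> E}), injective_module E /\ (f y = 0 -> y = 0).
  have [y0|y0] := pselect (y = 0).
    exists (zeroM R), (lzero Y _); split=> // ; apply: is_zero_injective; exact: zeroMP.
  apply: contrapT => nex; apply: y0; apply: (injective_cogenerator noeth sD Dinj).
  move=> E f EI; apply: contrapT => fy; apply: nex.
  by exists E, f.
pose E y := projT1 (cid (ex y)); pose f y := projT1 (cid (projT2 (cid (ex y)))).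
have fE y : injective_module (E y) /\ (f y y = 0 -> y = 0).
  exact: (projT2 (cid (projT2 (cid (ex y))))).
exists (pmod E), (ptuple f); split; first by apply: injective_pmod => y; case: (fE y).
apply: injection0 => y fy; have [_] := fE y; apply.
by have /(congr1 (fun z : pmod E => z y)) := fy.
Qed.

(** Baer's criterion in higher degrees: embed [Y] in an injective module and shift to the
    cokernel. *)
Lemma Xt_fg_bound m Y : (forall A, finitely_generated A -> Xt m A Y) ->
  forall M, Xt m M Y.
Proof.
elim: m Y => [|m IH] Y AY M; first exact/Xt_injective/baer.
have [E [f [EI fI]]] := enough_injectives Y.
have sY : ses Y E (qmod (range f)) by exists f, (qproj _); apply: cokernel_ses.
apply: (Xt_sub_r sY _ (Xt_injective _ _ EI)); apply: IH => A fA.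
exact: Xt_quot_r sY (Xt_injective _ _ EI) (AY A fA).
Qed.

(** The bound is the same for the whole of [fac D], in particular for all the successive kernels met
    in [perp_hom_fac]. *)
Lemma fac_D_bound Y M : fac D Y -> Xt n M Y.
Proof.
move=> DY; apply: Xt_fg_bound => A fA; apply: (fac_Xt noeth fA DY).
exact: (D_injdim Dinj).
Qed.

Section Test.
Variable M : lmodType R.
Hypothesis MC : forall S : choiceType, perp M (dsum S C).

(** As [Cd] is finitely generated, Hom(Cd, -) commutes with direct sums, and Hom(Cd, D) = C; so the
    second argument is a direct sum of copies of [C]. *)
Lemma perp_hom_dsum (S : choiceType) : perp M (lhom Cd (dsum S D)).
Proof.
have al (s : S) c : linear (fun h : Cd => dinj D s (h c)).
  by move=> a h k; exact: (linearP (dinj D s) a (h c) (k c)).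
have cl (s : S) : linear (fun c => lin (al s c) : lhom Cd (dsum S D)).
  move=> a x y; apply: lhomP => h.
  by rewrite -[LHS]/(dinj D s (h (a *: x + y))) !linearP.
pose p : {linear dsum S C -> lhom Cd (dsum S D)} := dlift (fun s => lin (cl s)).
have pE x s h : dcomp D s (p x h) = h (dcomp C s x).
  have pl : linear (fun x => dcomp D s (p x h)) by move=> a y z; rewrite !linearP.
  apply: (dsum_ext (f := lin pl) (g := (h : {linear C -> D}) \o dcomp C s)) => t c.
  rewrite linE compE /p dlift_inj -[lin (cl t) c h]/(dinj D t (h c)) !dcomp_inj.
  by case: eqP => //; rewrite linear0.
have pI : injection p.
  apply: injection0 => x px; apply: dsumP => s; rewrite linear0.
  apply: (C_bidual_inj noeth sD sC Dinj) => h.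
  by rewrite -pE px linear0.
have pS : surjection p.
  move=> f; have [l lE] := fg_dsum_image f (fg_Cd noeth sD sC).
  have /choice[c cE] s : exists c, forall h : Cd, dcomp D s (f h) = h c.
    exact: (C_bidual_surj noeth sD sC Dinj (dcomp D s \o f)).
  exists (\sum_(s <- l) dinj C s (c s)); apply: lhomP => h.
  rewrite linear_sum lhom_sumE lE; apply: eq_bigr => s _.
  by rewrite /p dlift_inj -[LHS]/(dinj D s (h (c s))) cE.
have [q [qK Kq]] := linear_inverse pI pS.
by move=> e; apply: (Xt_retract_r (i := q) qK); apply: MC.
Qed.

(* As in the proof that a flat module has finite projective dimension over a ring
   with a dualizing module: the syzygies Y_k of Y with respect to direct sums of D
   all lie in [fac D], so that Ext^1(Y_n, Y_(n+1)) = Ext^(n+1)(Y, Y_(n+1)) = 0 and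
   Y_n is a summand of a direct sum of copies of D. *)
Lemma perp_hom_fac Y : fac D Y -> perp M (lhom Cd Y).
Proof.
have [fD _ _ DD] := semidualizingP sD.
suff: forall j Y, fac D Y -> (forall N, fac D N -> Xt j Y N) -> perp M (lhom Cd Y).
  by move=> /(_ n Y) + DY; apply=> // N; apply: fac_D_bound.
have cover X : fac D X -> exists (K : lmodType R) (i : {linear K -> dsum (lhom D X) D}),
    short_exact i (hom_cover D X) /\ fac D K.
  move=> DX; have sX := kernel_ses (hom_cover_surj DX).
  by exists (smod (kernel (hom_cover D X))), (sincl _); split=> //; apply: fac_syzygy sX.
move=> {Y} j; elim: j => [|j IH] Y DY YN e; have [K [i [iK DK]]] := cover Y DY.
  have [s sE] := Xt0_lift iK (YN _ DK) (lid Y).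
  apply: (Xt_retract_r (i := hom_post Cd s) (p := hom_post Cd (hom_cover D Y))).
    by move=> f; apply: lhomP => h; rewrite -[LHS]/(hom_cover D Y (s (f h))) sE.
  exact: perp_hom_dsum.
have sY : ses K (dsum (lhom D Y) D) Y by exists i, (hom_cover D Y).
apply: Xt_quot_r (perp_hom_dsum _ e) _.
  apply: ses_hom_post sY _.
  exact: (fac_Xt noeth (fg_Cd noeth sD sC) DK (perp_Cd_D noeth sD sC Dinj 0)).
apply: IH => // N DN; apply: Xt_sub sY _ (YN N DN).
exact/Xt_dsum/(fac_Xt noeth fD DN (DD j)).
Qed.

(** From C = Hom(Cd, D) tensor evaluation gives Hom(C, J) = Cd (x) Hom(D, J). By adjunction the
    module is Hom(Cd, Y) with Y = Hom(Hom(D, J), I), which lies in [fac D]. *)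
Lemma perp_double_dual J I : injective_module J -> injective_module I ->
  perp M (lhom (lhom C J) I).
Proof.
move=> JI II; have [fD _ _ DD] := semidualizingP sD.
have fCd := fg_Cd noeth sD sC.
have [p [pE Kp]] := C_bidual_inverse noeth sD sC Dinj.
have l1 (k : lhom (lhom C J) I) (a : Cd) : linear (fun h : lhom D J => k (h \o a : lhom C J)).
  by move=> r g h; rewrite -linearP; congr (k _); apply: lhomP.
have l2 k : linear (fun a : Cd => lin (l1 k a) : lhom (lhom D J) I).
  move=> r a b; apply: lhomP => h; rewrite -[RHS]/(r *: k (h \o a : lhom C J) + k (h \o b : lhom C J)).
  by rewrite -linearP; congr (k _); apply: lhomP => c; rewrite /= linearP.
have l3 : linear (fun k => lin (l2 k) : lhom Cd (lhom (lhom D J) I)).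
  by move=> r k l; apply: lhomP => a; apply: lhomP.
pose u := lin l3.
have uE k a h : u k a h = k (h \o a : lhom C J) by [].
have uI : injection u.
  apply: injection0 => k uk; apply: lhomP => g.
  have [m [a [h hE]]] := evh_span (g \o p) fCd JI.
  have -> : g = \sum_i ((h i : {linear D -> J}) \o (a i : {linear C -> D}) : lhom C J).
    by apply: lhomP => c; rewrite lhom_sumE -[in LHS](Kp c) -[LHS]/((g \o p) _) hE.
  by rewrite linear_sum big1 // => i _; rewrite -uE uk.
have uS : surjection u.
  move=> b; have [xi xiE] := evaluation noeth b fCd JI.
  exists (xi \o hom_pre J p : {linear lhom C J -> I}); apply: lhomP => a; apply: lhomP => h.
  rewrite uE xiE compE; congr (xi _); apply: lhomP => f.
  by rewrite evhE -pE.
have [v [uv vu]] := linear_inverse uI uS.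
move=> e; apply: (Xt_retract_r (i := u) vu).
exact: perp_hom_fac (fac_double_dual noeth fD JI II) e.
Qed.

(** Hom(C, -) keeps the injective coresolution of [D] exact; dualizing into [I] resolves Hom(Cd, I)
    by finitely many modules Hom(Hom(C, J), I), to which [perp_double_dual] applies. *)
Lemma perp_gor_I I : injective_module I -> perp M (lhom Cd I).
Proof.
move=> II; suff: forall m X, coarse (@opses R) (@is_zero R) (@injective_module R) m X ->
    perp M (lhom (lhom C X) I) by move=> /(_ n D Dinj).
move=> m X; elim=> [{m}{}X zX e|{m X} m Y J X sX JI cY IH e].
  apply/Xt_injective/is_zero_injective => k; apply: lhomP => h.
  have -> : h = 0 by apply: lhomP => c; apply: zX.
  by rewrite linear0.
have BX : bass C X.
  by apply: (@bass_injdim _ _ _ noeth sD sC n Dinj m.+1); apply: coarse_step sX JI cY.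
have sCX := ses_hom_post sX (bass_perp BX 0).
apply: Xt_quot_r (ses_hom_pre sCX (Xt_injective 0 _ II)) _ (IH e.+1).
exact: perp_double_dual.
Qed.

End Test.
End FiniteDimension.

(** * C-Gorenstein classes *)

Section RelativeClasses.
Variable R : comPzRingType.
Implicit Types K M N X Y P I E V W Z T : lmodType R.

Definition opXt e M N : Prop := @Xt R e N M.
Definition gor_proj K := gor (@ses R) (@Xt R) (P_ K).
Definition gor_inj K := gor (@opses R) opXt (I_ K).

Lemma P_zero K Z : is_zero Z -> P_ K Z.
Proof.
move=> Z0; exists Z, (fun _ _ => 0); split; first exact: is_zero_projective.
split=> [|X h [h1 h2]].
  by split=> [b a x y|a b x y]; rewrite scaler0 addr0.
exists (lzero Z X); split=> [a b|f _].
  have l : linear (h a) := h2 a; rewrite (Z0 b).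
  by rewrite -[h a 0]/(lin l 0) linear0.
by apply: lin_ext => x; rewrite (Z0 x) !linear0.
Qed.

Lemma P_prod K W W' : P_ K W -> P_ K W' -> P_ K (prodM W W').
Proof.
move=> [P [t [PP [[t1 t2] tU]]]] [P' [t' [PP' [[t1' t2'] tU']]]].
exists (prodM P P'), (fun c p => (t c (pfst P P' p), t' c (psnd P P' p)) : prodM W W').
split; first exact: projective_prod.
split=> [|X h [h1 h2]].
  split=> [p a c d|c a p q]; apply: prodM_ext.
  - by rewrite /= t1.
  - by rewrite /= t1'.
  - by rewrite /= t2.
  - by rewrite /= t2'.
have [|f [fE fU]] := tU X (fun c p => h c (ppair (lid P) (lzero P P') p)).
  split=> [p|c a p q]; first exact: h1.
  by rewrite linearP h2.
have [|f' [fE' fU']] := tU' X (fun c p => h c (ppair (lzero P' P) (lid P') p)).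
  split=> [p|c a p q]; first exact: h1.
  by rewrite linearP h2.
exists ((f \o pfst W W') \+ (f' \o psnd W W')); split=> [c p|g gE].
  have l : linear (h c) := h2 c.
  rewrite laddE !compE -[RHS]/(lin l p) [in RHS](prodM_gen p) linearD.
  exact: (congr2 +%R (fE c _) (fE' c _)).
have t0 c : t c 0 = 0.
  by have l : linear (t c) := t2 c; rewrite -[t c 0]/(lin l 0) linear0.
have t0' c : t' c 0 = 0.
  by have l : linear (t' c) := t2' c; rewrite -[t' c 0]/(lin l 0) linear0.
have -> : f = g \o ppair (lid W) (lzero W W').
  apply: fU => c p; rewrite compE -gE; congr (g _).
  by apply: prodM_ext; rewrite /= ?t0'.
have -> : f' = g \o ppair (lzero W' W) (lid W').
  apply: fU' => c p; rewrite compE -gE; congr (g _).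
  by apply: prodM_ext; rewrite /= ?t0.
by apply: lin_ext => x; rewrite laddE !compE -linearD -prodM_gen.
Qed.

Lemma fliftE (S : choiceType) M (m : S -> M) p :
  flift m p = \sum_(s <- dsupp p) (dcomp R^o s p : R) *: m s.
Proof. by []. Qed.

Lemma flift_dinj_linear (S : choiceType) K p :
  linear (fun c => flift (fun s : S => dinj K s c) p).
Proof.
move=> a c d; rewrite !fliftE scaler_sumr -big_split; apply: eq_bigr => s _.
by rewrite [dinj K s _]linearP scalerDr !scalerA mulrC.
Qed.

Lemma P_dsum K (S : choiceType) : P_ K (dsum S K).
Proof.
have tl2 c : linear (flift (fun s : S => dinj K s c)) by move=> a p q; rewrite linearP.
exists (free_mod R S), (fun c => flift (fun s : S => dinj K s c)).
split; first exact: projective_free.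
split=> [|X h [h1 h2]].
  by split=> [p|//]; apply: flift_dinj_linear.
have l1 s : linear (fun c => h c (fbase R s)) := h1 (fbase R s).
exists (dlift (fun s => lin (l1 s))); split=> [c p|g gE].
  have l2 : linear (h c) := h2 c.
  apply: (free_ext (f := dlift (fun s => lin (l1 s)) \o flift (fun s : S => dinj K s c))
                   (g := lin l2)) => s.
  by rewrite compE flift_base dlift_inj.
apply: lin_ext; apply: dsum_ext => s c.
by rewrite dlift_inj linE -gE flift_base.
Qed.

(** [P] is a retract of the free module on its own elements, so K (x) P is one of the corresponding
    sum of copies of [K]. Uniqueness in the universal property shows that the composite is the
    identity. *)
Lemma P_retract K W : P_ K W -> exists (S : choiceType) (i : {linear W -> dsum S K})
  (p : {linear dsum S K -> W}), forall x, p (i x) = x.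
Proof.
move=> [P [t [PP [[t1 t2] tU]]]].
pose q : {linear free_mod R P -> P} := flift idfun.
have [j jE] := projective_split PP (@flift_surj R P).
have hl2 c : linear (fun x => flift (fun s : P => dinj K s c) (j x)).
  by move=> a x y; rewrite !linearP.
have [|i [iE _]] := tU (dsum P K) (fun c x => flift (fun s : P => dinj K s c) (j x)).
  by split=> [x|//]; apply: flift_dinj_linear.
have l1 (s : P) : linear (fun c => t c s) := t1 s.
exists P, i, (dlift (fun s => lin (l1 s))).
have [f [_ fU]] := tU W t (conj t1 t2).
have e1 : f = lid W by apply: fU.
have e2 : f = dlift (fun s => lin (l1 s)) \o i.
  apply: fU => c x; rewrite compE iE -[in RHS](jE x).
  have l2 : linear (t c) := t2 c.
  apply: (free_ext (f := dlift (fun s => lin (l1 s)) \o flift (fun s : P => dinj K s c))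
                   (g := lin l2 \o q)) => s.
  by rewrite !compE !flift_base dlift_inj.
by move=> x; rewrite -compE -e2 e1.
Qed.

Lemma perp_P K N W : perp K N -> P_ K W -> perp W N.
Proof.
move=> KN /P_retract[S [i [p pi]]] e.
by apply: (Xt_retract_l pi); apply/Xt_dsum/KN.
Qed.

Lemma orth_P_P K : noetherian R -> finitely_generated K -> perp K K ->
  orth (@Xt R) (P_ K) (P_ K).
Proof.
move=> noeth fK KK e W W' PW /P_retract[S [i [p pi]]].
apply: (Xt_retract_r pi); apply: (perp_P _ PW) => d.
exact: (fac_Xt noeth fK (@fac_dsum R S K) (KK d)).
Qed.

Lemma I_zero K Z : is_zero Z -> I_ K Z.
Proof.
move=> Z0; exists (zeroM R); split; first exact/is_zero_injective/zeroMP.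
apply/isomorphicP; exists (lzero Z _); split=> [x y _|h].
  by rewrite (Z0 x) (Z0 y).
by exists 0; apply: lhomP => x; rewrite (zeroMP (h x)); apply: zeroMP.
Qed.

Lemma I_prod K V V' : I_ K V -> I_ K V' -> I_ K (prodM V V').
Proof.
move=> [I [II /isomorphicP[f [fI fS]]]] [I' [II' /isomorphicP[f' [fI' fS']]]].
exists (prodM I I'); split.
  move=> A B i g iI.
  have [h hE] := II _ _ i (pfst I I' \o g) iI.
  have [h' hE'] := II' _ _ i (psnd I I' \o g) iI.
  by exists (ppair h h') => x; apply: prodM_ext; rewrite /= ?hE ?hE'.
have l : linear (fun v : prodM V V' => ppair (f (pfst V V' v)) (f' (psnd V V' v))
    : lhom K (prodM I I')).
  by move=> a v w; apply: lhomP => x; apply: prodM_ext; rewrite /= !linearP.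
apply/isomorphicP; exists (lin l); split.
  apply: injection0 => v /lhom_at e; apply: prodM_ext; rewrite linear0.
    apply: fI; rewrite linear0; apply: lhomP => x.
    by have /(congr1 (pfst I I')) := e x.
  apply: fI'; rewrite linear0; apply: lhomP => x.
  by have /(congr1 (psnd I I')) := e x.
move=> h; have [v vE] := fS (pfst I I' \o h); have [v' vE'] := fS' (psnd I I' \o h).
exists (v, v'); apply: lhomP => x; apply: prodM_ext.
  by rewrite -[LHS]/(f v x) vE.
by rewrite -[LHS]/(f' v' x) vE'.
Qed.

Lemma perp_I_r K M : (forall I, injective_module I -> perp M (lhom K I)) ->
  forall V, I_ K V -> perp M V.
Proof.
move=> MI V [I [II /isomorphicP[f [fI fS]]]] e.
have [g [_ gf]] := linear_inverse fI fS.
by apply: (Xt_retract_r gf); apply: MI.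
Qed.

Lemma perp_I_l K N : (forall I, injective_module I -> perp (lhom K I) N) ->
  forall V, I_ K V -> perp V N.
Proof.
move=> IN V [I [II /isomorphicP[f [fI fS]]]] e.
have [g [_ gf]] := linear_inverse fI fS.
by apply: (Xt_retract_l gf); apply: IN.
Qed.

(** From left to right [GP_ K] itself is the witness class: the cokernel of M -> K (x) P^0 is again
    in it, Ext^1 vanishing because maps M -> W extend along the coresolution. Conversely [rbuild]
    strings the steps together, and Hom(-, W)-exactness is Ext^1 = 0 on the cosyzygies. *)
Lemma gor_projP K M : orth (@Xt R) (P_ K) (P_ K) -> GP_ K M <-> gor_proj K M.
Proof.
move=> PP; split=> [gM|[Cl [CM Cstep]]].
  exists (GP_ K); split=> // {gM}M [Mperp [L [Lex LP Lac]]].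
  have MW e W : P_ K W -> Xt e M W by move=> PW; apply/Ext_eq0_Xt; apply: Mperp.
  split=> [e V|]; first exact: MW.
  have [K' [q [i [sL iq Kex]]]] := rshift Lex.
  exists (robj L 0), K'; split=> //; last by exists (raug L), q.
  split=> [[//|e] W _ PW|].
    apply/Ext_eq0_Xt; case: e => [|e].
      apply: (Xt0_quot sL); last exact: PP.
      move=> h; have [aS _ _] := Lac W PW; have [k kh] := aS h.
      by exists k => x; rewrite -kh.
    apply: Xt_quot (MW e W PW) (PP _ _ _ (LP 0) PW).
    by exists (raug L), q.
  exists (RSeq (fun n => rdiff L n.+1) i); split=> //= W PW.
  have [aS aE dE] := Lac W PW; have [_ sE qS] := sL.
  have diE (g : lhom (robj L 1) W) : hom_pre W (rdiff L 0) g = hom_pre W q (hom_pre W i g).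
    by apply: lhomP => x; rewrite -[LHS]/(g (rdiff L 0 x)) -iq.
  have qI : injection (hom_pre W q).
    move=> g h gh; apply: lhomP => x; have [y <-] := qS x; exact: (lhom_at gh y).
  split=> [h|g|n]; last exact: dE.
    have /aE[g gE] : hom_pre W (raug L) (hom_pre W q h) = 0.
      apply: lhomP => x; rewrite -[LHS]/(h (q (raug L x))).
      by rewrite (exact_comp0 sE) linear0.
    by exists g; apply: qI; apply: (etrans (esym (diE g)) gE).
  apply: (iff_trans _ (dE 0 (g : lhom (robj L 1) W))); split=> [g0|g0].
    by apply: (etrans (diE g)); rewrite (g0 : hom_pre W i g = 0) linear0.
  by apply: qI; rewrite linear0; apply: etrans (esym (diE g)) g0.
have [||L [Z [f [g [s q0 q]]]]] := @rbuild R Cl (fun M X K' => P_ K X /\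
    forall e W, P_ K W -> Xt e K' W) _ M => //.
  move=> N /Cstep[NP [V [N' [PV CN' sN]]]]; exists V, N'; split=> //; split=> //.
  by have [] := Cstep _ CN'.
split=> [[//|e] W _ PW|]; first by apply/Ext_eq0_Xt; have [+ _] := Cstep M CM; apply.
exists L; split; [exact: rsyz_exact s | by case=> [|n]; [case: q0|case: (q n)] |].
move=> W PW; have [s0 sS sd] := s; apply: (rsyz_hom_pre s).
  by move=> h; apply: Xt0_extend s0 h; have [_] := q0; apply.
by move=> n h; apply: Xt0_extend (sS n) h; have [_] := q n; apply.
Qed.

(** The mirror image of [gor_projP]. As [GP_] and [GI_] speak of explicit sequences running in
    opposite directions, [ext_structure_op] does not transfer one to the other. *)
Lemma gor_injP K N : orth opXt (I_ K) (I_ K) -> GI_ K N <-> gor_inj K N.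
Proof.
move=> II; split=> [gN|[Cl [CN Cstep]]].
  exists (GI_ K); split=> // {gN}N [Nperp [L [Lex LI Lac]]].
  have VN e V : I_ K V -> Xt e V N by move=> IV; apply/Ext_eq0_Xt; apply: Nperp.
  split=> [e V|]; first exact: VN.
  have [K' [i [q [sL iq Kex]]]] := lshift Lex.
  exists (lobj L 0), K'; split=> //; last by exists i, (laug L).
  split=> [[//|e] V _ IV|].
    apply/Ext_eq0_Xt; case: e => [|e].
      apply: (Xt0_sub_r sL); last exact: (II 0 _ _ (LI 0) IV).
      move=> h; have [aS _ _] := Lac V IV; have [k kh] := aS h.
      by exists k => x; rewrite -kh.
    by apply: Xt_sub_r (VN e V IV) (II e.+1 _ _ (LI 0) IV); exists i, (laug L).
  exists (LSeq (fun n => ldiff L n.+1) q); split=> //= V IV.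
  have [aS aE dE] := Lac V IV; have [iI sE _] := sL.
  have diE (g : lhom V (lobj L 1)) : hom_post V (ldiff L 0) g = hom_post V i (hom_post V q g).
    by apply: lhomP => x; rewrite -[LHS]/(ldiff L 0 (g x)) -iq.
  have iJ : injection (hom_post V i).
    by move=> g h gh; apply: lhomP => x; apply: iI; apply: (lhom_at gh x).
  split=> [h|g|n]; last exact: dE.
    have /aE[g gE] : hom_post V (laug L) (hom_post V i h) = 0.
      apply: lhomP => x; rewrite -[LHS]/(laug L (i (h x))).
      exact: exact_comp0 sE _.
    by exists g; apply: iJ; apply: (etrans (esym (diE g)) gE).
  apply: (iff_trans _ (dE 0 (g : lhom V (lobj L 1)))); split=> [g0|g0].
    by apply: (etrans (diE g)); rewrite (g0 : hom_post V q g = 0) linear0.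
  by apply: iJ; rewrite linear0; apply: etrans (esym (diE g)) g0.
have [||L [Z [f [g [s q0 q]]]]] := @lbuild R Cl (fun K' X N => I_ K X /\
    forall e V, I_ K V -> Xt e V K') _ N => //.
  move=> M /Cstep[NI [V [N' [IV CN' sN]]]]; exists N', V; split=> //; split=> //.
  by have [] := Cstep _ CN'.
split=> [[//|e] V _ IV|]; first by apply/Ext_eq0_Xt; have [+ _] := Cstep N CN; apply.
exists L; split; [exact: lsyz_exact s | by case=> [|n]; [case: q0|case: (q n)] |].
move=> V IV; have [s0 sS sd] := s; apply: (lsyz_hom_post s).
  by move=> h; apply: Xt0_lift s0 _ h; have [_] := q0; apply.
by move=> n h; apply: Xt0_lift (sS n) _ h; have [_] := q n; apply.
Qed.

Lemma wedge_self (Cl : lmodType R -> Prop) M : Cl M -> wedge Cl M.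
Proof.
move=> CM; pose Lz := @LSeq R (zeroM R) (fun=> zeroM R) (fun=> lid _) (lid _).
exists 0, (lcons (lzero (zeroM R) M) (lid M) Lz); split; last 1 first.
- by case=> // k _; apply: zeroMP.
- apply: lcons_exact.
    split=> [x y _|b|y]; first by rewrite (zeroMP x) (zeroMP y).
      by split=> [/= ->|[a <-]] //; exists 0.
    by exists y.
  have z0 (x y : zeroM R) : x = y by rewrite (zeroMP x) (zeroMP y).
  by split=> [y|b|n b]; [exists y| split=> _; [exists 0|] .. ].
by case.
Qed.

Lemma vee_self (Cl : lmodType R -> Prop) M : Cl M -> vee Cl M.
Proof.
move=> CM; pose o n : lmodType R := if n is 0 then M else zeroM R.
exists 0, (@RSeq R M o (fun n => lzero (o n) (o n.+1)) (lid M)); split; last 1 first.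
- by case=> // k _; apply: zeroMP.
- split=> // [b|n b]; first by split=> // _; exists b.
  by split=> [_|[a <-]] //; exists 0; rewrite linear0 (zeroMP b).
by case.
Qed.

End RelativeClasses.

(** * Orthogonality of the Gorenstein classes and balanced resolutions *)

Section Main.
Variables (R : comPzRingType) (D C : lmodType R).
Implicit Types K M N X Y P I E V W Z T : lmodType R.

Hypothesis noeth : noetherian R.
Hypothesis sD : semidualizing D.
Hypothesis sC : semidualizing C.
Variable n : nat.
Hypothesis Dinj : coarse (@opses R) (@is_zero R) (@injective_module R) n D.

Let Cd : lmodType R := lhom C D.
Let GP := gor_proj C.
Let GI := gor_inj Cd.
Let ES := @module_ext_structure R.
Let ES' := ext_structure_op ES.

Lemma P_perp_P : orth (@Xt R) (P_ C) (P_ C).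
Proof. by have [fC _ _ CC] := semidualizingP sC; apply: orth_P_P. Qed.

Lemma I_perp_I : orth (@opXt R) (I_ Cd) (I_ Cd).
Proof.
move=> e V V' IV IV'; rewrite /opXt.
apply: (perp_I_l _ IV') => J JI.
apply: (perp_I_r _ IV) => I II; exact: (perp_I_I noeth sD sC Dinj II JI).
Qed.

Lemma GP_perp_I : orth (@Xt R) GP (I_ Cd).
Proof.
move=> e M V gM IV; have [MP _] := gor_step gM; apply: (perp_I_r _ IV) => I II.
apply: (perp_gor_I noeth sD sC Dinj _ II) => S d.
by apply: MP; apply: P_dsum.
Qed.

Lemma P_perp_GI : orth (@Xt R) (P_ C) GI.
Proof.
move=> e W N PW gN; have [IN _] := gor_step gN; apply: (perp_P _ PW).
apply: (perp_C_of_I noeth sD sC Dinj) => I II d; apply: IN.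
by exists I; split=> //; apply/isomorphicP; exists (lid _); split=> [x y|y]; [| exists y].
Qed.

Lemma fin_P_perp_I : orth (@Xt R) (fin_left (P_ C)) (I_ Cd).
Proof.
move=> e H V cH IV; apply: (perp_I_r _ IV) => I II.
exact: (perp_fin_left noeth sD sC Dinj II cH).
Qed.

Lemma P_perp_fin_I : orth (@Xt R) (P_ C) (fin_right (I_ Cd)).
Proof.
move=> e W N PW [m cN]; apply: (perp_P _ PW).
apply: (perp_C_fin_right noeth sD sC Dinj); exists m.
elim: cN => [Z zZ|k K V X sX [I [II IV]] _ IH]; first exact: coarse_zero.
by apply: coarse_step sX _ IH; exists I.
Qed.

Lemma fin_GP_perp_I : orth (@Xt R) (fin_left GP) (I_ Cd).
Proof.
apply: (gor_fin_res_orth ES (@P_zero R C) (@P_prod R C) P_perp_P GP_perp_I).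
exact: fin_P_perp_I.
Qed.

Lemma fin_P_perp_GI : orth (@Xt R) (fin_left (P_ C)) GI.
Proof.
apply: (fin_res_generated ES _ P_perp_GI fin_P_perp_I).
by move=> N gN; have [_ [V [N' [IV gN' sN]]]] := gor_step gN; exists V, N'.
Qed.

Lemma P_perp_fin_GI : orth (@Xt R) (P_ C) (fin_right GI).
Proof.
move=> e W N PW cN.
apply: (gor_fin_res_orth ES' (@I_zero R Cd) (@I_prod R Cd) I_perp_I (G := P_ C)) cN PW.
  by move=> d A B gA PB; apply: P_perp_GI.
by move=> d A B gA PB; apply: P_perp_fin_I.
Qed.

Lemma GP_perp_fin_I : orth (@Xt R) GP (fin_right (I_ Cd)).
Proof.
move=> e M N gM cN.
apply: (fin_res_generated ES' (C := I_ Cd) (D := P_ C) (G := GP)) cN gM.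
- by move=> K gK; have [_ [V [K' [PV gK' sK]]]] := gor_step gK; exists V, K'.
- by move=> d A B IA gB; apply: GP_perp_I.
by move=> d A B cA PB; apply: P_perp_fin_I.
Qed.

Lemma GP_perp_fin_P : orth (@Xt R) GP (fin_left (P_ C)).
Proof. exact: (fin_res_orthr ES (@gor_orth _ _ _ (P_ C))). Qed.

Lemma fin_I_perp_GI : orth (@Xt R) (fin_right (I_ Cd)) GI.
Proof.
move=> e M N cM gN.
apply: (fin_res_orthr ES' (C := GI) (D := I_ Cd)) gN cM.
exact: gor_orth.
Qed.

(** Iterated Auslander-Buchweitz covers: each kernel has a finite [P_ C]-resolution, so it is in
    [fin_left GP] and has a cover again. Properness is Ext^1(GP, kernel) = 0. *)
Lemma balanced_left M : fin_left GP M -> exists L : lseq M,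
  [/\ lcomplex L, forall k, GP (lobj L k), covariant_acyclic_l GP L &
      contravariant_acyclic_l GI L].
Proof.
move=> fM.
have [|L [Z [f [g [s q0 q]]]]] := @lbuild R (fin_left GP)
    (fun K X M => [/\ GP X, fin_left (P_ C) K & fin_left GP M]) _ M fM.
  move=> N fN; have [[K [X [sN fK gX]]] _] :=
    gor_approx ES (@P_zero R C) (@P_prod R C) P_perp_P fN.
  by exists K, X; split=> //; apply: (fin_res_gor ES (@P_zero R C) P_perp_P).
have [s0 sS sd] := s; have [gX0 fZ0 _] := q0.
exists L; split.
- exact/lexact_lcomplex/(lsyz_exact s).
- by case=> // k; case: (q k).
- move=> T gT; apply: (lsyz_hom_post s).
    by move=> h; apply: Xt0_lift s0 _ h; apply: GP_perp_fin_P.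
  move=> k h; apply: Xt0_lift (sS k) _ h; apply: GP_perp_fin_P => //.
  by case: (q k).
move=> N gN; apply: (lsyz_hom_pre s).
(* No vanishing of Ext^1(Y, N) is at hand. Instead a map K -> N is lifted to [V] along 0 -> N' -> V
   -> N -> 0 by Ext^1(K, N') = 0, extended to [X] by Ext^1(Y, V) = 0, and composed with V -> N. *)
have ext K X Y (a : {linear K -> X}) (b : {linear X -> Y}) : short_exact a b ->
    fin_left (P_ C) K -> fin_left GP Y -> hom_ext N a.
  move=> ab fK fY h; have [_ [V [N' [IV gN' [i [p ip]]]]]] := gor_step gN.
  have [h' hE] := Xt0_lift ip (fin_P_perp_GI 0 fK gN') h.
  have [k kE] := Xt0_extend (fin_GP_perp_I 0 fY IV) ab h'.
  by exists (p \o k) => x; rewrite compE kE.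
case=> [|k]; first by apply: ext s0 fZ0 fM.
by have [_ fK fY] := q k; apply: ext (sS k) fK fY.
Qed.

Lemma balanced_right N : fin_right GI N -> exists L : rseq N,
  [/\ rcomplex L, forall k, GI (robj L k), contravariant_acyclic_r GI L &
      covariant_acyclic_r GP L].
Proof.
move=> fN.
have [|L [Z [f [g [s q0 q]]]]] := @rbuild R (fin_right GI)
    (fun M X K => [/\ GI X, fin_right (I_ Cd) K & fin_right GI M]) _ N fN.
  move=> M fM; have [[K [X [sM fK gX]]] _] :=
    gor_approx ES' (@I_zero R Cd) (@I_prod R Cd) I_perp_I fM.
  by exists X, K; split=> //; apply: (fin_res_gor ES' (@I_zero R Cd) I_perp_I).
have [s0 sS sd] := s; have [gX0 fZ0 _] := q0.
exists L; split.
- exact/rexact_rcomplex/(rsyz_exact s).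
- by case=> // k; case: (q k).
- move=> T gT; apply: (rsyz_hom_pre s).
    by move=> h; apply: Xt0_extend _ s0 h; apply: fin_I_perp_GI.
  move=> k h; apply: Xt0_extend _ (sS k) h; apply: fin_I_perp_GI => //.
  by case: (q k).
move=> T gT; apply: (rsyz_hom_post s).
(* Dually, a map T -> Y is extended to [V] in [P_ C] along 0 -> T -> V -> T' -> 0, lifted to [X] by
   Ext^1(V, K) = 0, and restricted to [T]. *)
have lift K X Y (a : {linear K -> X}) (b : {linear X -> Y}) : short_exact a b ->
    fin_right (I_ Cd) Y -> fin_right GI K -> hom_onto T b.
  move=> ab fY fK h; have [_ [V [T' [PV gT' [i [p ip]]]]]] := gor_step gT.
  have [h' hE] := Xt0_extend (GP_perp_fin_I 0 gT' fY) ip h.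
  have [k kE] := Xt0_lift ab (P_perp_fin_GI 0 PV fK) h'.
  by exists (k \o i) => x; rewrite compE kE.
case=> [|k]; first by apply: lift s0 fZ0 fN.
by have [_ fY fK] := q k; apply: lift (sS k) fY fK.
Qed.

End Main.

Lemma fin_res_mono T (S : T -> T -> T -> Prop) zero (A B : T -> Prop) M :
  (forall M, A M -> B M) -> fin_res S zero A M -> fin_res S zero B M.
Proof.
move=> AB [n cM]; exists n; elim: cM => [Z zZ|k K X N sN AX _ IH].
  exact: coarse_zero.
by apply: coarse_step sN (AB _ AX) IH.
Qed.

Lemma orth_Ext (R : comPzRingType) (A B A' B' : lmodType R -> Prop) :
  orth (@Xt R) A B -> (forall M, A' M -> A M) -> (forall M, B' M -> B M) ->
  forall i, (1 <= i)%N -> Ext_class_eq0 i A' B'.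
Proof.
move=> AB AA BB [//|e] _ M N /AA AM /BB BN; exact/Ext_eq0_Xt/AB.
Qed.

Theorem proposition4p13 (R : comPzRingType) (D C : lmodType R) :
  cohen_macaulay R -> dualizing D -> semidualizing C ->
  let Cdag : lmodType R := lhom C D in
  strong_finite_balanced_system (GP_ C) (P_ C) (I_ Cdag) (GI_ Cdag) /\
  balanced_pair (GP_ C) (GI_ Cdag) (wedge (GP_ C)) (vee (GI_ Cdag)).
Proof.
move=> [noeth _] [sD /vee_fin_right[n Dinj]] sC Cdag.
have ES := @module_ext_structure R; have ES' := ext_structure_op ES.
have PP := P_perp_P noeth sC; have II := I_perp_I noeth sD sC Dinj.
have GPE M := gor_projP M PP; have GIE N := gor_injP N II.
have PGP : subclass (P_ C) (GP_ C).
  by move=> W PW; apply/GPE/(sub_gor ES (@P_zero R C) PP).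
have IGI : subclass (I_ Cdag) (GI_ Cdag).
  by move=> V IV; apply/GIE/(sub_gor ES' (@I_zero R Cdag) II).
have wGP M : wedge (GP_ C) M -> fin_left (gor_proj C) M.
  by move=> /wedge_fin_left; apply: fin_res_mono => N /GPE.
have vGI N : vee (GI_ Cdag) N -> fin_right (gor_inj Cdag) N.
  by move=> /vee_fin_right; apply: fin_res_mono => M /GIE.
have toGP M : GP_ C M -> gor_proj C M by move=> /GPE.
have toGI N : GI_ Cdag N -> gor_inj Cdag N by move=> /GIE.
have bl M : wedge (GP_ C) M -> exists L : lseq M,
    proper_left_resolution (GP_ C) L /\ contravariant_acyclic_l (GI_ Cdag) L.
  move=> /wGP/(balanced_left noeth sD sC Dinj)[L [cL gL La Lb]]; exists L; split.
    by split=> // [k|X /GPE]; [apply/GPE | apply: La].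
  by move=> Y /GIE; apply: Lb.
have br N : vee (GI_ Cdag) N -> exists L : rseq N,
    proper_right_resolution (GI_ Cdag) L /\ covariant_acyclic_r (GP_ C) L.
  move=> /vGI/(balanced_right noeth sD sC Dinj)[L [cL gL La Lb]]; exists L; split.
    by split=> // [k|Y /GIE]; [apply/GIE | apply: La].
  by move=> X /GPE; apply: Lb.
split; last first.
  split=> //; split.
  - by move=> M; apply: wedge_self.
  - by move=> M /bl[L [pL _]]; exists L.
  - by move=> N; apply: vee_self.
  - by move=> N /br[L [pL _]]; exists L.
split; [split | | ].
- split=> [Z zZ|A B X f g fg gA gX]; first by apply/PGP/P_zero.
  apply/GPE; apply: (gor_extension ES (@P_prod R C)) (toGP _ gA) (toGP _ gX).
  by exists f, g.
- split=> [Z zZ|A B X f g fg gA gX]; first by apply/IGI/I_zero.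
  apply/GIE; apply: (gor_extension ES' (@I_prod R Cdag)) (toGI _ gX) (toGI _ gA).
  by exists f, g.
- split; last first.
    by apply: orth_Ext toGP (fun _ => id); apply: gor_orth.
  split=> // M gM; have [_ [V [K [PV gK [f [g fg]]]]]] := gor_step (toGP M gM).
  by exists V, K, f, g; split=> //; apply/GPE.
- split; last first.
    apply: orth_Ext (fun _ => id) toGI => e V N IV gN; exact: (gor_orth e gN IV).
  split=> // N gN; have [_ [V [K [IV gK [f [g fg]]]]]] := gor_step (toGI N gN).
  by exists V, K, f, g; split=> //; apply/GIE.
- split.
    exact: orth_Ext (fin_GP_perp_I noeth sD sC Dinj) wGP (fun _ => id) 1%N isT.
  exact: orth_Ext (fin_P_perp_GI noeth sD sC Dinj) (@wedge_fin_left R (P_ C)) toGI 1%N isT.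
- split.
    exact: orth_Ext (P_perp_fin_GI noeth sD sC Dinj) (fun _ => id) vGI 1%N isT.
  exact: orth_Ext (GP_perp_fin_I noeth sD sC Dinj) toGP (@vee_fin_right R (I_ Cdag)) 1%N isT.
- exact: orth_Ext (P_perp_GI noeth sD sC Dinj) (fun _ => id) toGI.
exact: orth_Ext (GP_perp_I noeth sD sC Dinj) toGP (fun _ => id).
Qed.
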